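(* For any nearly-Kähler structure of Type I (see context), with orbit space $\Sigma=M/G$ of the principal locus viewed as a Riemann surface with metric $g_\Sigma$, local holomorphic coordinate $z$, and functions $f,g\colon\Sigma\to\mathbb{C}$, $u\colon\Sigma\to\mathbb{R}$ defined (on the coordinate domain) by $\overline{p}_4\,\eta=\varpi^*(f\,dz)$, $\overline{r}\,\eta^3=\varpi^*(g\,dz^3)$ and $e^{2u}\,\eta\circ\overline\eta=\varpi^*(dz\circ d\overline z)$, the functions $f,g,u$ satisfy the quasilinear elliptic PDE system $$\frac{\partial f}{\partial\overline z}=-6|f|^2-\tfrac32e^{-2u},$$ $$\frac{\partial g}{\partial\overline z}=5i f^2e^{-2u}-\overline f g,$$ $$\Delta u=-2\left(6+|g|^2e^{6u}-|f|^2e^{2u}\right),$$ where $\Delta=-\ast d\ast d$ is the Hodge Laplacian of $g_\Sigma$ on functions.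
   Context: Nearly-Kähler structure. An $\mathrm{SU}(3)$-structure on a $6$-manifold $M$ is a pair $(\Omega,\Upsilon)$, $\Omega\in\Omega^2(M)$, $\Upsilon\in\Omega^3(M;\mathbb{C})$, such that at each $x$ there is a linear isomorphism $u\colon T_xM\to\mathbb{R}^6$ with $\Omega|_x=u^*(dx^1\wedge dx^4+dx^2\wedge dx^5+dx^3\wedge dx^6)$, $\Upsilon|_x=u^*(dz^1\wedge dz^2\wedge dz^3)$, $z^j=x^j+ix^{j+3}$. These $u$ (the $\mathrm{SU}(3)$-coframes) form a principal $\mathrm{SU}(3)$-bundle $B\to M$; they determine a Riemannian metric and an almost-complex structure $J$ by pullback from $\mathbb{R}^6=\mathbb{C}^3$. The structure is nearly-Kähler if $d\Omega=3\,\mathrm{Im}(\Upsilon)$ and $d\,\mathrm{Re}(\Upsilon)=2\,\Omega\wedge\Omega$. Symmetry. $M$ is acted on by a connected Lie group $G$ (faithfully, closed in the isometry group), with cohomogeneity two, preserving $(J,\Omega,\Upsilon)$, with coisotropic principal orbits (i.e. $\Omega\wedge\Omega$ vanishes on the $4$-dimensional principal orbits). $M$ always denotes the principal locus (union of principal $G$-orbits). Adapted frames. Let $P=\{u\in B: u(T_xGx)=\mathrm{span}(e_3,e_4,e_5,e_6)\}$, a principal $\mathrm{O}(2)$-bundle $\pi\colon P\to M$, with tautological $1$-form $\omega=(\omega^1,\dots,\omega^6)$, $\omega(v)=u(\pi_*v)$ for $v\in T_uP$. Put $\eta=\omega^1+i\omega^2$, $\theta=\omega^4+i\omega^5$. There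 are unique $1$-forms $\alpha,\xi_0$ (real) and $\xi_1,\xi_2,\xi_3$ (complex) on $P$ with $$d\eta=i\alpha\wedge\eta-2i\xi_1\wedge\omega^3+\xi_0\wedge\theta+\xi_3\wedge\overline\theta+2\xi_2\wedge\omega^6+i(-\eta\wedge\omega^3+\theta\wedge\omega^6),$$ $$d\omega^3=-i\overline\xi_1\wedge\eta+i\xi_1\wedge\overline\eta+\overline\xi_2\wedge\theta+\xi_2\wedge\overline\theta-2\xi_0\wedge\omega^6+\tfrac i2(\eta\wedge\overline\eta-\theta\wedge\overline\theta),$$ $$d\theta=-\xi_0\wedge\eta-\xi_3\wedge\overline\eta-2\xi_2\wedge\omega^3+i\alpha\wedge\theta-2i\xi_1\wedge\omega^6+i(-\omega^3\wedge\theta+\eta\wedge\omega^6),$$ $$d\omega^6=-\overline\xi_2\wedge\eta-\xi_2\wedge\overline\eta+2\xi_0\wedge\omega^3-i\overline\xi_1\wedge\theta+i\xi_1\wedge\overline\theta+\tfrac i2(\overline\theta\wedge\eta-\theta\wedge\overline\eta).$$ Torsion functions. There are unique $G$-invariant functions $p_1,p_2,p_3,p_4,q_1,q_2,r\colon P\to\mathbb{C}$ and $h_1,h_2,h_3,h_4\colon P\to\mathbb{R}$ with $$2\xi_1=h_1\eta-ih_2\theta+q_1\overline\theta+p_1\omega^3+p_2\omega^6,\qquad 2\xi_2=ih_4\eta+(h_3-i)\theta+q_2\overline\theta-ip_2\omega^3+p_3\omega^6,$$ $$\xi_3=p_4\theta-ir\overline\theta-iq_1\omega^3+q_2\omega^6,\qquad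 \xi_0=\overline p_4\theta+p_4\overline\theta-h_2\omega^3+h_3\omega^6.$$ Put $s_1=(h_1+3)+ih_3$, $s_2=h_2+ih_4$. $M$ is of Type I if $q_1=q_2=s_1=s_2=0$ on $P$. Orbit space. $\eta\circ\overline\eta=(\omega^1)^2+(\omega^2)^2$ descends to a Riemannian metric $g_\Sigma$ on $\Sigma=M/G$; $\varpi\colon F\to\Sigma$ denotes its orthonormal coframe bundle, whose complex-valued tautological form is also denoted $\eta$ (it pulls back to $\eta$ under the natural map $P\to F$). The complex structure of $\Sigma$ is the one for which a complex $1$-form $\sigma$ is of type $(1,0)$ iff $\varpi^*\sigma\in\mathrm{span}_{\mathbb{C}}(\eta)$; here one works locally with an orientation of $\Sigma$ and the corresponding $\mathrm{SO}(2)$-subbundles. The $G$-invariant functions $p_4$ and $r$ are regarded as functions on $F$; the forms $\overline p_4\eta$ and $\overline r\eta^3$ descend to sections of $K_\Sigma$ and $K_\Sigma^{\otimes 3}$, where $K_\Sigma=\Lambda^{1,0}(\Sigma)$. In particular $g_\Sigma=e^{-2u}dz\circ d\overline z$. *)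

(* Defs.v *)
From HB Require Import structures.
From mathcomp Require Import all_boot all_order all_algebra all_fingroup.
From mathcomp Require Import all_classical all_reals all_analysis.
From mathcomp Require Import complex.
Set Implicit Arguments.
Unset Strict Implicit.
Unset Printing Implicit Defensive.
Import Order.TTheory GRing.Theory Num.Theory.
Import numFieldNormedType.Exports.
Local Open Scope classical_set_scope.
Local Open Scope ring_scope.

Definition partial (R : realType) k (i : 'I_k) (phi : 'rV[R]_k -> R) :
    'rV[R]_k -> R :=
  fun a => 'D_(delta_mx 0 i) (phi : 'rV[R]_k -> R^o) a.

(* All iterated partials of order <= n exist and are Fréchet differentiable on
   A; for all n together this is C^infinity on the open set A. *)
Fixpoint Cn_on (R : realType) k (n : nat) (A : set 'rV[R]_k)
    (phi : 'rV[R]_k -> R) : Prop :=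
  (forall a, A a -> differentiable (phi : 'rV[R]_k -> R^o) a) /\
  match n with
  | 0 => True
  | n'.+1 => forall i, Cn_on n' A (partial i phi)
  end.

Definition Cinf_on (R : realType) k (A : set 'rV[R]_k) (phi : 'rV[R]_k -> R) :=
  forall n, Cn_on n A phi.

(* Smooth manifolds are presented by their algebras of smooth functions: a set
   with a family of real functions, subject to the axioms [manifold].  The
   topology is the initial one for the family. *)
Record fspace (R : realType) := FSpace {
  pt :> Type;
  Cinfty : set (pt -> R) }.

Definition jointly (R : realType) T k (g : 'I_k -> T -> R) (y : T) : 'rV[R]_k :=
  \row_i g i y.

Definition nearby (R : realType) (X : fspace R) (x : X) (Q : set X) : Prop :=
  exists k (g : 'I_k -> X -> R) (A : set 'rV[R]_k),
    [/\ forall i, Cinfty (g i), open A, A (jointly g x) &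
        forall y, A (jointly g y) -> Q y].

Definition fopen (R : realType) (X : fspace R) (U : set X) : Prop :=
  forall x, U x -> nearby x U.

(* f is smooth in a neighbourhood of x: there it is a C^infinity function of
   finitely many members of the family. *)
Definition smoothat (R : realType) (X : fspace R) (x : X) (f : X -> R) : Prop :=
  exists k (g : 'I_k -> X -> R) (A : set 'rV[R]_k) (phi : 'rV[R]_k -> R),
    [/\ forall i, Cinfty (g i), open A, A (jointly g x), Cinf_on A phi &
        forall y, A (jointly g y) -> f y = phi (jointly g y)].

(* The smallest smooth structure on T for which the members of gen are smooth;
   on an embedded submanifold of a manifold N, if gen is a family of
   restrictions generating the structure of N, these are its usual smooth
   functions. *)
Definition generated (R : realType) (T : Type) (gen : set (T -> R)) : fspace R :=
  FSpace [set f | forall x : FSpace gen, smoothat x f].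

Definition prodspace (R : realType) (X Y : fspace R) : fspace R :=
  @generated R (pt X * pt Y)%type
    [set f | (exists2 h : X -> R, Cinfty h & f = h \o fst) \/
             (exists2 h : Y -> R, Cinfty h & f = h \o snd)].

Definition smooth_map (R : realType) (X Y : fspace R) (phi : X -> Y) : Prop :=
  forall h, Cinfty h -> Cinfty (h \o phi).

Definition chart (R : realType) (X : fspace R) n (U : set X)
    (c : 'I_n -> X -> R) : Prop :=
  [/\ fopen U,
      forall x i, U x -> smoothat x (c i),
      {in U &, injective (jointly c)},
      open (jointly c @` U) &
      forall x f, U x -> smoothat x f ->
        exists (A : set 'rV[R]_n) (phi : 'rV[R]_n -> R),
          [/\ open A, A (jointly c x), Cinf_on A phi &
              forall y, U y -> A (jointly c y) -> f y = phi (jointly c y)]].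

Record manifold (R : realType) (n : nat) (X : fspace R) : Prop := {
  manifold_closed : forall f : X -> R, (forall x, smoothat x f) -> Cinfty f;
  manifold_hausdorff : forall x y : X, (forall f, Cinfty f -> f x = f y) -> x = y;
  manifold_second_countable : exists B : nat -> set X,
    (forall i, fopen (B i)) /\
    (forall x Q, nearby x Q -> exists2 i, B i x & B i `<=` Q);
  manifold_charts : forall x : X, exists U (c : 'I_n -> X -> R), U x /\ chart U c }.

Definition connected_space (R : realType) (X : fspace R) : Prop :=
  forall U : set X, fopen U -> fopen (~` U) -> U = set0 \/ U = setT.

(* A tangent vector at x is a derivation of germs of smooth functions at x, in
   the form of the chain rule (linearity and the Leibniz rule are the cases
   phi(s,t) = a s + t and phi(s,t) = s t).  It is represented by a total
   functional, which is 0 on functions not smooth near x: so equality of tangent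
   vectors is Leibniz equality. *)
Definition tvec (R : realType) (X : fspace R) : Type := (X -> R) -> R.

Record tangent (R : realType) (X : fspace R) (x : X) (v : tvec X) : Prop := {
  tangent_junk : forall f, ~ smoothat x f -> v f = 0;
  tangent_germ : forall f g, nearby x [set y | f y = g y] -> v f = v g;
  tangent_chain : forall k (f : 'I_k -> X -> R) (A : set 'rV[R]_k) phi,
    (forall i, smoothat x (f i)) -> open A -> A (jointly f x) -> Cinf_on A phi ->
    v (phi \o jointly f) = \sum_i partial i phi (jointly f x) * v (f i) }.

Definition csmoothat (R : realType) (X : fspace R) (x : X) (f : X -> R[i]) : Prop :=
  smoothat x (fun y => complex.Re (f y)) /\ smoothat x (fun y => complex.Im (f y)).

Definition csmooth (R : realType) (X : fspace R) (f : X -> R[i]) : Prop :=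
  forall x, csmoothat x f.

Definition cder (R : realType) (X : fspace R) (v : tvec X)
    (f : X -> R[i]) : R[i] :=
  (v (fun y => complex.Re (f y)) +i* v (fun y => complex.Im (f y)))%C.

Definition push (R : realType) (X Y : fspace R) (phi : X -> Y) (x : X)
    (v : tvec X) : tvec Y :=
  fun h => if `[< smoothat (phi x) h >] then v (h \o phi) else 0.

Definition smooth_field (R : realType) (X : fspace R) (V : set X)
    (Z : X -> tvec X) : Prop :=
  forall x, V x -> tangent x (Z x) /\
    forall f, Cinfty f -> smoothat x (fun y => Z y f).

Definition bracket (R : realType) (X : fspace R) (Y Z : X -> tvec X)
    (x : X) : tvec X :=
  fun f => if `[< smoothat x f >]
           then Y x (fun y => Z y f) - Z x (fun y => Y y f) else 0.

(* Complex-valued k-forms; only the values on tuples of tangent vectors matter. *)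
Definition dform (R : realType) (X : fspace R) (k : nat) : Type :=
  X -> ('I_k -> tvec X) -> R[i].

Definition subst_at T k (v : 'I_k -> T) (i : 'I_k) (w : T) : 'I_k -> T :=
  fun j => if j == i then w else v j.

Record is_form (R : realType) (X : fspace R) (U : set X) k
    (w : dform X k) : Prop := {
  form_linear : forall x v i (a : R) t, U x ->
    (forall j, tangent x (v j)) -> tangent x t ->
    w x (subst_at v i (fun f => a * v i f + t f)) =
      a%:C%C * w x v + w x (subst_at v i t);
  form_alternating : forall x v i j, U x -> (forall l, tangent x (v l)) ->
    i != j -> v i = v j -> w x v = 0;
  form_smooth : forall V (Z : 'I_k -> X -> tvec X),
    fopen V -> V `<=` U -> (forall i, smooth_field V (Z i)) ->
    forall x, V x -> csmoothat x (fun y => w y (fun i => Z i y)) }.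

Definition real_form (R : realType) (X : fspace R) k
    (w : dform X k) : Prop :=
  forall x v, (forall i, tangent x (v i)) -> complex.Im (w x v) = 0.

Definition eq_form (R : realType) (X : fspace R) k
    (w w' : dform X k) : Prop :=
  forall x v, (forall i, tangent x (v i)) -> w x v = w' x v.

(* dw = t on U, by the invariant (Koszul) formula, normalised so that
   dw(Y,Z) = Y w(Z) - Z w(Y) - w([Y,Z]) on 1-forms.  In the second sum the
   bracket stands in the slot of Z_i instead of the first one, which absorbs the
   factor (-1)^i of the usual sign (-1)^(i+j). *)
Definition is_d (R : realType) (X : fspace R) (U : set X) k
    (w : dform X k)
    (t : dform X k.+1) : Prop :=
  forall V (Z : 'I_k.+1 -> X -> tvec X),
    fopen V -> V `<=` U -> (forall i, smooth_field V (Z i)) ->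
    forall x, V x ->
    t x (fun i => Z i x) =
      \sum_(i < k.+1) (-1) ^+ i * cder (Z i x) (fun y => w y (fun l => Z (lift i l) y))
    + \sum_(j < k.+1) \sum_(i < k.+1 | (i < j)%N) (-1) ^+ j *
        w x (fun l => if lift j l == i then bracket (Z i) (Z j) x
                      else Z (lift j l) x).

(* determinant convention: (a /\ b)(v, v') = a(v) b(v') - a(v') b(v) *)
Definition wedge (R : realType) (X : fspace R) k l
    (a : dform X k)
    (b : dform X l) :
    dform X (k + l) :=
  fun x v => ((k`! * l`!)%:R)^-1 *
    \sum_(s : 'S_(k + l)) (-1) ^+ s *
      a x (fun i => v (s (lshift l i))) * b x (fun j => v (s (rshift k j))).

Definition form1 (R : realType) (X : fspace R)
    (a : X -> tvec X -> R[i]) : dform X 1 :=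
  fun x v => a x (v ord0).

Definition fbar (R : realType) (X : fspace R) k
    (w : dform X k) :
    dform X k :=
  fun x v => (w x v)^*.

Definition re_form (R : realType) (X : fspace R) k (w : dform X k) : dform X k :=
  fun x v => (complex.Re (w x v))%:C%C.

Definition im_form (R : realType) (X : fspace R) k (w : dform X k) : dform X k :=
  fun x v => (complex.Im (w x v))%:C%C.

Definition form_mul (R : realType) (X : fspace R) k (f : X -> R[i])
    (w : dform X k) :
    dform X k :=
  fun x v => f x * w x v.

Definition rfun (R : realType) (T : Type) (h : T -> R) : T -> R[i] :=
  fun x => (h x)%:C%C.

Declare Scope form_scope.
Delimit Scope form_scope with F.
Notation "a \wedge b" := (wedge a b)
  (at level 38, left associativity) : form_scope.
Notation "f ** w" := (form_mul f w)
  (at level 40, left associativity) : form_scope.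
Notation "c *c w" := (form_mul (cst c) w)
  (at level 40, left associativity) : form_scope.

(* A coframe, i.e. a linear isomorphism u : T_xX -> R^n, is encoded by its dual
   frame e_i = u^-1(i-th basis vector); u itself is then [coordinates e]. *)
Definition frame (R : realType) (X : fspace R) (n : nat) : Type :=
  'I_n -> tvec X.

Definition lincomb (R : realType) (X : fspace R) n (c : 'rV[R]_n)
    (e : frame X n) : tvec X :=
  fun f => \sum_i c 0 i * e i f.

Definition is_frame (R : realType) (X : fspace R) n (x : X) (e : frame X n) :=
  (forall i, tangent x (e i)) /\
  (forall v, tangent x v -> exists! c : 'rV[R]_n, v = lincomb c e).

Definition coordinates (R : realType) (X : fspace R) n (e : frame X n) (v : tvec X) :
    'rV[R]_n :=
  xget 0 [set c | v = lincomb c e].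

(* A set of frames, with the smooth structure induced from the frame bundle:
   the latter is generated by (x,e) |-> h(x) and (x,e) |-> e_i(h). *)
Definition frame_space (R : realType) (X : fspace R) n
    (S : X -> frame X n -> Prop) : fspace R :=
  @generated R {p : pt X * frame X n | S p.1 p.2}
    [set f | (exists2 h, Cinfty h & f = fun p => h (sval p).1) \/
             (exists i, exists2 h, Cinfty h & f = fun p => (sval p).2 i h)].

Definition fbase (R : realType) (X : fspace R) n (S : X -> frame X n -> Prop)
    (p : frame_space S) : X := (sval p).1.

Definition fframe (R : realType) (X : fspace R) n (S : X -> frame X n -> Prop)
    (p : frame_space S) : frame X n := (sval p).2.

(* the tautological form, w(v) = u(pi_* v) at the coframe u *)
Definition taut (R : realType) (X : fspace R) n (S : X -> frame X n -> Prop)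
    (p : frame_space S) (v : tvec (frame_space S)) : 'rV[R]_n :=
  coordinates (fframe p) (push (@fbase R X n S) p v).
Arguments taut {R X n S} p v.

(* Coordinates on R^6 = R^(3+3) are (x^1,x^2,x^3,x^4,x^5,x^6) and
   z^j = x^j + i x^(j+3). *)
Definition zcoord (R : realType) (a : 'rV[R]_(3 + 3)) : 'rV[R[i]]_3 :=
  \row_j (a 0 (lshift 3 j) +i* a 0 (rshift 3 j))%C.

Definition Omega0 (R : realType) (a b : 'rV[R]_(3 + 3)) : R :=
  \sum_(j < 3) (a 0 (lshift 3 j) * b 0 (rshift 3 j)
              - a 0 (rshift 3 j) * b 0 (lshift 3 j)).

(* dz^1 /\ dz^2 /\ dz^3 *)
Definition Upsilon0 (R : realType) (v : 'I_3 -> 'rV[R]_(3 + 3)) : R[i] :=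
  \det (\matrix_(i < 3, j < 3) zcoord (v i) 0 j).

Definition normsq (R : realType) n (a : 'rV[R]_n) : R := \sum_i a 0 i ^+ 2.

Definition SU3_frame (R : realType) (M : fspace R) (Om : dform M 2) (Up : dform M 3)
    (x : M) (e : frame M 6) : Prop :=
  [/\ is_frame x e,
      (forall v, (forall i, tangent x (v i)) ->
         Om x v = (Omega0 (coordinates e (v ord0)) (coordinates e (v ord_max)))%:C%C) &
      (forall v, (forall i, tangent x (v i)) ->
         Up x v = Upsilon0 (fun i => coordinates e (v i)))].

Definition SU3_structure (R : realType) (M : fspace R) (Om : dform M 2)
    (Up : dform M 3) : Prop :=
  [/\ is_form setT Om, real_form Om, is_form setT Up &
      forall x, exists e, SU3_frame Om Up x e].

Definition nearly_Kahler (R : realType) (M : fspace R) (Om : dform M 2)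
    (Up : dform M 3) : Prop :=
  is_d setT Om (3 *c im_form Up)%F /\
  is_d setT (re_form Up) (2 *c (Om \wedge Om))%F.

(* w = J v: multiplication by i in an SU(3)-coframe *)
Definition is_J (R : realType) (M : fspace R) (Om : dform M 2) (Up : dform M 3)
    (x : M) (v w : tvec M) : Prop :=
  tangent x v /\ tangent x w /\
  exists e, SU3_frame Om Up x e /\
    zcoord (coordinates e w) = (0 +i* 1)%C *: zcoord (coordinates e v).

Definition nk_isometry (R : realType) (M : fspace R) (Om : dform M 2) (Up : dform M 3)
    (phi : M -> M) : Prop :=
  (exists psi, [/\ cancel phi psi, cancel psi phi, smooth_map phi & smooth_map psi])
  /\ forall x e e' v, SU3_frame Om Up x e -> SU3_frame Om Up (phi x) e' ->
       tangent x v -> normsq (coordinates e' (push phi x v)) = normsq (coordinates e v).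

Definition lie_group (R : realType) (n : nat) (G : groupType)
    (CG : set (G -> R)) : Prop :=
  let GG := FSpace CG in
  [/\ manifold n GG,
      @smooth_map R (prodspace GG GG) GG (fun p => p.1 * p.2)%g &
      @smooth_map R GG GG (fun g => g^-1)%g].

Definition smooth_action (R : realType) (G : groupType) (CG : set (G -> R))
    (M : fspace R) (act : G -> M -> M) : Prop :=
  [/\ forall x, act 1%g x = x,
      forall g h x, act (g * h)%g x = act g (act h x) &
      @smooth_map R (prodspace (FSpace CG) M) M (fun p => act p.1 p.2)].

(* the tangent space of the orbit: the image of T_1 G under the differential of
   the orbit map *)
Definition orbit_tangent (R : realType) (G : groupType) (CG : set (G -> R))
    (M : fspace R) (act : G -> M -> M) (x : M) (v : tvec M) : Prop :=
  exists2 w, tangent (1%g : FSpace CG) w &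
    v = push (fun g : FSpace CG => act g x) 1%g w.

(* For isometries the topology of pointwise convergence, used here, is the
   compact-open topology. *)
Definition closed_in_isometries (R : realType) (G : groupType) (M : fspace R)
    (act : G -> M -> M) (Om : dform M 2) (Up : dform M 3) : Prop :=
  forall phi, nk_isometry Om Up phi ->
    (forall k (x : 'I_k -> M) (W : 'I_k -> set M),
       (forall i, nearby (phi (x i)) (W i)) ->
       exists g, forall i, W i (act g (x i))) ->
    exists g, forall x, act g x = phi x.

(* The standing symmetry hypotheses.  M is the principal locus: all isotropy
   groups are conjugate. *)
Record symmetric_SU3 (R : realType) (n : nat) (G : groupType) (CG : set (G -> R))
    (M : fspace R) (act : G -> M -> M) (Om : dform M 2) (Up : dform M 3) : Prop := {
  sym_lie : lie_group n CG;
  sym_connected : connected_space (FSpace CG);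
  sym_action : smooth_action CG act;
  sym_faithful : forall g, (forall x, act g x = x) -> g = 1%g;
  sym_closed : closed_in_isometries act Om Up;
  sym_J : forall g x v w, is_J Om Up x v w ->
    is_J Om Up (act g x) (push (act g) x v) (push (act g) x w);
  sym_Om : forall g x v, (forall i, tangent x (v i)) ->
    Om (act g x) (fun i => push (act g) x (v i)) = Om x v;
  sym_Up : forall g x v, (forall i, tangent x (v i)) ->
    Up (act g x) (fun i => push (act g) x (v i)) = Up x v;
  sym_principal : forall x y, exists g, forall h,
    act h x = x <-> act (g * h * g^-1)%g y = y;
  sym_cohomogeneity_two : forall x, exists b : frame M 4, forall v,
    orbit_tangent CG act x v <-> exists! c : 'rV[R]_4, v = lincomb c b;
  sym_coisotropic : forall x v, (forall i, orbit_tangent CG act x (v i)) ->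
    (Om \wedge Om)%F x v = 0 }.

(* the k-th index in the 1-based numbering e_1, ..., e_6 *)
Definition o6 (k : nat) : 'I_(3 + 3) := inord k.-1.

Definition adapted (R : realType) (G : groupType) (CG : set (G -> R))
    (M : fspace R) (act : G -> M -> M) (Om : dform M 2) (Up : dform M 3)
    (x : M) (e : frame M 6) : Prop :=
  SU3_frame Om Up x e /\
  forall v, tangent x v ->
    orbit_tangent CG act x v <->
    coordinates e v 0 (o6 1) = 0 /\ coordinates e v 0 (o6 2) = 0.

(* the components w^1, ..., w^6 of the tautological form *)
Definition omega (R : realType) (M : fspace R) (S : M -> frame M 6 -> Prop)
    (k : nat) : dform (frame_space S) 1 :=
  form1 (fun (p : frame_space S) v => (taut p v 0 (o6 k))%:C%C).
Arguments omega {R M} S k.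

Section StructureEquations.
Context {R : realType} {M : fspace R} (S : M -> frame M 6 -> Prop).
Local Notation P := (frame_space S).
Local Notation ii := (0 +i* 1)%C.

Definition eta : dform P 1 := (omega S 1 + ii *c omega S 2)%F.
Definition theta : dform P 1 := (omega S 4 + ii *c omega S 5)%F.

Record structure_equations (alpha xi0 xi1 xi2 xi3 : dform P 1) : Prop := {
  str_eta : is_d setT eta
    (ii *c (alpha \wedge eta) - (2 * ii) *c (xi1 \wedge omega S 3)
     + xi0 \wedge theta + xi3 \wedge fbar theta + 2 *c (xi2 \wedge omega S 6)
     + ii *c (- (eta \wedge omega S 3) + theta \wedge omega S 6))%F;
  str_omega3 : is_d setT (omega S 3)
    (- (ii *c (fbar xi1 \wedge eta)) + ii *c (xi1 \wedge fbar eta)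
     + fbar xi2 \wedge theta + xi2 \wedge fbar theta
     - 2 *c (xi0 \wedge omega S 6)
     + (ii / 2) *c (eta \wedge fbar eta - theta \wedge fbar theta))%F;
  str_theta : is_d setT theta
    (- (xi0 \wedge eta) - xi3 \wedge fbar eta - 2 *c (xi2 \wedge omega S 3)
     + ii *c (alpha \wedge theta) - (2 * ii) *c (xi1 \wedge omega S 6)
     + ii *c (- (omega S 3 \wedge theta) + eta \wedge omega S 6))%F;
  str_omega6 : is_d setT (omega S 6)
    (- (fbar xi2 \wedge eta) - xi2 \wedge fbar eta + 2 *c (xi0 \wedge omega S 3)
     - ii *c (fbar xi1 \wedge theta) + ii *c (xi1 \wedge fbar theta)
     + (ii / 2) *c (fbar theta \wedge eta - theta \wedge fbar eta))%F }.

Record torsion_equations (xi0 xi1 xi2 xi3 : dform P 1)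
    (p1 p2 p3 p4 q1 q2 r : P -> R[i]) (h1 h2 h3 h4 : P -> R) : Prop := {
  tor_xi1 : eq_form (2 *c xi1)%F
    (rfun h1 ** eta - ii *c (rfun h2 ** theta) + q1 ** fbar theta
     + p1 ** omega S 3 + p2 ** omega S 6)%F;
  tor_xi2 : eq_form (2 *c xi2)%F
    (ii *c (rfun h4 ** eta) + (rfun h3 - cst ii) ** theta + q2 ** fbar theta
     - ii *c (p2 ** omega S 3) + p3 ** omega S 6)%F;
  tor_xi3 : eq_form xi3
    (p4 ** theta - ii *c (r ** fbar theta) - ii *c (q1 ** omega S 3)
     + q2 ** omega S 6)%F;
  tor_xi0 : eq_form xi0
    ((fun p => (p4 p)^*) ** theta + p4 ** fbar theta
     - rfun h2 ** omega S 3 + rfun h3 ** omega S 6)%F }.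

End StructureEquations.

(* invariance under the action g.(x,u) = (g x, u o (g_* )^-1) on coframes *)
Definition G_invariant (R : realType) (G : Type) (M : fspace R)
    (act : G -> M -> M) n (S : M -> frame M n -> Prop) (T : Type)
    (f : frame_space S -> T) : Prop :=
  forall g (p p' : frame_space S),
    fbase p' = act g (fbase p) ->
    fframe p' = (fun i => push (act g) (fbase p) (fframe p i)) -> f p' = f p.

Definition smooth_invariant (R : realType) (G : Type) (M : fspace R)
    (act : G -> M -> M) n (S : M -> frame M n -> Prop)
    (f : frame_space S -> R[i]) : Prop :=
  csmooth f /\ G_invariant act f.

(* s_1 = (h_1 + 3) + i h_3 and s_2 = h_2 + i h_4 *)
Definition typeI (R : realType) (P : Type) (q1 q2 : P -> R[i])
    (h1 h2 h3 h4 : P -> R) : Prop :=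
  forall p, [/\ q1 p = 0, q2 p = 0,
                ((h1 p + 3) +i* h3 p)%C = 0 & (h2 p +i* h4 p)%C = 0].

Definition orbit_set (G M : Type) (act : G -> M -> M) (x : M) : set M :=
  [set y | exists g, y = act g x].

(* Smooth functions on M/G are the G-invariant smooth functions on M. *)
Definition orbit_space (R : realType) (G : Type) (M : fspace R)
    (act : G -> M -> M) : fspace R :=
  @FSpace R {O : set M | exists x, O = orbit_set act x}
    [set f | Cinfty (fun x : M =>
       f (exist _ (orbit_set act x) (ex_intro _ x erefl)))].

Definition orbit_proj (R : realType) (G : Type) (M : fspace R)
    (act : G -> M -> M) (x : M) : orbit_space act :=
  exist _ (orbit_set act x) (ex_intro _ x erefl).

(* g is the metric on the orbit space to which (w^1)^2 + (w^2)^2 descends *)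
Definition is_orbit_metric (R : realType) (G : Type) (M : fspace R)
    (act : G -> M -> M) (S : M -> frame M 6 -> Prop)
    (g : forall y : orbit_space act, tvec (orbit_space act) ->
         tvec (orbit_space act) -> R) : Prop :=
  forall (p : frame_space S) v w, tangent p v -> tangent p w ->
    let q := push (@orbit_proj R G M act \o @fbase R M 6 S) p in
    g (orbit_proj act (fbase p)) (q v) (q w) =
      taut p v 0 (o6 1) * taut p w 0 (o6 1)
    + taut p v 0 (o6 2) * taut p w 0 (o6 2).

Definition orthonormal_frame (R : realType) (X : fspace R) n
    (g : X -> tvec X -> tvec X -> R) (y : X) (e : frame X n) : Prop :=
  is_frame y e /\ forall i j, g y (e i) (e j) = (i == j)%:R.

(* The natural map P -> F.  It sends the coframe u of T_xM to the coframe u' of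
   T_y(M/G), y = Gx, with u' o q_* = (u^1, u^2), q : M -> M/G; the dual frame of
   u' is (q_* e_1, q_* e_2). *)
Definition natural_map (R : realType) (G : Type) (M : fspace R)
    (act : G -> M -> M) (S : M -> frame M 6 -> Prop)
    (S' : orbit_space act -> frame (orbit_space act) 2 -> Prop)
    (p : frame_space S) (p' : frame_space S') : Prop :=
  fbase p' = orbit_proj act (fbase p) /\
  fframe p' = (fun i => push (orbit_proj act) (fbase p)
                         (fframe p (widen_ord (isT : (2 <= 6)%N) i))).

Section Surface.
Context {R : realType} {X : fspace R} (S : X -> frame X 2 -> Prop).
Local Notation F := (frame_space S).

(* An orientation of U, given by the corresponding SO(2)-subbundle of the
   orthonormal coframe bundle F over U. *)
Record SO2_subbundle (U : set X) (Fp : set F) : Prop := {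
  SO2_over : forall p, Fp p -> U (fbase p);
  SO2_nonempty : forall y, U y -> exists2 p, Fp p & fbase p = y;
  SO2_torsor : forall p p', Fp p -> fbase p' = fbase p ->
    (Fp p' <-> exists a b : R, a ^+ 2 + b ^+ 2 = 1 /\
       fframe p' = (fun i f =>
         if i == ord0 then a * fframe p ord0 f + b * fframe p ord_max f
         else - b * fframe p ord0 f + a * fframe p ord_max f));
  SO2_open : fopen Fp }.

(* the tautological form eta = eta^1 + i eta^2 of F, and the pullback to F of dz *)
Definition etaF (p : F) (w : tvec F) : R[i] :=
  (taut p w 0 ord0 +i* taut p w 0 ord_max)%C.

Definition pull_d (z : X -> R[i]) (p : F) (w : tvec F) : R[i] :=
  cder (push (@fbase R X 2 S) p w) z.

(* z is a holomorphic coordinate on U: a complex-valued chart whose differential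
   is of type (1,0), i.e. in the complex span of eta *)
Definition holomorphic_coordinate (U : set X) (Fp : set F) (z : X -> R[i]) :=
  chart U (fun (i : 'I_2) y =>
             if i == ord0 then complex.Re (z y) else complex.Im (z y)) /\
  forall p, Fp p -> exists c : R[i],
    forall w, tangent p w -> pull_d z p w = c * etaF p w.

Definition du (u : X -> R) : dform X 1 := form1 (fun y v => (v u)%:C%C).

(* On oriented orthonormal coframes: * eta^1 = eta^2, * eta^2 = - eta^1,
   * (eta^1 /\ eta^2) = 1, written on the dual frame (e_1, e_2). *)
Definition star1 (Fp : set F) (a b : dform X 1) : Prop :=
  forall p, Fp p ->
    b (fbase p) (fun=> fframe p ord0) = - a (fbase p) (fun=> fframe p ord_max) /\
    b (fbase p) (fun=> fframe p ord_max) = a (fbase p) (fun=> fframe p ord0).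

Definition star2 (Fp : set F) (t : dform X 2) (l : X -> R) : Prop :=
  forall p, Fp p -> t (fbase p) (fframe p) = (l (fbase p))%:C%C.

(* - * d * d u = l on U *)
Definition is_laplacian (U : set X) (Fp : set F) (u l : X -> R) : Prop :=
  exists (a : dform X 1) (t : dform X 2),
    [/\ is_form U a, is_form U t, star1 Fp (du u) a, is_d U a t &
        star2 Fp t (fun y => - l y)].

End Surface.

(* df/dzbar = b at y, i.e. df = a dz + b dzbar at y for some a; meaningful for f
   smooth near y *)
Definition is_dzbar (R : realType) (X : fspace R) (z f : X -> R[i]) (y : X)
    (b : R[i]) : Prop :=
  exists a, forall v, tangent y v -> cder v f = a * cder v z + b * (cder v z)^*.

Definition P_bundle (R : realType) (G : groupType) (CG : set (G -> R))
    (M : fspace R) (act : G -> M -> M) (Om : dform M 2) (Up : dform M 3) : fspace R :=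
  frame_space (adapted CG act Om Up).

Definition F_bundle (R : realType) (X : fspace R)
    (g : X -> tvec X -> tvec X -> R) : fspace R :=
  frame_space (@orthonormal_frame R X 2 g).

(* Main.v *)
Require Import Defs.
From HB Require Import structures.
From mathcomp Require Import all_boot all_order all_algebra all_fingroup.
From mathcomp Require Import all_classical all_reals all_analysis.
From mathcomp Require Import complex ring lra.
Set Implicit Arguments.
Unset Strict Implicit.
Unset Printing Implicit Defensive.
Import Order.TTheory GRing.Theory Num.Theory.
Import numFieldNormedType.Exports.
Local Open Scope classical_set_scope.
Local Open Scope ring_scope.

(** The proof is Cartan's method in coordinates: the structure equations are read
    as brackets of vector fields on M, and the differential system is what the
    Jacobi identity says about these brackets.

    Local geometry. Near each point there is a smooth field s_1, ..., s_6 of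
    adapted frames (adapted_section). Indeed Omega has rank two on the
    coisotropic orbits, e_4 and e_5 span its radical there, and the rest of the
    frame follows from these two by contraction with Omega and Upsilon. The
    freedom left is the group O(2). It is used to match the orientation of the
    surface and to make dz a positive multiple of eta; by the definition of u the
    multiple is e^u, and then conj(p_4) = f e^u and conj(r) = g e^{3u} along the
    frame (gauge). In this gauge the vectors s_3, ..., s_6, which are tangent to
    the orbits, annihilate p_4, r and u.

    Brackets. The fields s_k lift to the bundle P along the local sections that
    are constant combinations of s. The tautological form is constant on the
    lifts along s itself, so that each structure equation evaluates to the
    component of a bracket [s_j, s_k] on M (structure_transport). For torsion of
    Type I this expresses all brackets by p_1, ..., p_4, r and the two
    derivatives of u; the form alpha is eliminated by comparing the equation of
    eta with d(dz) = 0 (structure_table, frame_brackets).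

    Jacobi identity. Its components that contain no derivative of the torsion
    give p_2 = 0, p_1 = - 4 i p_4 and p_3 = 4 p_4 (torsion_reduced). The others
    give the eta-component of d p_4, that of d r, and the curvature equation
    relating the second derivatives of u to |p_4|^2 and |r|^2
    (torsion_derivatives). Written in terms of f, g and u the first two are the
    equations for df/dzbar and dg/dzbar, since s_1 and s_2 lie over e^u d/dx and
    e^u d/dy (horizontal_push). For the last one, the Hodge dual of du is
    u_x dy - u_y dx, whose differential is the flat Laplacian of u times
    dx /\ dy (d_conj_d).

    Since manifolds are presented by algebras of functions and tangent vectors by
    derivations of germs, the beginning of the file develops the calculus of such
    germs: the chain rule, symmetry of second derivatives, coordinate vector
    fields, and smoothness of solutions of linear systems, by which all fields
    constructed here are seen to be smooth. *)

(** * Functions of class C^n on R^k *)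

Section CinfCalculus.
Context {R : realType}.

Local Notation diffble f a := (differentiable (f : 'rV[R]_ _ -> R^o) a).

Lemma partialE k (i : 'I_k) (phi : 'rV[R]_k -> R) a :
  diffble phi a -> partial i phi a = 'd (phi : 'rV[R]_k -> R^o) a (delta_mx 0 i).
Proof. by move=> d; rewrite /partial deriveE. Qed.

Lemma diff_partials k (phi : 'rV[R]_k -> R) a v : diffble phi a ->
  'd (phi : 'rV[R]_k -> R^o) a v = \sum_i v 0 i * partial i phi a.
Proof.
move=> d; rewrite [v in LHS]row_sum_delta linear_sum; apply: eq_bigr => i _.
by rewrite linearZ partialE.
Qed.

Lemma diff_jointly k m (psi : 'I_m -> 'rV[R]_k -> R) a :
  (forall j, diffble (psi j) a) -> differentiable (jointly psi) a.
Proof.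
move=> d.
have -> : jointly psi = \sum_(j < m) (fun b => psi j b *: (delta_mx 0 j : 'rV[R]_m)).
  apply/funext => b; rewrite fct_sumE [LHS]row_sum_delta.
  by apply: eq_bigr => j _; rewrite mxE.
by apply: differentiable_sum => j; apply: differentiableZl; exact: d.
Qed.

Lemma partial_comp k m (psi : 'I_m -> 'rV[R]_k -> R) (phi : 'rV[R]_m -> R) a i :
  (forall j, diffble (psi j) a) -> diffble phi (jointly psi a) ->
  partial i (phi \o jointly psi) a =
    \sum_j partial j phi (jointly psi a) * partial i (psi j) a.
Proof.
move=> dpsi dphi.
have dj := diff_jointly dpsi.
have dc : diffble (phi \o jointly psi) a by exact: differentiable_comp.
rewrite partialE // diff_comp //= diff_partials //.
apply: eq_bigr => j _; rewrite mulrC; congr (_ * _).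
rewrite -deriveE // derive_mx; last exact: diff_derivable.
have E : (fun t => jointly psi t 0 j) = psi j by apply/funext => t; rewrite mxE.
by rewrite mxE E.
Qed.

Lemma near_eq_partial k (i : 'I_k) (f g : 'rV[R]_k -> R) a :
  (\near a, f a = g a) -> partial i f a = partial i g a.
Proof. exact: near_eq_derive. Qed.

Lemma near_eq_differentiable k (f g : 'rV[R]_k -> R) a :
  (\near a, f a = g a) -> diffble f a -> diffble g a.
Proof.
move=> fg df; have [dfc dfo] := (diff_locallyP _ _).1 df.
have dgo : (g : 'rV[R]_k -> R^o) \o shift a =
    cst (g a) + 'd (f : 'rV[R]_k -> R^o) a +o_ 0 id.
  apply/eqaddoP => e e0; move/eqaddoP : dfo => /(_ e e0).
  have fg' : \forall v \near (0 : 'rV[R]_k), f (v + a) = g (v + a).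
    by have := fg; rewrite (near_shift 0) subr0; apply: filterS => v /=; rewrite ?add0r addrC.
  apply: filterS2 fg' => v /= E.
  by rewrite /cst /= -(nbhs_singleton fg) !fctE /= -E.
have E := diff_unique dfc dgo.
by apply/diff_locallyP; rewrite E.
Qed.

Section OnOpenSets.
Implicit Types (k m n : nat).

Lemma Cn_on_diff k n A (phi : 'rV[R]_k -> R) a : Cn_on n A phi -> A a -> diffble phi a.
Proof. by case: n => [|n] [d _]; apply: d. Qed.

Lemma Cn_on_partial k n A (phi : 'rV[R]_k -> R) i :
  Cn_on n.+1 A phi -> Cn_on n A (partial i phi).
Proof. by case=> _; apply. Qed.

Lemma Cn_on_le k n A (phi : 'rV[R]_k -> R) : Cn_on n.+1 A phi -> Cn_on n A phi.
Proof.
elim: n phi => [|n IHn] phi [d D]; first by split.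
by split=> // i; apply: IHn.
Qed.

Lemma Cn_on_sub k n (A B : set 'rV[R]_k) phi : B `<=` A -> Cn_on n A phi -> Cn_on n B phi.
Proof.
move=> sBA; elim: n phi => [|n IHn] phi [d D]; split=> //.
- by move=> a /sBA; apply: d.
- by move=> a /sBA; apply: d.
- by move=> i; apply: IHn (D i).
Qed.

Lemma Cn_on_eq k n (A : set 'rV[R]_k) phi psi : open A ->
  (forall a, A a -> phi a = psi a) -> Cn_on n A phi -> Cn_on n A psi.
Proof.
move=> oA; elim: n phi psi => [|n IHn] phi psi E [d D].
  split=> // a Aa; apply: near_eq_differentiable (d a Aa).
  by apply: filterS (open_nbhs_nbhs (conj oA Aa)).
split=> [a Aa|i].
  apply: near_eq_differentiable (d a Aa).
  by apply: filterS (open_nbhs_nbhs (conj oA Aa)).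
apply: IHn (D i) => a Aa; apply: near_eq_partial.
by apply: filterS (open_nbhs_nbhs (conj oA Aa)).
Qed.

Lemma Cn_on_cst k n (A : set 'rV[R]_k) (c : R) : Cn_on n A (fun=> c).
Proof.
elim: n c => [|n IHn] c; split=> //; try by move=> a _; apply: differentiable_cst.
move=> i; have -> : partial i (fun=> c) = fun=> 0 by apply/funext => a; apply: derive_cst.
exact: IHn.
Qed.

Lemma partial_coord k (i j : 'I_k) a :
  partial i (fun b : 'rV[R]_k => b 0 j) a = (i == j)%:R.
Proof.
have did : derivable (@id 'rV[R]_k) a (delta_mx 0 i) by apply: derivable_id.
have := derive_mx did; rewrite derive_id => /matrixP/(_ 0 j); rewrite !mxE eqxx /=.
by rewrite eq_sym => ->.
Qed.

Lemma Cn_on_coord k n (A : set 'rV[R]_k) j : Cn_on n A (fun b => b 0 j).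
Proof.
case: n => [|n]; split=> //; try by move=> a _; apply: differentiable_coord.
move=> i; have -> : partial i (fun b : 'rV[R]_k => b 0 j) = (fun=> (i == j)%:R : R).
  by apply/funext => a; apply: partial_coord.
exact: Cn_on_cst.
Qed.

Lemma Cn_onD k n (A : set 'rV[R]_k) phi psi : open A ->
  Cn_on n A phi -> Cn_on n A psi -> Cn_on n A (fun a => phi a + psi a).
Proof.
move=> oA; elim: n phi psi => [|n IHn] phi psi [d D] [d' D'].
  by split=> // a Aa; apply: differentiableD; [apply: d|apply: d'].
split=> [a Aa|i]; first by apply: differentiableD; [apply: d|apply: d'].
apply: (Cn_on_eq oA) (IHn _ _ (D i) (D' i)) => a Aa.
by rewrite /partial; apply/esym/deriveD; apply: diff_derivable; [apply: d|apply: d'].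
Qed.

Lemma Cn_onM k n (A : set 'rV[R]_k) phi psi : open A ->
  Cn_on n A phi -> Cn_on n A psi -> Cn_on n A (fun a => phi a * psi a).
Proof.
move=> oA; elim: n phi psi => [|n IHn] phi psi Cphi Cpsi.
  by split=> // a Aa; apply: differentiableM; [case: Cphi|case: Cpsi] => d _; apply: d.
have d a : A a -> diffble phi a by apply: Cn_on_diff Cphi.
have d' a : A a -> diffble psi a by apply: Cn_on_diff Cpsi.
split=> [a Aa|i]; first by apply: differentiableM; [apply: d|apply: d'].
pose rhs a := phi a * partial i psi a + psi a * partial i phi a.
suff : Cn_on n A rhs.
  apply: (Cn_on_eq oA) => a Aa; rewrite /partial.
  by apply/esym/deriveM; apply: diff_derivable; [apply: d|apply: d'].
apply: Cn_onD => //; apply: IHn; do ?exact: Cn_on_le.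
- exact: Cn_on_partial.
- exact: Cn_on_partial.
Qed.

Lemma Cn_on_sum k n (A : set 'rV[R]_k) m (phi : 'I_m -> 'rV[R]_k -> R) : open A ->
  (forall j, Cn_on n A (phi j)) -> Cn_on n A (fun a => \sum_j phi j a).
Proof.
move=> oA; elim: m phi => [|m IHm] phi Cphi.
  apply: (Cn_on_eq oA) (Cn_on_cst n A 0) => a _; by rewrite big_ord0.
have := Cn_onD oA (Cphi ord0) (IHm (fun j => phi (lift ord0 j)) (fun j => Cphi _)).
by apply: Cn_on_eq => // a _; rewrite big_ord_recl.
Qed.

(** By the chain rule the partials of the composite are sums of products of
    functions one class lower, so the induction is on n. *)
Lemma Cn_on_comp k m n (A : set 'rV[R]_k) (B : set 'rV[R]_m)
    (psi : 'I_m -> 'rV[R]_k -> R) phi :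
  open A -> (forall j, Cn_on n A (psi j)) -> Cn_on n B phi ->
  (forall a, A a -> B (jointly psi a)) -> Cn_on n A (phi \o jointly psi).
Proof.
move=> oA; elim: n phi psi => [|n IHn] phi psi Cpsi Cphi AB.
  split=> // a Aa; apply: differentiable_comp.
    by apply: diff_jointly => j; apply: Cn_on_diff (Cpsi j) _.
  by apply: (Cn_on_diff Cphi); apply: AB.
have d j a : A a -> diffble (psi j) a by apply: Cn_on_diff (Cpsi j).
have d' a : A a -> diffble phi (jointly psi a) by move=> /AB; apply: Cn_on_diff Cphi.
split=> [a Aa|i].
  by apply: differentiable_comp (d' _ Aa); apply: diff_jointly => j; apply: d.
pose rhs a := \sum_j (partial j phi \o jointly psi) a * partial i (psi j) a.
suff : Cn_on n A rhs.
  apply: (Cn_on_eq oA) => a Aa; rewrite partial_comp //; last exact: d'.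
  by move=> j; apply: d.
apply: Cn_on_sum => // j; apply: Cn_onM => //; last exact: Cn_on_partial.
by apply: IHn => //; [move=> l; apply: Cn_on_le|apply: Cn_on_partial].
Qed.

End OnOpenSets.

End CinfCalculus.

Section OneVariable.
Context {R : realType}.
Local Notation diffble f a := (differentiable (f : 'rV[R]_ _ -> R^o) a).
Local Notation var1 F := (fun a : 'rV[R]_1 => F (a 0 0)).

Lemma partial_var1 (F : R -> R) (a : 'rV[R]_1) (d : R) (i : 'I_1) :
  is_derive (a 0 0 : R^o) 1 (F : R^o -> R^o) d ->
  diffble (var1 F) a /\ partial i (var1 F) a = d.
Proof.
move=> [dF dE].
have dc : diffble (fun a : 'rV[R]_1 => a 0 0) a by apply: differentiable_coord.
have dF' : differentiable (F : R^o -> R^o) (a 0 0) by apply/derivable1_diffP.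
have dcF : diffble (var1 F) a by exact: (differentiable_comp dc dF').
split=> //; rewrite partialE // (diff_comp dc dF') /= -[X in 'd F _ X]partialE //.
by rewrite (ord1 i) partial_coord eqxx deriv1E // derive1E dE scale1r.
Qed.

Lemma open_var1 (D : set R) : open D -> open [set a : 'rV[R]_1 | D (a 0 0)].
Proof. by move=> oD; apply: open_comp => // a _; apply: coord_continuous. Qed.

(** Bootstrapping: a function of one variable is smooth once its derivative is
    of class C^n whenever the function is. This covers exp, 1/x and the square root. *)
Lemma Cinf_var1 (D : set R) (F F' : R -> R) : open D ->
  (forall x, D x -> is_derive (x : R^o) 1 (F : R^o -> R^o) (F' x)) ->
  (forall n, Cn_on n [set a | D (a 0 0)] (var1 F) -> Cn_on n [set a | D (a 0 0)] (var1 F')) ->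
  Cinf_on [set a | D (a 0 0)] (var1 F).
Proof.
move=> oD dF step; elim=> [|n IHn].
  by split=> // a /dF/partial_var1 - /(_ ord0) [].
split=> [a /dF/partial_var1 - /(_ ord0) []|i] //.
apply: (Cn_on_eq (open_var1 oD)) (step n IHn) => a /dF/partial_var1 - /(_ i) [_ ->] //.
Qed.

Lemma Cinf_expR : Cinf_on setT (var1 (@expR R)).
Proof.
have E : [set a : 'rV[R]_1 | setT (a 0 0)] = setT by apply/seteqP.
rewrite -E; apply: (@Cinf_var1 setT (@expR R) (@expR R)) => //.
exact: openT.
Qed.

Lemma Cinf_inv : Cinf_on [set a : 'rV[R]_1 | a 0 0 != 0] (var1 (@GRing.inv R)).
Proof.
have o0 : open [set x : R | x != 0] by exact: (@open_neq R 0).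
apply: (@Cinf_var1 [set x | x != 0] (@GRing.inv R) (fun x => - (x^-1 * x^-1))) => //.
  move=> x x0; have -> : - (x^-1 * x^-1) = - x ^- 2 *: 1 :> R^o.
    by rewrite /GRing.scale /= mulr1 expr2 invfM.
  exact: (@is_deriveV R id x 1 1 x0 (is_derive_id _ _)).

move=> n Cn.
have -> : var1 (fun x => - (x^-1 * x^-1)) = fun a => (fun=> -1) a * (a 0 0)^-1 * (a 0 0)^-1.
  by apply/funext => a; rewrite -mulrA mulN1r.
have oA := open_var1 o0.
by apply: (Cn_onM oA) => //; apply: (Cn_onM oA) => //; apply: Cn_on_cst.
Qed.

Lemma Cinf_sqrt : Cinf_on [set a : 'rV[R]_1 | 0 < a 0 0] (var1 (@Num.sqrt R)).
Proof.
have o0 : open [set x : R | 0 < x] by exact: (@open_gt R 0).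
apply: (@Cinf_var1 [set x | 0 < x] (@Num.sqrt R) (fun x => (2 * Num.sqrt x)^-1)) => //.
move=> n Cn; have oA := open_var1 o0.
have C2 : Cn_on n [set a : 'rV[R]_1 | 0 < a 0 0] (fun a => 2 * Num.sqrt (a 0 0)).
  by apply: Cn_onM => //; apply: Cn_on_cst.
have := @Cn_on_comp R 1 1 n _ _ (fun=> var1 (fun x => 2 * Num.sqrt x)) _ oA (fun=> C2) (Cinf_inv n).
have -> : var1 (@GRing.inv R) \o jointly (fun=> var1 (fun x => 2 * Num.sqrt x)) =
   var1 (fun x => (2 * Num.sqrt x)^-1) by apply/funext => a /=; rewrite mxE.
by apply=> a a0 /=; rewrite mxE mulf_neq0 // gt_eqF // sqrtr_gt0.
Qed.

End OneVariable.

(** * Symmetry of second derivatives *)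

Section Schwarz.
Context {R : realType} (k : nat).
Local Notation diffble f a := (differentiable (f : 'rV[R]_k -> R^o) a).
Implicit Types (phi : 'rV[R]_k -> R) (a : 'rV[R]_k).

Lemma norm_delta_le1 (i : 'I_k) : `|delta_mx 0 i : 'rV[R]_k| <= 1.
Proof.
rewrite [leLHS]/Num.Def.normr/= mx_normrE; apply: bigmax_le => // -[x y] _ /=.
by rewrite mxE; case: (_ && _); rewrite ?normr1 ?normr0 ?ler01.
Qed.

Lemma first_order phi a : diffble phi a -> forall e, 0 < e ->
  \forall v \near (0 : 'rV[R]_k),
    `|phi (v + a) - phi a - \sum_i v 0 i * partial i phi a| <= e * `|v|.
Proof.
move=> d e e0; have [_ /eqaddoP/(_ e e0)] := (diff_locallyP _ _).1 d.
by apply: filterS => v /=; rewrite -diff_partials // !fctE /= opprD addrA.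
Qed.

(** The mean value theorem along e_i, applied to the difference of phi over a
    step h e_j, and then differentiability of the i-th partial at a. *)
Lemma second_difference phi (A : set 'rV[R]_k) a i j : open A -> A a -> Cn_on 1 A phi ->
  forall e, 0 < e -> exists2 d, 0 < d & forall h, 0 < h -> h < d ->
  `|phi (h *: delta_mx 0 i + h *: delta_mx 0 j + a) - phi (h *: delta_mx 0 i + a)
    - phi (h *: delta_mx 0 j + a) + phi a
    - h ^+ 2 * partial j (partial i phi) a| <= 3 * e * h ^+ 2.
Proof.
move=> oA Aa Cphi e e0.
have dpi : diffble (partial i phi) a.
  by apply: Cn_on_diff (Cn_on_partial i Cphi) Aa.
have /nbhs_ballP[d1 /= d1gt0 Hd1] := first_order dpi e0.
have /nbhs_ballP[d2 /= d2gt0 Hd2] : nbhs a A by apply: open_nbhs_nbhs.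
pose d := Num.min d1 d2 / 2.
have d0 : 0 < d by rewrite divr_gt0 // lt_min d1gt0.
exists d => // h h0 hd.
pose ei : 'rV[R]_k := delta_mx 0 i; pose ej : 'rV[R]_k := delta_mx 0 j.
have small c t : 0 <= c <= h -> 0 <= t <= h -> `|c *: ei + t *: ej| <= c + t.
  move=> /andP[c0 _] /andP[t0 _]; apply: (le_trans (ler_normD _ _)).
  by apply: lerD; rewrite normrZ ger0_norm // ler_piMr // norm_delta_le1.
have h2 : h + h < Num.min d1 d2 by move: hd; rewrite /d; lra.
have inA c t : 0 <= c <= h -> 0 <= t <= h -> A (c *: ei + t *: ej + a).
  move=> ch th; apply: Hd2; rewrite -ball_normE /= opprD addrCA subrr addr0 normrN.
  apply: (le_lt_trans (small _ _ ch th)); move: ch th h2; rewrite lt_min; lra.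
have err c t : 0 <= c <= h -> 0 <= t <= h -> `|partial i phi (c *: ei + t *: ej + a) - partial i phi a
     - (c * partial i (partial i phi) a + t * partial j (partial i phi) a)| <= e * (c + t).
  move=> ch th.
  have small1 : `|c *: ei + t *: ej| < d1.
    by apply: (le_lt_trans (small _ _ ch th)); move: ch th h2; rewrite lt_min; lra.
  apply: (@le_trans _ _ (e * `|c *: ei + t *: ej|)); last first.
    by rewrite ler_pM2l // small.
  have E : c * partial i (partial i phi) a + t * partial j (partial i phi) a =
      \sum_l (c *: ei + t *: ej) 0 l * partial l (partial i phi) a.
    by rewrite -diff_partials // linearD !linearZ /= -!partialE.
  by rewrite E; apply: Hd1; rewrite -ball_normE /= sub0r normrN.
have dline b s : A (s *: ei + b) ->
    is_derive (s : R^o) 1 (fun s => phi (s *: ei + b) : R^o) (partial i phi (s *: ei + b)).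
  move=> Ab.
  have dl : differentiable (fun s : R^o => s *: ei + b : 'rV[R]_k) s.
    by apply: differentiableD; [apply: differentiableZl|apply: differentiable_cst].
  have dp : diffble phi (s *: ei + b) by apply: Cn_on_diff Cphi Ab.
  have dlE : is_diff (s : R^o) (fun s : R^o => s *: ei + b : 'rV[R]_k) (fun v => v *: ei).
    have -> : (fun v : R^o => v *: ei) = (fun v => v *: ei) + 0 by rewrite addr0.
    by apply: is_diffD; apply: is_diff_cst.
  apply: DeriveDef; first exact/derivable1_diffP/(differentiable_comp dl dp).
  rewrite deriveE; last exact: (differentiable_comp dl dp).
  by rewrite (diff_comp dl dp) /= partialE // diff_val scale1r.
pose F s := phi (s *: ei + (h *: ej + a)) - phi (s *: ei + a).
pose F' s := partial i phi (s *: ei + (h *: ej + a)) - partial i phi (s *: ei + a).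
have hh : 0 <= h <= h by rewrite (ltW h0) lexx.
have h00 : 0 <= (0 : R) <= h by rewrite (ltW h0) lexx.
have dF s : 0 <= s <= h -> is_derive (s : R^o) 1 (F : R^o -> R^o) (F' s).
  move=> hs; apply: is_deriveB; apply: dline.
  - by rewrite addrA; apply: inA.
  - by have := inA s 0 hs h00; rewrite scale0r addr0.
have [c cin Fc] : exists2 c, c \in `]0, h[%R & F h - F 0 = F' c * (h - 0).
  apply: MVT => // [s|].
    by rewrite in_itv /= => /andP[s0 sh]; apply: dF; rewrite !ltW.
  apply: derivable_within_continuous => s; rewrite in_itv /= => sh.
  exact: (@ex_derive _ _ _ _ _ _ _ (dF s sh)).
have ch : 0 <= c <= h by move: cin; rewrite in_itv /= => /andP[c0 c1]; rewrite !ltW.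
have -> : phi (h *: ei + h *: ej + a) - phi (h *: ei + a) - phi (h *: ej + a) + phi a
    = F' c * h.
  have := Fc; rewrite subr0 => <-; rewrite /F !scale0r !add0r addrA; ring.
have E0 : `|partial i phi (c *: ei + a) - partial i phi a
    - c * partial i (partial i phi) a| <= e * c.
  by have := err c 0 ch h00; rewrite scale0r mul0r !addr0.
have E1 : `|partial i phi (c *: ei + (h *: ej + a)) - partial i phi a
    - (c * partial i (partial i phi) a + h * partial j (partial i phi) a)| <= e * (c + h).
  by rewrite [c *: ei + (_ + a)]addrA; apply: err.
clear Fc dF dline err inA small Hd1 Hd2 oA Aa Cphi dpi; rewrite /F' => {F F'}.
move: E0 E1; move: (partial i (partial i phi) a) (partial j (partial i phi) a) => Q1 Q2.
move: (partial i phi (c *: ei + (h *: ej + a))) (partial i phi (c *: ei + a)) => P2 P1.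
move: (partial i phi a) => P0 E0 E1.
have -> : (P2 - P1) * h - h ^+ 2 * Q2 = ((P2 - P0 - (c * Q1 + h * Q2)) - (P1 - P0 - c * Q1)) * h.
  by ring.
rewrite normrM (gtr0_norm h0) expr2 mulrA ler_pM2r //.
apply: (le_trans (ler_normB _ _)).
move: E0 E1; set x := `|_|; set y := `|_| => E0 E1.
by apply: (le_trans (lerD E1 E0)); rewrite -mulrDr; nra.
Qed.

(** Schwarz: the second difference of step h is symmetric in i and j. *)
Lemma partial_sym phi (A : set 'rV[R]_k) a i j : open A -> A a -> Cn_on 1 A phi ->
  partial i (partial j phi) a = partial j (partial i phi) a.
Proof.
move=> oA Aa Cphi; apply/eqP; rewrite -subr_eq0 -normr_le0; apply/ler_addgt0Pl => e e0.
(* The error 3 e h^2 is made twice. *)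
have e6 : 0 < e / 6 by rewrite divr_gt0.
have [d1 d1gt0 H1] := second_difference i j oA Aa Cphi e6.
have [d2 d2gt0 H2] := second_difference j i oA Aa Cphi e6.
pose h := Num.min d1 d2 / 2.
have hmin : 0 < h /\ h < d1 /\ h < d2.
  rewrite /h; have : 0 < Num.min d1 d2 by rewrite lt_min d1gt0.
  have : Num.min d1 d2 <= d1 by rewrite ge_min lexx.
  have : Num.min d1 d2 <= d2 by rewrite ge_min lexx orbT.
  by lra.
have [h0 [hd1 hd2]] := hmin.
have := H1 h h0 hd1; have := H2 h h0 hd2.
rewrite [h *: delta_mx 0 j + _]addrC.
set X := _ - _ - _ + _; set Y := _ - _ - _ + _.
have -> : X = Y by rewrite /X /Y; ring.
move=> E1 E2; have h20 := exprn_gt0 2 h0; rewrite ?addr0 ?add0r.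
move: E1 E2 h20; move: (partial i (partial j phi) a) (partial j (partial i phi) a) Y (h ^+ 2).
move=> Q1 Q2 y H E1 E2 H0; rewrite -(@ler_pM2r _ H) // -[X in _ * X <= _](gtr0_norm H0) -normrM.
have -> : (Q1 - Q2) * H = (y - H * Q2) - (y - H * Q1) by ring.
apply: (le_trans (ler_normB _ _)); apply: (le_trans (lerD E2 E1)).
by rewrite -mulrDl ler_pM2r //; lra.
Qed.

End Schwarz.

(** * Germs of smooth functions *)

Section OpenPreimages.
Context {R : realType}.

Lemma open_preim k m (A : set 'rV[R]_k) (B : set 'rV[R]_m) (psi : 'I_m -> 'rV[R]_k -> R) :
  open A -> open B -> (forall j, Cn_on 0 A (psi j)) ->
  open [set a | A a /\ B (jointly psi a)].
Proof.
move=> oA oB Cpsi; rewrite openE => a [Aa Ba].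
have cj : {for a, continuous (jointly psi)}.
  apply: differentiable_continuous; apply: diff_jointly => j.
  by apply: Cn_on_diff (Cpsi j) Aa.
have nB : nbhs (jointly psi a) B by apply: open_nbhs_nbhs.
have nA : nbhs a A by apply: open_nbhs_nbhs.
by apply: filterS2 nA (cj _ nB).
Qed.

Definition select k m (p : 'I_m -> 'I_k) (a : 'rV[R]_k) : 'rV[R]_m :=
  jointly (fun j (b : 'rV[R]_k) => b 0 (p j)) a.

Lemma open_select k m (p : 'I_m -> 'I_k) (B : set 'rV[R]_m) :
  open B -> open [set a | B (select p a)].
Proof.
move=> oB.
have := @open_preim k m setT B (fun j b => b 0 (p j)) openT oB (fun j => Cn_on_coord _ _ _).
by congr open; apply/seteqP; split=> a //= [].
Qed.

Lemma Cinf_select k m (p : 'I_m -> 'I_k) (B : set 'rV[R]_m) (phi : 'rV[R]_m -> R) :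
  open B -> Cinf_on B phi -> Cinf_on [set a | B (select p a)] (phi \o select p).
Proof.
move=> oB Cphi n; have oS := open_select (p := p) oB.
by apply: (@Cn_on_comp R k m n _ B (fun j b => b 0 (p j)) phi oS) => // j; apply: Cn_on_coord.
Qed.

Lemma select_jointly T k m (p : 'I_m -> 'I_k) (g : 'I_k -> T -> R) y :
  select p (jointly g y) = jointly (fun j => g (p j)) y.
Proof. by apply/rowP => j; rewrite !mxE. Qed.

Lemma open_forall k m (B : 'I_m -> set 'rV[R]_k) :
  (forall j, open (B j)) -> open [set a | forall j, B j a].
Proof.
move=> oB; rewrite openE => a Ba.
apply: (@filter_forall 'rV[R]_k 'I_m B (nbhs a) (nbhs_filter a)) => j.
by apply: open_nbhs_nbhs; split.
Qed.

End OpenPreimages.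

Section SmoothFunctions.
Context {R : realType} {X : fspace R}.
Implicit Types (x y : X) (f g h : X -> R) (Q : set X).

Lemma nearby_mono x Q Q' : Q `<=` Q' -> nearby x Q -> nearby x Q'.
Proof. by move=> s [k [g [A [gC oA Ax H]]]]; exists k, g, A; split=> // y /H /s. Qed.

Lemma nearby_self x Q : nearby x Q -> Q x.
Proof. by case=> k [g [A [_ _ Ax H]]]; apply: H. Qed.

Lemma nearbyT x Q : (forall y, Q y) -> nearby x Q.
Proof.
move=> H; exists 0%N, (fun=> cst 0), setT; split=> //; last exact: openT.
by case.
Qed.

Lemma smoothat_gen x f : Cinfty f -> smoothat x f.
Proof.
move=> Cf; exists 1%N, (fun=> f), setT, (fun a => a 0 0); split=> //.
- exact: openT.
- by move=> n; apply: Cn_on_coord.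
- by move=> y _; rewrite mxE.
Qed.

(** Finitely many germs are presented over common generators and a common open
    set; this is what makes germs composable. *)
Lemma smoothat_joint x m (F : 'I_m -> X -> R) : (forall j, smoothat x (F j)) ->
  exists N (g : 'I_N -> X -> R) (A : set 'rV[R]_N) (Phi : 'I_m -> 'rV[R]_N -> R),
   [/\ forall i, Cinfty (g i), open A, A (jointly g x), forall j, Cinf_on A (Phi j) &
       forall y, A (jointly g y) -> forall j, F j y = Phi j (jointly g y)].
Proof.
move=> smF; have /choice[k_ /= H1] := smF.
pose T := {j : 'I_m & 'I_(k_ j)}.
have {H1}[g_ H2] : exists g_ : forall j, 'I_(k_ j) -> X -> R, forall j,
   exists (A : set 'rV[R]_(k_ j)) phi, [/\ forall i, Cinfty (g_ j i), open A, A (jointly (g_ j) x),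
     Cinf_on A phi & forall y, A (jointly (g_ j) y) -> F j y = phi (jointly (g_ j) y)].
  exists (fun j => projT1 (cid (H1 j))) => j; exact: (projT2 (cid (H1 j))).
have [A_ H3] : exists A_ : forall j, set 'rV[R]_(k_ j), forall j,
   exists phi, [/\ forall i, Cinfty (g_ j i), open (A_ j), A_ j (jointly (g_ j) x),
     Cinf_on (A_ j) phi & forall y, A_ j (jointly (g_ j) y) -> F j y = phi (jointly (g_ j) y)].
  exists (fun j => projT1 (cid (H2 j))) => j; exact: (projT2 (cid (H2 j))).
have [phi_ H4] : exists phi_ : forall j, 'rV[R]_(k_ j) -> R, forall j,
   [/\ forall i, Cinfty (g_ j i), open (A_ j), A_ j (jointly (g_ j) x),
     Cinf_on (A_ j) (phi_ j) & forall y, A_ j (jointly (g_ j) y) -> F j y = phi_ j (jointly (g_ j) y)].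
  exists (fun j => projT1 (cid (H3 j))) => j; exact: (projT2 (cid (H3 j))).
pose p j (l : 'I_(k_ j)) : 'I_#|{: T}| := enum_rank (Tagged (fun j => 'I_(k_ j)) l).
pose g (n : 'I_#|{: T}|) := let t := enum_val n : T in g_ (tag t) (tagged t).
have gE y j : select (@p j) (jointly g y) = jointly (g_ j) y.
  by rewrite select_jointly; apply/rowP => l; rewrite !mxE /g /p enum_rankK.
pose A := [set a | forall j, A_ j (select (@p j) a)].
have oA : open A by apply: open_forall => j; apply: open_select; case: (H4 j).
exists #|{: T}|, g, A, (fun j => phi_ j \o select (@p j)); split=> //.
- by move=> i; rewrite /g /=; case: (H4 (tag (enum_val i : T))).
- by move=> j; rewrite gE; case: (H4 j).
- move=> j n; case: (H4 j) => _ oAj _ Cj _.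
  by apply: Cn_on_sub (Cinf_select _ oAj Cj n) => a /(_ j).
- by move=> y Ay j; case: (H4 j) => _ _ _ _ ->; rewrite -?gE //; apply: Ay.
Qed.

Lemma nearby_smooth x m (F : 'I_m -> X -> R) (B : set 'rV[R]_m) :
  (forall j, smoothat x (F j)) -> open B -> B (jointly F x) ->
  nearby x [set y | B (jointly F y)].
Proof.
move=> /smoothat_joint[N [g [A [Phi [gC oA Ax CPhi E]]]]] oB Bx.
have E' y : A (jointly g y) -> jointly F y = jointly Phi (jointly g y).
  by move=> /E FE; apply/rowP => j; rewrite !mxE FE.
exists N, g, [set a | A a /\ B (jointly Phi a)]; split=> //.
- by apply: open_preim => // j; apply: CPhi.
- by split=> //; rewrite -E'.
- by move=> y [Ay By] /=; rewrite E'.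
Qed.

Lemma smoothat_comp x m (F : 'I_m -> X -> R) (B : set 'rV[R]_m) phi :
  (forall j, smoothat x (F j)) -> open B -> B (jointly F x) -> Cinf_on B phi ->
  smoothat x (phi \o jointly F).
Proof.
move=> /smoothat_joint[N [g [A [Phi [gC oA Ax CPhi E]]]]] oB Bx Cphi.
have E' y : A (jointly g y) -> jointly F y = jointly Phi (jointly g y).
  by move=> /E FE; apply/rowP => j; rewrite !mxE FE.
pose A' := [set a | A a /\ B (jointly Phi a)].
have oA' : open A' by apply: open_preim => // j; apply: CPhi.
exists N, g, A', (phi \o jointly Phi); split=> //.
- by split=> //; rewrite -E'.
- move=> n; apply: (Cn_on_comp oA') (Cphi n) _ => [j|a []] //.
  by apply: Cn_on_sub (CPhi j n) => a [].
- by move=> y [Ay By] /=; rewrite E'.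
Qed.

Lemma nearbyI x Q Q' : nearby x Q -> nearby x Q' -> nearby x (Q `&` Q').
Proof.
move=> [k [g [A [gC oA Ax H]]]] [k' [g' [A' [gC' oA' Ax' H']]]].
pose G (i : 'I_(k + k')) := match fintype.split i with inl j => g j | inr j => g' j end.
have GE y : select (@lshift k k') (jointly G y) = jointly g y.
  by rewrite select_jointly; congr (jointly _ y); apply/funext => j; rewrite /G (unsplitK (inl j)).
have GE' y : select (@rshift k k') (jointly G y) = jointly g' y.
  by rewrite select_jointly; congr (jointly _ y); apply/funext => j; rewrite /G (unsplitK (inr j)).
exists (k + k')%N, G, ([set a | A (select (@lshift k k') a)] `&` [set a | A' (select (@rshift k k') a)]).
split.
- by move=> i; rewrite /G; case: (fintype.split i).
- by apply: openI; apply: open_select.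
- by split; rewrite /= ?GE ?GE'.
- by move=> y [/=]; rewrite GE GE' => /H Qy /H' Qy'.
Qed.

Lemma nearbyS2 x Q Q' Q'' : (forall y, Q y -> Q' y -> Q'' y) ->
  nearby x Q -> nearby x Q' -> nearby x Q''.
Proof. by move=> H n n'; apply: nearby_mono (nearbyI n n') => y [? ?]; apply: H. Qed.

Lemma nearby_forall x m (Q : 'I_m -> set X) :
  (forall j, nearby x (Q j)) -> nearby x [set y | forall j, Q j y].
Proof.
elim: m Q => [|m IHm] Q nQ; first by apply: nearbyT => y [].
apply: nearbyS2 (nQ ord0) (IHm _ (fun j => nQ (lift ord0 j))) => y Q0 QS j.
by case: (unliftP ord0 j) => [j' ->|->].
Qed.

Lemma nearby_nearby x Q : nearby x Q -> nearby x [set y | nearby y Q].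
Proof.
by move=> [k [g [A [gC oA Ax H]]]]; exists k, g, A; split=> // y Ay; exists k, g, A.
Qed.

Lemma smoothat_nearby x f : smoothat x f -> nearby x [set y | smoothat y f].
Proof.
move=> [k [g [A [phi [gC oA Ax Cphi H]]]]]; exists k, g, A; split=> // y Ay.
by exists k, g, A, phi.
Qed.

(** A neighbourhood is itself cut out by members of the family, which can be
    added to the presentation of f. *)
Lemma smoothat_eq x f g : nearby x [set y | f y = g y] -> smoothat x f -> smoothat x g.
Proof.
move=> [k [G [B [GC oB Bx H]]]] smf.
pose F (i : 'I_k.+1) := if unlift ord0 i is Some j then G j else f.
have F0 : F ord0 = f by rewrite /F unlift_none.
have FS j : F (lift ord0 j) = G j by rewrite /F liftK.
have smF i : smoothat x (F i) by rewrite /F; case: unlift => // j; apply: smoothat_gen.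
have [N [g' [A [Phi [gC oA Ax CPhi E]]]]] := smoothat_joint smF.
pose B' := [set a | A a /\ B (jointly (fun j => Phi (lift ord0 j)) a)].
have E' y : A (jointly g' y) ->
    jointly G y = jointly (fun j => Phi (lift ord0 j)) (jointly g' y).
  by move=> /E FE; apply/rowP => j; rewrite !mxE -FE FS.
exists N, g', B', (Phi ord0); split=> //.
- by apply: open_preim => // j; apply: CPhi.
- by split=> //; rewrite -E'.
- by move=> n; apply: Cn_on_sub (CPhi ord0 n) => a [].
- by move=> y [Ay By]; rewrite -E // F0 -H // E'.
Qed.

Lemma smoothat_comp1 x f (D : set R) (F : R -> R) : open D -> D (f x) ->
  Cinf_on [set a : 'rV[R]_1 | D (a 0 0)] (fun a => F (a 0 0)) ->
  smoothat x f -> smoothat x (fun y => F (f y)).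
Proof.
move=> oD Df CF smf.
have := @smoothat_comp x 1 (fun=> f) _ _ (fun=> smf) (open_var1 oD) _ CF.
have -> : (fun a : 'rV[R]_1 => F (a 0 0)) \o jointly (fun=> f) = (fun y => F (f y)).
  by apply/funext => y /=; rewrite mxE.
by apply; rewrite /= mxE.
Qed.

Definition two f g (i : 'I_2) := if i == 0 then f else g.

Lemma smoothat_comp2 x f g (F : R -> R -> R) :
  Cinf_on [set: 'rV[R]_2] (fun a => F (a 0 0) (a 0 1)) ->
  smoothat x f -> smoothat x g -> smoothat x (fun y => F (f y) (g y)).
Proof.
move=> CF smf smg.
have sm2 j : smoothat x (two f g j) by rewrite /two; case: ifP.
have := smoothat_comp sm2 openT I CF.
by congr (smoothat x _); apply/funext => y /=; rewrite !mxE.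
Qed.

Lemma smoothat_cst x (c : R) : smoothat x (fun=> c).
Proof.
exists 0%N, (fun=> cst 0), setT, (fun=> c); split=> //; try by case.
- exact: openT.
- by move=> n; apply: Cn_on_cst.
Qed.

Lemma smoothatD x f g : smoothat x f -> smoothat x g -> smoothat x (fun y => f y + g y).
Proof.
apply: smoothat_comp2 => n; apply: Cn_onD; try exact: Cn_on_coord; exact: openT.
Qed.

Lemma smoothatM x f g : smoothat x f -> smoothat x g -> smoothat x (fun y => f y * g y).
Proof.
apply: smoothat_comp2 => n; apply: Cn_onM; try exact: Cn_on_coord; exact: openT.
Qed.

Lemma smoothatN x f : smoothat x f -> smoothat x (fun y => - f y).
Proof.
move=> smf; have := smoothatM (smoothat_cst x (-1)) smf.
by congr (smoothat x _); apply/funext => y; rewrite mulN1r.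
Qed.

Lemma smoothatB x f g : smoothat x f -> smoothat x g -> smoothat x (fun y => f y - g y).
Proof. by move=> smf /smoothatN; apply: smoothatD. Qed.

Lemma smoothat_sum x I (s : seq I) (P : pred I) (F : I -> X -> R) :
  (forall i, smoothat x (F i)) -> smoothat x (fun y => \sum_(i <- s | P i) F i y).
Proof.
move=> smF; elim: s => [|i s IHs].
  have -> : (fun y => \sum_(i <- [::] | P i) F i y) = fun=> 0 :> R.
    by apply/funext => y; rewrite big_nil.
  exact: smoothat_cst.
have -> : (fun y => \sum_(j <- i :: s | P j) F j y) =
   fun y => (if P i then F i y else 0) + \sum_(j <- s | P j) F j y.
  by apply/funext => y; rewrite big_cons; case: ifP; rewrite ?add0r.
by apply: smoothatD => //; case: (P i) => //; apply: smoothat_cst.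
Qed.

Lemma smoothat_prod x I (s : seq I) (P : pred I) (F : I -> X -> R) :
  (forall i, smoothat x (F i)) -> smoothat x (fun y => \prod_(i <- s | P i) F i y).
Proof.
move=> smF; elim: s => [|i s IHs].
  have -> : (fun y => \prod_(i <- [::] | P i) F i y) = fun=> 1 :> R.
    by apply/funext => y; rewrite big_nil.
  exact: smoothat_cst.
have -> : (fun y => \prod_(j <- i :: s | P j) F j y) =
   fun y => (if P i then F i y else 1) * \prod_(j <- s | P j) F j y.
  by apply/funext => y; rewrite big_cons; case: ifP; rewrite ?mul1r.
by apply: smoothatM => //; case: (P i) => //; apply: smoothat_cst.
Qed.

Lemma smoothatV x f : f x != 0 -> smoothat x f -> smoothat x (fun y => (f y)^-1).
Proof.
move=> fx0; apply: (@smoothat_comp1 x f [set t | t != 0] (@GRing.inv R)) => //.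
exact: Cinf_inv.
Qed.

Lemma smoothat_sqrt x f : 0 < f x -> smoothat x f -> smoothat x (fun y => Num.sqrt (f y)).
Proof.
move=> fx0; apply: (@smoothat_comp1 x f [set t | 0 < t] (@Num.sqrt R)) => //.
exact: Cinf_sqrt.
Qed.

Lemma smoothat_expR x f : smoothat x f -> smoothat x (fun y => expR (f y)).
Proof.
apply: (@smoothat_comp1 x f setT (@expR R)) => //; first exact: openT.
have -> : [set a : 'rV[R]_1 | setT (a 0 0)] = setT by apply/seteqP.
exact: Cinf_expR.
Qed.

Lemma nearby_neq0 x f : smoothat x f -> f x != 0 -> nearby x [set y | f y != 0].
Proof.
move=> smf fx0.
have := @nearby_smooth x 1 (fun=> f) [set a | a 0 0 != 0] (fun=> smf).
case=> [||k [g [A [gC oA Ax H]]]].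
- exact: (open_var1 (@open_neq R 0)).
- by rewrite /= mxE.
- by exists k, g, A; split=> // y /H /=; rewrite mxE.
Qed.

Lemma fopenI Q Q' : fopen Q -> fopen Q' -> fopen (Q `&` Q').
Proof. by move=> oQ oQ' x [/oQ nQ /oQ' nQ']; apply: nearbyI. Qed.

End SmoothFunctions.

(** * Tangent vectors and differentials of maps *)

Section PartialRules.
Context {R : realType} {k : nat}.
Local Notation diffble f a := (differentiable (f : 'rV[R]_k -> R^o) a).

Lemma Cinf_partial (A : set 'rV[R]_k) phi i : Cinf_on A phi -> Cinf_on A (partial i phi).
Proof. by move=> C n; apply: Cn_on_partial (C n.+1). Qed.

Lemma partialD (i : 'I_k) (f g : 'rV[R]_k -> R) a : diffble f a -> diffble g a ->
  partial i (fun b => f b + g b) a = partial i f a + partial i g a.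
Proof. by move=> df dg; apply: deriveD; apply: diff_derivable. Qed.

Lemma partialM (i : 'I_k) (f g : 'rV[R]_k -> R) a : diffble f a -> diffble g a ->
  partial i (fun b => f b * g b) a = f a * partial i g a + g a * partial i f a.
Proof. by move=> df dg; apply: deriveM; apply: diff_derivable. Qed.

End PartialRules.

Section TangentVectors.
Context {R : realType} {X : fspace R}.
Implicit Types (x y : X) (f g h : X -> R) (v w : tvec X).

Lemma tan_cst x v (c : R) : tangent x v -> v (fun=> c) = 0.
Proof.
move=> tv.
have := @tangent_chain _ _ _ _ tv 0%N (fun=> cst 0) setT (fun=> c) _ openT I.
by rewrite big_ord0; apply=> [[]//|n]; apply: Cn_on_cst.
Qed.

Lemma tan_comp1 x v f (D : set R) (F : R -> R) (d : R) : tangent x v -> open D -> D (f x) ->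
  Cinf_on [set a : 'rV[R]_1 | D (a 0 0)] (fun a => F (a 0 0)) ->
  is_derive (f x : R^o) 1 (F : R^o -> R^o) d -> smoothat x f ->
  v (fun y => F (f y)) = d * v f.
Proof.
move=> tv oD Dx CF dF smf.
have fx : jointly (fun _ : 'I_1 => f) x 0 0 = f x by rewrite mxE.
have := @tangent_chain _ _ _ _ tv 1%N (fun=> f) _ _ (fun=> smf) (open_var1 oD) _ CF.
rewrite /= big_ord1 fx => /(_ Dx).
rewrite -fx in dF; have [_ ->] := partial_var1 ord0 dF.
move=> <-; congr v; apply/funext => y /=; by rewrite mxE.
Qed.

Lemma tan_expR x v f : tangent x v -> smoothat x f ->
  v (fun y => expR (f y)) = expR (f x) * v f.
Proof.
move=> tv smf; apply: (@tan_comp1 x v f setT (@expR R)) => //; first exact: openT.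
have -> : [set a : 'rV[R]_1 | setT (a 0 0)] = setT by apply/seteqP.
exact: Cinf_expR.
Qed.

Lemma tan_comp2 x v f g (F : R -> R -> R) (d e : R) : tangent x v ->
  Cinf_on [set: 'rV[R]_2] (fun a => F (a 0 0) (a 0 1)) ->
  (forall a : 'rV[R]_2, a 0 0 = f x -> a 0 1 = g x ->
     partial 0 (fun a => F (a 0 0) (a 0 1)) a = d /\
     partial 1 (fun a => F (a 0 0) (a 0 1)) a = e) ->
  smoothat x f -> smoothat x g -> v (fun y => F (f y) (g y)) = d * v f + e * v g.
Proof.
move=> tv CF dF smf smg.
have sm2 j : smoothat x (two f g j) by rewrite /two; case: ifP.
have := tangent_chain tv sm2 openT I CF.
rewrite big_ord_recl big_ord1 (_ : lift ord0 ord0 = 1 :> 'I_2); last exact: val_inj.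
have [||-> ->] := dF (jointly (two f g) x); rewrite ?mxE //= => <-.
by congr v; apply/funext => y /=; rewrite !mxE.
Qed.

Lemma tangentD x v f g : tangent x v -> smoothat x f -> smoothat x g ->
  v (fun y => f y + g y) = v f + v g.
Proof.
move=> tv smf smg; rewrite (tan_comp2 (d := 1) (e := 1) tv _ _ smf smg) ?mul1r //.
  by move=> n; apply: Cn_onD; try exact: Cn_on_coord; exact: openT.
move=> a _ _; rewrite !partialD ?partial_coord ?addr0 ?add0r; try exact: differentiable_coord.
by [].
Qed.

Lemma tangentM x v f g : tangent x v -> smoothat x f -> smoothat x g ->
  v (fun y => f y * g y) = f x * v g + g x * v f.
Proof.
move=> tv smf smg; rewrite addrC (tan_comp2 (d := g x) (e := f x) tv _ _ smf smg) //.
  by move=> n; apply: Cn_onM; try exact: Cn_on_coord; exact: openT.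
move=> a af ag; rewrite !partialM ?partial_coord; try exact: differentiable_coord.
by rewrite af ag !mulr1 !mulr0 addr0 add0r.
Qed.

Lemma tangentZ x v (c : R) f : tangent x v -> smoothat x f -> v (fun y => c * f y) = c * v f.
Proof.
by move=> tv smf; rewrite (tangentM tv) ?(tan_cst c tv) ?mulr0 ?addr0 //; apply: smoothat_cst.
Qed.

Lemma tangentN x v f : tangent x v -> smoothat x f -> v (fun y => - f y) = - v f.
Proof.
by move=> tv smf; rewrite -mulN1r -(tangentZ _ tv) //; congr v; apply/funext => y; rewrite mulN1r.
Qed.

Lemma tangentB x v f g : tangent x v -> smoothat x f -> smoothat x g ->
  v (fun y => f y - g y) = v f - v g.
Proof.
by move=> tv smf smg; rewrite (tangentD tv) ?(tangentN tv) //; apply: smoothatN.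
Qed.

Lemma tan_sum x v n (F : 'I_n -> X -> R) : tangent x v -> (forall i, smoothat x (F i)) ->
  v (fun y => \sum_i F i y) = \sum_i v (F i).
Proof.
move=> tv; elim: n F => [|n IHn] F smF.
  rewrite big_ord0; apply: etrans (tan_cst 0 tv); congr v.
  by apply/funext => y; rewrite big_ord0.
rewrite big_ord_recl -IHn // -(tangentD tv) //; last exact: smoothat_sum.
by congr v; apply/funext => y; rewrite big_ord_recl.
Qed.

Lemma tangent_comb n x (c : 'I_n -> R) (v : 'I_n -> tvec X) : (forall i, tangent x (v i)) ->
  tangent x (fun f => \sum_i c i * v i f).
Proof.
move=> tv; split.
- by move=> f nf; rewrite big1 // => i _; rewrite (tangent_junk (tv i)) // mulr0.
- by move=> f g E; apply: eq_bigr => i _; rewrite (tangent_germ (tv i) E).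
- move=> k f A phi smf oA Ax CA.
  under eq_bigr do rewrite (tangent_chain (tv _) smf oA Ax CA) mulr_sumr.
  rewrite exchange_big; apply: eq_bigr => i _ /=; rewrite mulr_sumr.
  by apply: eq_bigr => j _; rewrite mulrCA.
Qed.

Lemma tangent_lincomb n x (c : 'rV[R]_n) (e : frame X n) :
  (forall i, tangent x (e i)) -> tangent x (lincomb c e).
Proof. exact: tangent_comb. Qed.

Lemma tangent0 x : tangent x (fun=> 0).
Proof.
split=> // k f A phi _ _ _ _.
by rewrite big1 // => i _; rewrite mulr0.
Qed.

(** By the chain rule a tangent vector is determined by its values on the family. *)
Lemma tangent_ext x v w : tangent x v -> tangent x w ->
  (forall h, Cinfty h -> v h = w h) -> v = w.
Proof.
move=> tv tw E; apply/funext => f.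
have [smf|nsm] := pselect (smoothat x f); last by rewrite (tangent_junk tv) ?(tangent_junk tw).
have [k [g [A [phi [gC oA Ax Cphi H]]]]] := smf.
have n : nearby x [set y | f y = (phi \o jointly g) y] by exists k, g, A; split.
have smg i : smoothat x (g i) by apply: smoothat_gen.
rewrite (tangent_germ tv n) (tangent_germ tw n) (tangent_chain tv smg oA Ax Cphi).
by rewrite (tangent_chain tw smg oA Ax Cphi); apply: eq_bigr => i _; rewrite E.
Qed.

Lemma tangent_ext_smooth x v w : tangent x v -> tangent x w ->
  (forall h, smoothat x h -> v h = w h) -> v = w.
Proof. by move=> tv tw E; apply: (tangent_ext tv tw) => h Ch; apply/E/smoothat_gen. Qed.

Lemma smooth_field_at (V : set X) Z x f : fopen V -> smooth_field V Z -> V x ->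
  smoothat x f -> smoothat x (fun y => Z y f).
Proof.
move=> oV ZV Vx [k [g [A [phi [gC oA Ax Cphi H]]]]].
have smg y i : smoothat y (g i) by apply: smoothat_gen.
have nA : nearby x [set y | A (jointly g y)] by exists k, g, A.
apply: (@smoothat_eq _ _ _ (fun y => \sum_i partial i phi (jointly g y) * Z y (g i))).
  apply: nearbyS2 nA (oV x Vx) => y Ay Vy /=.
  have [tZ _] := ZV y Vy.
  have n : nearby y [set y | f y = (phi \o jointly g) y] by exists k, g, A; split.
  by rewrite (tangent_germ tZ n) (tangent_chain tZ (smg y) oA Ay Cphi).
apply: smoothat_sum => i; apply: smoothatM.
  by apply: (smoothat_comp (smg x) oA Ax); apply: Cinf_partial.
by have [_ ZC] := ZV x Vx; apply: ZC.
Qed.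

Lemma smooth_field_sub (V W : set X) Z : W `<=` V -> smooth_field V Z -> smooth_field W Z.
Proof. by move=> sWV ZV x /sWV /ZV. Qed.

Lemma smooth_field_comb n (V : set X) (c : 'I_n -> X -> R) (Z : 'I_n -> X -> tvec X) :
  (forall i, smooth_field V (Z i)) -> (forall i x, V x -> smoothat x (c i)) ->
  smooth_field V (fun x f => \sum_i c i x * Z i x f).
Proof.
move=> ZV cV x Vx; split.
  by apply: (tangent_comb (fun i => c i x)) => i; case: (ZV i x Vx).
by move=> f Cf; apply: smoothat_sum => i; apply: smoothatM; [apply: cV|case: (ZV i x Vx) => _; apply].
Qed.

End TangentVectors.

Section Maps.
Context {R : realType}.

Definition smooth_map_at (X Y : fspace R) (phi : X -> Y) (x : X) :=
  forall h, Cinfty h -> smoothat x (h \o phi).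

Lemma smooth_map_atE (X Y : fspace R) (phi : X -> Y) x f :
  smooth_map_at phi x -> smoothat (phi x) f -> smoothat x (f \o phi).
Proof.
move=> sphi [k [g [A [chi [gC oA Ax Cchi H]]]]].
have smg i : smoothat x (g i \o phi) by apply: sphi.
have jE y : jointly (fun i => g i \o phi) y = jointly g (phi y) by apply/rowP => i; rewrite !mxE.
apply: (@smoothat_eq _ _ _ (chi \o jointly (fun i => g i \o phi))).
  have := @nearby_smooth _ _ x _ _ A smg oA; rewrite jE => /(_ Ax).
  by apply: nearby_mono => y /=; rewrite jE => Ay; rewrite H.
by apply: (smoothat_comp smg oA); rewrite ?jE.
Qed.

Lemma smooth_map_near (X Y : fspace R) (phi : X -> Y) x Q :
  smooth_map_at phi x -> nearby (phi x) Q -> nearby x [set y | Q (phi y)].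
Proof.
move=> sphi [k [g [A [gC oA Ax H]]]].
have smg i : smoothat x (g i \o phi) by apply: sphi.
have jE y : jointly (fun i => g i \o phi) y = jointly g (phi y) by apply/rowP => i; rewrite !mxE.
have := @nearby_smooth _ _ x _ _ A smg oA; rewrite jE => /(_ Ax).
by apply: nearby_mono => y /=; rewrite jE; apply: H.
Qed.

Lemma smooth_map_all (X Y : fspace R) (phi : X -> Y) x :
  smooth_map phi -> smooth_map_at phi x.
Proof. by move=> sphi h /sphi; apply: smoothat_gen. Qed.

Lemma pushE (X Y : fspace R) (phi : X -> Y) x (v : tvec X) h :
  smoothat (phi x) h -> push phi x v h = v (h \o phi).
Proof. by rewrite /push => smh; case: asboolP. Qed.

Lemma push_tangent (X Y : fspace R) (phi : X -> Y) x (v : tvec X) :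
  smooth_map_at phi x -> tangent x v -> tangent (phi x) (push phi x v).
Proof.
move=> sphi tv; split.
- by move=> f nsm; rewrite /push; case: asboolP.
- move=> f g E; have E' : nearby (phi x) [set y | g y = f y] by apply: nearby_mono E.
  rewrite /push; case: asboolP => [smf|nf]; case: asboolP => [smg|ng] //.
  + by apply: (tangent_germ tv); apply: (smooth_map_near sphi E).
  + by case: ng; apply: smoothat_eq E smf.
  + by case: nf; apply: smoothat_eq E' smg.
- move=> k f A chi smf oA Ax CA.
  have smf' i : smoothat x (f i \o phi) by apply: smooth_map_atE.
  have jE y : jointly (fun i => f i \o phi) y = jointly f (phi y) by apply/rowP => i; rewrite !mxE.
  rewrite pushE; last exact: smoothat_comp smf oA Ax CA.
  have := @tangent_chain _ _ _ _ tv _ _ A chi smf' oA; rewrite jE => /(_ Ax CA).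
  have -> : chi \o jointly (fun i => f i \o phi) = (chi \o jointly f) \o phi.
    by apply/funext => y /=; rewrite jE.
  by move=> ->; apply: eq_bigr => i _; rewrite pushE.
Qed.

Lemma push_push (X Y Z : fspace R) (phi : X -> Y) (psi : Y -> Z) x (v : tvec X) :
  smooth_map_at psi (phi x) ->
  push psi (phi x) (push phi x v) = push (psi \o phi) x v.
Proof.
move=> spsi; apply/funext => h; rewrite {1 3}/push /=.
case: asboolP => // smh; rewrite pushE //; exact: smooth_map_atE.
Qed.

Lemma push_near (X Y : fspace R) (phi psi : X -> Y) x (v : tvec X) :
  tangent x v -> nearby x [set y | phi y = psi y] -> push phi x v = push psi x v.
Proof.
move=> tv E; have Ex := nearby_self E; apply/funext => h; rewrite /push Ex.
by case: asboolP => // smh; apply: (tangent_germ tv); apply: nearby_mono E => y /= ->.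
Qed.

Lemma push_id (X : fspace R) x (v : tvec X) : tangent x v -> push id x v = v.
Proof.
by move=> tv; apply/funext => h; rewrite /push; case: asboolP => // /(tangent_junk tv) ->.
Qed.

Lemma push_comb (X Y : fspace R) (phi : X -> Y) x n (c : 'I_n -> R) (v : 'I_n -> tvec X) :
  push phi x (fun f => \sum_i c i * v i f) = fun h => \sum_i c i * push phi x (v i) h.
Proof.
apply/funext => h; rewrite /push; case: asboolP => // _.
by rewrite big1 // => i _; rewrite mulr0.
Qed.

End Maps.

Section GeneratedStructure.
Context {R : realType} {T : Type} (gen : set (T -> R)).
Local Notation X0 := (FSpace gen).
Local Notation X := (Defs.generated gen).

Lemma Cinfty_gen (h : T -> R) : gen h -> @Cinfty R X h.
Proof. by move=> gh x; apply: smoothat_gen. Qed.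

(** Closing the family under local smooth expressions adds no new germs. *)
Lemma smoothat_generated (x : T) (f : T -> R) :
  @smoothat R X x f <-> @smoothat R X0 x f.
Proof.
split=> [[k [g [A [phi [gC oA Ax Cphi H]]]]]|[k [g [A [phi [gC oA Ax Cphi H]]]]]].
  have smg i : @smoothat R X0 x (g i) by apply: gC.
  apply: (smoothat_eq _ (smoothat_comp smg oA Ax Cphi)).
  by apply: nearby_mono (nearby_smooth smg oA Ax) => y /H.
exists k, g, A, phi; split=> //.
by move=> i; apply: Cinfty_gen; apply: gC.
Qed.

Lemma nearby_generated (x : T) (Q : set T) :
  @nearby R X0 x Q -> @nearby R X x Q.
Proof.
by move=> [k [g [A [gC oA Ax H]]]]; exists k, g, A; split=> //; move=> i; apply: Cinfty_gen; apply: gC.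
Qed.

Lemma smooth_to_generated (Y : fspace R) (phi : Y -> T) (y : Y) :
  (forall h, gen h -> smoothat y (h \o phi)) -> @smooth_map_at R Y X phi y.
Proof.
move=> H h Ch; have smh : @smoothat R X0 (phi y) h by apply: Ch.
exact: (@smooth_map_atE R Y X0 phi y h).
Qed.

End GeneratedStructure.

(** * Frames and charts *)

Section SmoothLinearAlgebra.
Context {R : realType} {X : fspace R}.

Lemma smoothat_det (x : X) n (A : 'I_n -> 'I_n -> X -> R) :
  (forall i j, smoothat x (A i j)) -> smoothat x (fun y => \det (\matrix_(i, j) A i j y)).
Proof.
move=> smA; apply: smoothat_sum => s; apply: smoothatM; first exact: smoothat_cst.
have -> : (fun y => \prod_i (\matrix_(i, j) A i j y) i (s i)) = fun y => \prod_i A i (s i) y.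
  by apply/funext => y; apply: eq_bigr => i _; rewrite mxE.
exact: smoothat_prod.
Qed.

(** Cramer's rule *)
Lemma smoothat_solve (x : X) n (A : 'I_n -> 'I_n -> X -> R) (b u : 'I_n -> X -> R) :
  (forall i j, smoothat x (A i j)) -> (forall i, smoothat x (b i)) ->
  \det (\matrix_(i, j) A i j x) != 0 ->
  nearby x [set y | forall i, \sum_j A i j y * u j y = b i y] ->
  forall j, smoothat x (u j).
Proof.
case: n A b u => [|n] A b u smA smb dx E j; first by case: j.
pose M y := \matrix_(i, j) A i j y.
have smd : smoothat x (fun y => \det (M y)) by apply: smoothat_det.
have nd : nearby x [set y | \det (M y) != 0] by apply: nearby_neq0.
pose rhs y := (\det (M y))^-1 * \sum_i (\adj (M y)) j i * b i y.
apply: (@smoothat_eq _ _ _ rhs).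
  apply: nearbyS2 nd E => y dy Ey /=.
  have MU : M y *m (\col_j u j y) = \col_i b i y.
    by apply/colP => i; rewrite !mxE -Ey; apply: eq_bigr => l _; rewrite !mxE.
  have := congr1 (fun W => (\adj (M y) *m W) j 0) MU.
  rewrite mulmxA mul_adj_mx mul_scalar_mx [LHS]mxE [X in _ * X]mxE => Ej.
  rewrite /rhs (_ : \sum_i (\adj (M y)) j i * b i y = (\adj (M y) *m (\col_i b i y)) j 0).
    by rewrite -Ej mulKf.
  by rewrite [RHS]mxE; apply: eq_bigr => i _; congr (_ * _); rewrite mxE.
apply: smoothatM; first exact: smoothatV.
apply: smoothat_sum => i; apply: smoothatM => //.
have -> : (fun y => (\adj (M y)) j i) =
   fun y => (-1) ^+ (i + j) * \det (\matrix_(k, l) A (lift i k) (lift j l) y).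
  apply/funext => y; rewrite mxE /cofactor; congr (_ * \det _).
  by apply/matrixP => k l; rewrite !mxE.
by apply: smoothatM; [apply: smoothat_cst|apply: smoothat_det].
Qed.

End SmoothLinearAlgebra.

Section Frames.
Context {R : realType} {X : fspace R} {n : nat}.
Implicit Types (x : X) (e : frame X n) (v : tvec X) (c : 'rV[R]_n).

Lemma frame_coordinates x e v : is_frame x e -> tangent x v -> v = lincomb (coordinates e v) e.
Proof.
move=> [te ue] /ue[c [cE _]].
exact: (@xgetPex _ 0 [set c | v = lincomb c e] (ex_intro _ c cE)).
Qed.

Lemma frame_inj x e c c' : is_frame x e -> lincomb c e = lincomb c' e -> c = c'.
Proof.
move=> [te ue] E; have [d [_ dU]] := ue _ (tangent_lincomb c te).
by rewrite -(dU c) // -(dU c').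
Qed.

Lemma coordinates_lincomb x e c : is_frame x e -> coordinates e (lincomb c e) = c.
Proof.
move=> fe; apply: (frame_inj fe).
by rewrite -(frame_coordinates fe) //; apply: tangent_lincomb; case: fe.
Qed.

Lemma coordinatesP x e v c : is_frame x e -> v = lincomb c e -> coordinates e v = c.
Proof. by move=> fe ->; apply: (coordinates_lincomb _ fe). Qed.

Lemma lincomb_delta e i : lincomb (delta_mx 0 i) e = e i.
Proof.
apply/funext => f; rewrite /lincomb (bigD1 i) //= mxE !eqxx mul1r big1 ?addr0 //.
by move=> j ji; rewrite mxE (negPf ji) andbF mul0r.
Qed.

Lemma coordinates_frame x e i : is_frame x e -> coordinates e (e i) = delta_mx 0 i.
Proof. by move=> fe; rewrite -[in LHS](lincomb_delta e i) (coordinates_lincomb _ fe). Qed.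

Lemma lincomb_comb e m (a : 'I_m -> R) (c : 'I_m -> 'rV[R]_n) :
  lincomb (\sum_l a l *: c l) e = (fun f => \sum_l a l * lincomb (c l) e f).
Proof.
apply/funext => f; rewrite /lincomb; under eq_bigr do rewrite summxE mulr_suml.
rewrite exchange_big; apply: eq_bigr => l _ /=; rewrite mulr_sumr.
by apply: eq_bigr => j _; rewrite mxE mulrA.
Qed.

Lemma coordinates_comb x e m (a : 'I_m -> R) (v : 'I_m -> tvec X) : is_frame x e ->
  (forall l, tangent x (v l)) ->
  coordinates e (fun f => \sum_l a l * v l f) = \sum_l a l *: coordinates e (v l).
Proof.
move=> fe tv; apply: (coordinatesP fe); rewrite lincomb_comb.
apply/funext => f; apply: eq_bigr => l _; congr (_ * _).
by rewrite -(frame_coordinates fe (tv l)).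
Qed.

Definition change_frame (A : 'M[R]_n) e : frame X n := fun i => lincomb (row i A) e.

Lemma lincomb_change (A : 'M[R]_n) e c : lincomb c (change_frame A e) = lincomb (c *m A) e.
Proof.
rewrite mulmx_sum_row lincomb_comb; apply/funext => f.
by apply: eq_bigr.
Qed.

Lemma change_is_frame x e (A : 'M[R]_n) : is_frame x e -> A \in unitmx ->
  is_frame x (change_frame A e).
Proof.
move=> fe uA; split=> [i|v tv]; first by apply: tangent_lincomb; case: fe.
exists (coordinates e v *m invmx A); split.
  by rewrite lincomb_change mulmxKV // -(frame_coordinates fe).
move=> c; rewrite lincomb_change => /(coordinatesP fe) ->; by rewrite mulmxK.
Qed.

Lemma coordinates_change x e (A : 'M[R]_n) v : is_frame x e -> A \in unitmx -> tangent x v ->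
  coordinates (change_frame A e) v *m A = coordinates e v.
Proof.
move=> fe uA tv; apply/esym/(coordinatesP fe); rewrite -lincomb_change.
exact: (frame_coordinates (change_is_frame fe uA)).
Qed.

Definition transition e e' : 'M[R]_n := \matrix_i coordinates e (e' i).

Lemma transitionE x e e' : is_frame x e -> is_frame x e' -> change_frame (transition e e') e = e'.
Proof.
move=> fe fe'; apply/funext => i; rewrite /change_frame rowK -(frame_coordinates fe) //.
by case: fe'.
Qed.

Lemma transition_unit x e e' : is_frame x e -> is_frame x e' -> transition e e' \in unitmx.
Proof.
move=> fe fe'; suff /mulmx1_unit[] : transition e e' *m transition e' e = 1%:M by [].
have H (f f' : frame X n) : is_frame x f -> is_frame x f' ->
    transition f' f *m transition f f' = 1%:M.
  move=> ff ff'; apply/row_matrixP => i; rewrite row1 rowE.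
  apply: (frame_inj ff); rewrite mulmxA -lincomb_change (transitionE ff ff').
  by rewrite -lincomb_change (transitionE ff' ff).
exact: H.
Qed.

Lemma coordinates_transition x e e' v : is_frame x e -> is_frame x e' -> tangent x v ->
  coordinates e' v *m transition e e' = coordinates e v.
Proof.
move=> fe fe' tv; apply/esym/(coordinatesP fe); rewrite -lincomb_change (transitionE fe fe').
exact: (frame_coordinates fe').
Qed.

End Frames.

Section Charts.
Context {R : realType} {X : fspace R} {n : nat} (U : set X) (c : 'I_n -> X -> R).
Hypothesis cU : chart U c.
Implicit Types (x y : X) (v : tvec X) (f : X -> R).

(** A local expression of f in the chart, of which only the germ at x matters. *)
Definition represents (f : X -> R) x (phi : 'rV[R]_n -> R) :=
  exists A : set 'rV[R]_n, [/\ open A, A (jointly c x), Cinf_on A phi &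
    nearby x [set y | A (jointly c y) -> f y = phi (jointly c y)]].

(** The coordinate derivation; by represents_unique below it does not depend on
    the local expression. *)
Definition coordvec x (i : 'I_n) : tvec X := fun f =>
  xget 0 [set d | exists2 phi, represents f x phi & d = partial i phi (jointly c x)].

Lemma chart_smoothat x i : U x -> smoothat x (c i).
Proof. by case: cU => _ + _ _ _ Ux; apply. Qed.

Lemma chart_fopen : fopen U.
Proof. by case: cU. Qed.

(** The neighbourhoods of x are defined by members of the family, which the chart
    expresses by coordinates: both topologies agree. *)
Lemma chart_image_nearby x Q : U x -> nearby x Q ->
  exists2 B : set 'rV[R]_n, open B /\ B (jointly c x) & forall b, B b ->
    exists2 y, b = jointly c y & Q y.
Proof.
case: cU => oU _ _ oimg rep Ux [k [g [A [gC oA Ax H]]]].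
have /choice[A_ /choice[gam H2]] l : exists (A : set 'rV[R]_n) phi, [/\ open A,
    A (jointly c x), Cinf_on A phi & forall y, U y -> A (jointly c y) -> g l y = phi (jointly c y)].
  by apply: rep => //; apply/smoothat_gen/gC.
pose B0 := [set b | (jointly c @` U) b /\ forall l, A_ l b].
have oB0 : open B0.
  by apply: openI => //; apply: open_forall => l; case: (H2 l).
have gE y : U y -> (forall l, A_ l (jointly c y)) -> jointly gam (jointly c y) = jointly g y.
  by move=> Uy Ay; apply/rowP => l; rewrite !mxE; case: (H2 l) => _ _ _ ->.
exists [set b | B0 b /\ A (jointly gam b)]; first split.
- apply: open_preim => // l; case: (H2 l) => _ _ Cg _.
  by apply: Cn_on_sub (Cg 0%N) => b [_]; apply.
- by split; [split; [exists x|move=> l; case: (H2 l)]|rewrite gE // => l; case: (H2 l)].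
- move=> b [[[y Uy <-] Ab] Agam]; exists y => //; apply: H.
  by rewrite -gE.
Qed.

Lemma chart_represents x f : U x -> smoothat x f -> exists phi, represents f x phi.
Proof.
move=> Ux smf; case: cU => oU _ _ _ /(_ x f Ux smf)[A [phi [oA Ax CA E]]].
exists phi, A; split=> //; apply: nearby_mono (oU x Ux) => y Uy; exact: E.
Qed.

Lemma chart_nearby x (B : set 'rV[R]_n) : U x -> open B -> B (jointly c x) ->
  nearby x [set y | B (jointly c y)].
Proof. by move=> Ux; apply: nearby_smooth => i; apply: chart_smoothat. Qed.

Lemma represents_smooth x f phi : U x -> represents f x phi -> smoothat x f.
Proof.
move=> Ux [A [oA Ax CA E]].
have smc i : smoothat x (c i) by apply: chart_smoothat.
apply: (smoothat_eq _ (smoothat_comp smc oA Ax CA)).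
by apply: nearbyS2 E (chart_nearby Ux oA Ax) => y H /H.
Qed.

Lemma represents_unique x f phi psi i : U x -> represents f x phi -> represents f x psi ->
  partial i phi (jointly c x) = partial i psi (jointly c x).
Proof.
move=> Ux [A [oA Ax CA E]] [A' [oA' Ax' CA' E']].
have [B [oB Bx] HB] := chart_image_nearby Ux (nearbyI E E').
apply: near_eq_partial.
apply: filterS (open_nbhs_nbhs (conj (openI (openI oA oA') oB) (conj (conj Ax Ax') Bx))).
by move=> a [[Aa Aa'] /HB[y ay [H H']]]; rewrite ay in Aa Aa' *; rewrite -H // -H'.
Qed.

Lemma coordvecE x f phi i : U x -> represents f x phi ->
  coordvec x i f = partial i phi (jointly c x).
Proof.
move=> Ux rf; rewrite /coordvec.
case: xgetP => [d _ [psi rf' ->]|nE]; first exact: represents_unique rf' rf.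
by case: (nE (partial i phi (jointly c x))); exists phi.
Qed.

Lemma coordvec_tangent x i : U x -> tangent x (coordvec x i).
Proof.
move=> Ux; split.
- move=> f nsf; rewrite /coordvec; case: xgetP => [d _ [phi rf _]|//].
  by case: nsf; apply: represents_smooth rf.
- move=> f g E; congr (xget 0 _); apply/seteqP; split=> d [phi [A [oA Ax CA H]] dE];
    exists phi => //; exists A; split=> //; apply: nearbyS2 E H => y Ey H Ay.
    by rewrite -Ey; apply: H.
  by rewrite Ey; apply: H.
- move=> k f A chi smf oA Ax CA.
  have /choice[phi rphi] l : exists phi, represents (f l) x phi by apply: chart_represents.
  have fx : jointly phi (jointly c x) = jointly f x.
    apply/rowP => l; rewrite !mxE; have [B [_ Bx _ /nearby_self ->]] := rphi l => //.
  have /choice[B_ HB] := rphi.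
  pose B0 := [set b | forall l, B_ l b].
  have oB0 : open B0 by apply: open_forall => l; case: (HB l).
  pose B := [set b | B0 b /\ A (jointly phi b)].
  have CB0 l n' : Cn_on n' B0 (phi l).
    by case: (HB l) => _ _ Cl _; apply: Cn_on_sub (Cl n') => b; apply.
  have oB : open B by apply: open_preim => // l; apply: CB0.
  have rep : represents (chi \o jointly f) x (chi \o jointly phi).
    exists B; split=> //.
    + by split; [move=> l; case: (HB l)|rewrite fx].
    + move=> n'; apply: (Cn_on_comp oB) (CA n') _ => [l|b []//].
      by apply: Cn_on_sub (CB0 l n') => b [].
    + have : nearby x [set y | forall l, B_ l (jointly c y) -> f l y = phi l (jointly c y)].
        by apply: nearby_forall => l; case: (HB l).
      apply: nearby_mono => y H [B0y _] /=; congr chi; apply/rowP => l; rewrite !mxE.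
      exact: H.
  rewrite (coordvecE _ Ux rep) partial_comp.
  + by rewrite fx; apply: eq_bigr => l _; rewrite (coordvecE _ Ux (rphi l)).
  + by move=> l; case: (HB l) => _ Bx Cl _; apply: Cn_on_diff (Cl 0%N) Bx.
  + by rewrite fx; apply: Cn_on_diff (CA 0%N) Ax.
Qed.

Lemma coordvec_coord x i j : U x -> coordvec x i (c j) = (i == j)%:R.
Proof.
move=> Ux; rewrite (@coordvecE _ _ (fun a => a 0 j)) ?partial_coord //.
exists setT; split=> //; first exact: openT.
  by move=> k; apply: Cn_on_coord.
by apply: nearbyT => y _; rewrite mxE.
Qed.

Lemma coordvec_decomp x v : U x -> tangent x v -> v = lincomb (\row_i v (c i)) (coordvec x).
Proof.
move=> Ux tv.
have te i := coordvec_tangent i Ux.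
apply: (tangent_ext_smooth tv (tangent_lincomb _ te)) => h smh.
have [phi rh] := chart_represents Ux smh; have [A [oA Ax CA E]] := rh.
have smc i : smoothat x (c i) by apply: chart_smoothat.
have Eh : nearby x [set y | h y = (phi \o jointly c) y].
  by apply: nearbyS2 E (chart_nearby Ux oA Ax) => y H /H.
rewrite (tangent_germ tv Eh) (tangent_chain tv smc oA Ax CA) /lincomb.
by apply: eq_bigr => i _; rewrite mxE mulrC (coordvecE _ Ux rh).
Qed.

Lemma coordvec_frame x : U x -> is_frame x (coordvec x).
Proof.
move=> Ux; split=> [i|v tv]; first exact: coordvec_tangent.
exists (\row_i v (c i)); split; first exact: coordvec_decomp.
move=> d ->; apply/rowP => i; rewrite mxE /lincomb (bigD1 i) //= coordvec_coord // eqxx mulr1.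
by rewrite big1 ?addr0 // => j ji; rewrite coordvec_coord // (negPf ji) mulr0.
Qed.

Lemma coordvec_field i : smooth_field U (coordvec^~ i).
Proof.
move=> x Ux; split=> [|f Cf]; first exact: coordvec_tangent.
have [phi [A [oA Ax CA E]]] := chart_represents Ux (smoothat_gen x Cf).
have smc j : smoothat x (c j) by apply: chart_smoothat.
apply: (smoothat_eq _ (smoothat_comp smc oA Ax (Cinf_partial i CA))).
have := nearbyI (nearby_nearby E) (nearbyI (chart_nearby Ux oA Ax) (chart_fopen Ux)).
apply: nearby_mono => y [nE [Ay Uy]] /=.
by rewrite (@coordvecE _ _ phi) //; exists A.
Qed.

End Charts.

(** * Products and frame bundles *)

Section Products.
Context {R : realType} {X Y : fspace R}.
Local Notation XY := (prodspace X Y).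

Lemma prod_slice_l (x : X) (y : Y) : @smooth_map_at R X XY (fun x' => (x', y)) x.
Proof.
apply: smooth_to_generated => _ [[h Ch ->]|[h Ch ->]]; first exact: smoothat_gen.
exact: (smoothat_cst x (h y)).
Qed.

(** In terms of the generators the mixed derivative is a sum of products of
    functions of the second variable. *)
Lemma smoothat_partial_derivation (x : X) (y : Y) (w : tvec X) (f : X * Y -> R) : tangent x w ->
  @smoothat R XY (x, y) f -> smoothat y (fun y' => w (fun x' => f (x', y'))).
Proof.
move=> tw /smoothat_generated [k [g [A [phi [gC oA Axy Cphi H]]]]].
have smgr l y' : smoothat y' (fun y' => g l (x, y')).
  by case: (gC l) => [[h Ch ->]|[h Ch ->]]; [exact: (smoothat_cst y' (h x))|exact: smoothat_gen].
have smgl l y' : smoothat x (fun x' => g l (x', y')).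
  by case: (gC l) => [[h Ch ->]|[h Ch ->]]; [exact: smoothat_gen|exact: (smoothat_cst x (h y'))].
have jl y' x' : jointly (fun l x' => g l (x', y')) x' = jointly g (x', y').
  by apply/rowP => l; rewrite !mxE.
have jr y' : jointly (fun l y' => g l (x, y')) y' = jointly g (x, y').
  by apply/rowP => l; rewrite !mxE.
pose rhs y' := \sum_l partial l phi (jointly (fun l y' => g l (x, y')) y') * w (fun x' => g l (x', y)).
apply: (@smoothat_eq _ _ _ rhs).
  have nA : nearby y [set y' | A (jointly g (x, y'))].
    have := @nearby_smooth _ _ y _ (fun l y' => g l (x, y')) A (fun l => smgr l y) oA.
    by rewrite jr => /(_ Axy); apply: nearby_mono => y' /=; rewrite jr.
  apply: nearby_mono nA => y' Ay' /=.
  have n : nearby x [set x' | f (x', y') = (phi \o jointly (fun l x' => g l (x', y'))) x'].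
    have := @nearby_smooth _ _ x _ (fun l x' => g l (x', y')) A (fun l => smgl l y') oA.
    by rewrite jl => /(_ Ay'); apply: nearby_mono => x' /=; rewrite jl => /H ->.
  rewrite (tangent_germ tw n).
  have := @tangent_chain _ _ _ _ tw _ (fun l x' => g l (x', y')) A phi (fun l => smgl l y') oA.
  rewrite jl => /(_ Ay' Cphi) ->; apply: eq_bigr => l _; rewrite jr; congr (_ * _).
  case: (gC l) => [[h Ch ->]|[h Ch ->]] //=.
  by rewrite (tan_cst _ tw) (tan_cst _ tw).
apply: smoothat_sum => l; apply: smoothatM; last exact: smoothat_cst.
apply: (smoothat_comp (fun l => smgr l y) oA _ (Cinf_partial l Cphi)).
by rewrite jr.
Qed.

End Products.

Section FrameSpaces.
Context {R : realType} {X : fspace R} {n : nat} (S : X -> frame X n -> Prop).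
Local Notation P := (frame_space S).
Implicit Types (p : P).

Lemma fbase_smooth p : smooth_map_at (@fbase R X n S) p.
Proof. by move=> h Ch; apply/smoothat_gen/Cinfty_gen; left; exists h. Qed.

Lemma fframe_smooth p i h : Cinfty h -> @smoothat R P p (fun p' => fframe p' i h).
Proof. by move=> Ch; apply/smoothat_gen/Cinfty_gen; right; exists i, h. Qed.

Lemma fframe_smoothat p i h :
  (forall x e, S x e -> tangent x (e i)) -> smoothat (fbase p) h ->
  @smoothat R P p (fun p' => fframe p' i h).
Proof.
move=> tS [k [g [A [phi [gC oA Ax Cphi H]]]]].
have smg x l : smoothat x (g l) by apply: smoothat_gen.
have smgb l : smoothat p (g l \o @fbase R X n S) by apply: fbase_smooth.
have jE p' : jointly (fun l => g l \o @fbase R X n S) p' = jointly g (fbase p').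
  by apply/rowP => l; rewrite !mxE.
have nA : nearby p [set p' : P | A (jointly g (fbase p'))].
  have := @nearby_smooth _ _ p _ _ A smgb oA; rewrite jE => /(_ Ax).
  by apply: nearby_mono => p' /=; rewrite jE.
pose rhs (p' : P) := \sum_l partial l phi (jointly (fun l => g l \o @fbase R X n S) p') * fframe p' i (g l).
apply: (@smoothat_eq _ _ _ rhs).
  apply: nearby_mono nA => p' Ap' /=.
  have tp' : tangent (fbase p') (fframe p' i) by apply: tS (svalP p').
  have nh : nearby (fbase p') [set y | h y = (phi \o jointly g) y] by exists k, g, A; split.
  rewrite (tangent_germ tp' nh) (tangent_chain tp' (smg _) oA Ap' Cphi).
  by apply: eq_bigr => l _; rewrite jE.
apply: smoothat_sum => l; apply: smoothatM; last exact: fframe_smooth.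
by apply: (smoothat_comp smgb oA _ (Cinf_partial l Cphi)); rewrite jE.
Qed.

Lemma smooth_to_frames (Y : fspace R) (phi : Y -> P) (y : Y) :
  smooth_map_at (fun y' => fbase (phi y')) y ->
  (forall i h, Cinfty h -> smoothat y (fun y' => fframe (phi y') i h)) -> smooth_map_at phi y.
Proof.
move=> Hb Hf; apply: smooth_to_generated => _ [[h Ch ->]|[i [h Ch ->]]].
  exact: Hb.
exact: Hf.
Qed.

End FrameSpaces.

(** * Linear algebra of C^3 *)

Section ComplexThreeSpace.
Context {R : realType}.
Local Notation C := R[i].
Local Notation i0 := (ord0 : 'I_3).
Local Notation i1 := (lift ord0 ord0 : 'I_3).
Local Notation i2 := (lift ord0 (lift ord0 ord0) : 'I_3).
Implicit Types (a b : 'rV[R]_(3 + 3)) (u v w : 'rV[C]_3).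

Lemma sum3 (V : nmodType) (F : 'I_3 -> V) : \sum_i F i = F i0 + F i1 + F i2.
Proof. by rewrite !big_ord_recl big_ord0 addr0 addrA. Qed.

Lemma forall3 (Q : 'I_3 -> Prop) : Q i0 -> Q i1 -> Q i2 -> forall i, Q i.
Proof.
move=> Q0 Q1 Q2 i; case: (unliftP ord0 i) => [j ->|->] //.
case: (unliftP ord0 j) => [k ->|->] //.
by rewrite (ord1 k).
Qed.

Lemma det3 (K : comNzRingType) (A : 'M[K]_3) : \det A =
  A i0 i0 * (A i1 i1 * A i2 i2 - A i1 i2 * A i2 i1)
  - A i0 i1 * (A i1 i0 * A i2 i2 - A i1 i2 * A i2 i0)
  + A i0 i2 * (A i1 i0 * A i2 i1 - A i1 i1 * A i2 i0).
Proof.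
pose a m n := A (inord m) (inord n).
have AE i j : A i j = a i j by rewrite /a !inord_val.
rewrite (expand_det_row _ ord0) sum3 /cofactor !(expand_det_row _ ord0).
rewrite !big_ord_recl !big_ord0 /cofactor !det_mx11 !mxE !AE /= /bump /=.
ring.
Qed.

Definition rz u : 'rV[R]_(3 + 3) :=
  row_mx (map_mx (@complex.Re R) u) (map_mx (@complex.Im R) u).

Lemma zcoord_rz u : zcoord (rz u) = u.
Proof. by apply/rowP => j; rewrite mxE row_mxEl row_mxEr !mxE; case: (u 0 j). Qed.

Lemma rz_zcoord a : rz (zcoord a) = a.
Proof.
rewrite -[RHS]hsubmxK; congr row_mx; apply/rowP => j; rewrite !mxE //.
Qed.

Lemma zcoord_inj : injective (@zcoord R).
Proof. exact: can_inj rz_zcoord. Qed.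

Lemma zcoord_sum n (c : 'I_n -> R) (a : 'I_n -> 'rV[R]_(3 + 3)) :
  zcoord (\sum_l c l *: a l) = \sum_l (c l)%:C%C *: zcoord (a l).
Proof.
apply/rowP => j; rewrite !mxE !summxE; apply/eqP; rewrite eq_complex.
apply/andP; split; apply/eqP.
  rewrite [LHS]/= (raddf_sum (@complex.Re R : Rcomplex R -> R)) /=.
  by apply: eq_bigr => l _; rewrite !mxE /= mul0r subr0.
rewrite [LHS]/= (raddf_sum (@complex.Im R : Rcomplex R -> R)) /=.
by apply: eq_bigr => l _; rewrite !mxE /= mul0r addr0.
Qed.

Definition herm u v : C := \sum_j (u 0 j)^* * v 0 j.

Lemma Omega0_herm a b : Omega0 a b = complex.Im (herm (zcoord a) (zcoord b)).
Proof.
rewrite (raddf_sum (@complex.Im R : Rcomplex R -> R)) /=.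
by apply: eq_bigr => l _; rewrite !mxE /= mulNr.
Qed.

(** The real matrix of a complex one: the rows of index j and j + 3 are the
    real vectors of U_j and i U_j. *)
Definition unitary_real (U : 'M[C]_3) : 'M[R]_(3 + 3) :=
  \matrix_i match fintype.split i with
            | inl j => rz (row j U)
            | inr j => rz (('i%C : C) *: row j U) end.

Lemma zcoord_unitary_real a (U : 'M[C]_3) : zcoord (a *m unitary_real U) = zcoord a *m U.
Proof.
rewrite mulmx_sum_row zcoord_sum big_split_ord /= mulmx_sum_row -big_split.
apply: eq_bigr => j _ /=.
rewrite !rowK (unsplitK (inl j)) (unsplitK (inr j)) !zcoord_rz scalerA -scalerDl; congr (_ *: _).
by rewrite mxE; apply/eqP; rewrite eq_complex /=; apply/andP; split; apply/eqP; ring.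
Qed.

Lemma Omega0_unitary_real a b (U : 'M[C]_3) : map_mx Num.conj U *m U^T = 1%:M ->
  Omega0 (a *m unitary_real U) (b *m unitary_real U) = Omega0 a b.
Proof.
move=> uU; rewrite !Omega0_herm !zcoord_unitary_real; congr complex.Im.
have hE u v : herm u v = (map_mx Num.conj u *m v^T) 0 0.
  by rewrite mxE; apply: eq_bigr => j _; rewrite !mxE.
by rewrite !hE map_mxM trmx_mul -mulmxA (mulmxA _ _ (_^T)) uU mul1mx.
Qed.

Lemma Upsilon0_unitary_real (a : 'I_3 -> 'rV[R]_(3 + 3)) (U : 'M[C]_3) : \det U = 1 ->
  Upsilon0 (fun i => a i *m unitary_real U) = Upsilon0 a.
Proof.
move=> dU; rewrite /Upsilon0 -[RHS]mulr1 -dU -det_mulmx; congr (\det _).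
apply/matrixP => i j; rewrite [LHS]mxE zcoord_unitary_real !mxE.
by apply: eq_bigr => k _; rewrite !mxE.
Qed.


Definition mx3 u v w : 'M[C]_3 := \matrix_i (if i == i0 then u else if i == i1 then v else w).

Definition cross u v : 'rV[C]_3 := \row_i
  if i == i0 then u 0 i1 * v 0 i2 - u 0 i2 * v 0 i1
  else if i == i1 then u 0 i2 * v 0 i0 - u 0 i0 * v 0 i2
  else u 0 i0 * v 0 i1 - u 0 i1 * v 0 i0.

Lemma crossE u v : (cross u v 0 i0 = u 0 i1 * v 0 i2 - u 0 i2 * v 0 i1) *
  (cross u v 0 i1 = u 0 i2 * v 0 i0 - u 0 i0 * v 0 i2) *
  (cross u v 0 i2 = u 0 i0 * v 0 i1 - u 0 i1 * v 0 i0).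
Proof. by rewrite !mxE. Qed.

Definition conjv u : 'rV[C]_3 := map_mx Num.conj u.

Lemma hermE u v : herm u v = (u 0 i0)^* * v 0 i0 + (u 0 i1)^* * v 0 i1 + (u 0 i2)^* * v 0 i2.
Proof. exact: sum3. Qed.

Lemma herm_conj u v : herm v u = (herm u v)^*.
Proof. by rewrite !hermE !rmorphD !rmorphM /= !conjCK; ring. Qed.

Lemma hermBl u v w : herm (u - v) w = herm u w - herm v w.
Proof. by rewrite !hermE !mxE !rmorphB /=; ring. Qed.

Lemma hermBr u v w : herm u (v - w) = herm u v - herm u w.
Proof. by rewrite !hermE !mxE; ring. Qed.

Lemma hermZl (s : C) u v : herm (s *: u) v = s^* * herm u v.
Proof. by rewrite !hermE !mxE !rmorphM /=; ring. Qed.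

Lemma hermZr (s : C) u v : herm u (s *: v) = s * herm u v.
Proof. by rewrite !hermE !mxE; ring. Qed.

Definition sqnorm u : R := complex.Re (herm u u).

Lemma herm_self u : herm u u = (sqnorm u)%:C%C.
Proof.
rewrite /sqnorm hermE; case: (u 0 _) => x1 y1; case: (u 0 _) => x2 y2; case: (u 0 _) => x3 y3.
by apply/eqP; rewrite eq_complex /=; apply/andP; split; apply/eqP => //; ring.
Qed.

Lemma sqnormE u : sqnorm u = \sum_j (complex.Re (u 0 j) ^+ 2 + complex.Im (u 0 j) ^+ 2).
Proof.
rewrite /sqnorm sum3 hermE.
by case: (u 0 _) => x1 y1; case: (u 0 _) => x2 y2; case: (u 0 _) => x3 y3 /=; ring.
Qed.

Lemma sqnorm_ge0 u : 0 <= sqnorm u.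
Proof. by rewrite sqnormE sumr_ge0 // => j _; rewrite addr_ge0 ?sqr_ge0. Qed.

Lemma sqnorm_eq0 u : sqnorm u = 0 -> u = 0.
Proof.
rewrite sqnormE => /psumr_eq0P u0; apply/rowP => j; rewrite mxE.
have /eqP := u0 (fun j _ => addr_ge0 (sqr_ge0 _) (sqr_ge0 _)) j isT.
rewrite paddr_eq0 ?sqr_ge0 // !sqrf_eq0 => /andP[/eqP r0 /eqP m0].
by apply/eqP; rewrite eq_complex r0 m0 /= eqxx.
Qed.

(** Twice applied, duality with the cross product is Gram-Schmidt. *)
Lemma conj_cross_cross u v :
  - conjv (cross (- conjv (cross u v)) u) = herm u u *: v - herm u v *: u.
Proof.
apply/rowP; apply: forall3; rewrite !hermE /conjv !mxE /=.
- by rewrite !(rmorphB, rmorphM, rmorphN) /= ?conjCK; ring.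
- by rewrite !(rmorphB, rmorphM, rmorphN) /= ?conjCK; ring.
- by rewrite !(rmorphB, rmorphM, rmorphN) /= ?conjCK; ring.
Qed.

(** Lagrange's identity. *)
Lemma herm_cross u v : herm (conjv (cross u v)) (conjv (cross u v)) =
  herm u u * herm v v - herm u v * herm v u.
Proof.
rewrite !hermE /conjv !mxE /= !rmorphB !rmorphM /= !conjCK; ring.
Qed.

(** Two orthonormal vectors of C^3 are completed to a special unitary basis by the
    conjugate of their cross product. *)
Section UnitaryCompletion.
Variables u v : 'rV[C]_3.
Hypotheses (uu : herm u u = 1) (vv : herm v v = 1) (uv : herm u v = 0).
Let U := mx3 u v (conjv (cross u v)).

Lemma completion_det : \det U = 1.
Proof.
have := herm_cross u v; rewrite uu vv uv mul0r subr0 mulr1 => <-.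
rewrite det3 hermE /U /conjv !mxE /= ?mxE /= !rmorphB !rmorphM /= !conjCK; ring.
Qed.

Lemma completion_unitary : map_mx Num.conj U *m U^T = 1%:M.
Proof.
have vu : herm v u = 0 by rewrite herm_conj uv rmorph0.
have ww := herm_cross u v; rewrite uu vv uv mul0r subr0 mulr1 in ww.
have E x y : herm (row x U) (row y U) = (map_mx Num.conj U *m U^T) x y.
  by rewrite mxE; apply: eq_bigr => j _; rewrite !mxE.
have R0 : row i0 U = u by rewrite /U /mx3 rowK.
have R1 : row i1 U = v by rewrite /U /mx3 rowK.
have R2 : row i2 U = conjv (cross u v) by rewrite /U /mx3 rowK.
have uw : herm u (conjv (cross u v)) = 0.
  by rewrite hermE /conjv !mxE /= !rmorphB !rmorphM /=; ring.
have vw : herm v (conjv (cross u v)) = 0.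
  by rewrite hermE /conjv !mxE /= !rmorphB !rmorphM /=; ring.
have wu : herm (conjv (cross u v)) u = 0 by rewrite herm_conj uw rmorph0.
have wv : herm (conjv (cross u v)) v = 0 by rewrite herm_conj vw rmorph0.
apply/matrixP => x y; rewrite -E [RHS]mxE.
by move: x y; apply: forall3; apply: forall3; rewrite ?R0 ?R1 ?R2 ?uu ?vv ?ww ?uv ?vu ?uw ?vw ?wu ?wv.
Qed.

End UnitaryCompletion.

Lemma Upsilon0_cross (a : 'I_3 -> 'rV[R]_(3 + 3)) :
  Upsilon0 a = \sum_j cross (zcoord (a i0)) (zcoord (a i1)) 0 j * zcoord (a i2) 0 j.
Proof. by rewrite /Upsilon0 det3 sum3 !crossE !mxE; ring. Qed.

Lemma zcoordN a : zcoord (- a) = - zcoord a.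
Proof. by apply/rowP => j; rewrite !mxE. Qed.

(** The next two lemmas identify the vectors dual under Omega to the imaginary and
    the real part of b |-> Upsilon(u,v,b), where w is the cross product of u and v. *)
Lemma Omega0_conj_im w b : Omega0 b (- rz (conjv w)) = complex.Im (\sum_j w 0 j * zcoord b 0 j).
Proof.
rewrite Omega0_herm zcoordN zcoord_rz.
rewrite -[in LHS](opprK (herm _ _)) /=.
have -> : - herm (zcoord b) (- conjv w) = (\sum_j w 0 j * zcoord b 0 j)^*.
  rewrite rmorph_sum -sumrN; apply: eq_bigr => j _; rewrite !mxE rmorphM /=.
  by rewrite mulrN opprK mulrC.
by case: (\sum_j _) => x y /=; rewrite opprK.
Qed.

Lemma Omega0_conj_re w b : Omega0 b (rz ('i%C *: conjv w)) = complex.Re (\sum_j w 0 j * zcoord b 0 j).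
Proof.
rewrite Omega0_herm zcoord_rz.
have -> : herm (zcoord b) ('i%C *: conjv w) = 'i%C * (\sum_j w 0 j * zcoord b 0 j)^*.
  rewrite rmorph_sum mulr_sumr; apply: eq_bigr => j _; rewrite !mxE rmorphM /=.
  by ring.
by case: (\sum_j _) => x y /=; ring.
Qed.

End ComplexThreeSpace.

(** * SU(3)-structures *)

Section SU3Geometry.
Context {R : realType} {M : fspace R} (Om : dform M 2) (Up : dform M 3).
Hypothesis hM : manifold 6 M.
Hypothesis hSU3 : SU3_structure Om Up.
Local Notation C := R[i].
Local Notation i0 := (ord0 : 'I_3).
Local Notation i1 := (lift ord0 ord0 : 'I_3).
Local Notation i2 := (lift ord0 (lift ord0 ord0) : 'I_3).
Local Notation ex := (lshift 3).
Local Notation ey := (rshift 3).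
Implicit Types (x y : M) (v w : tvec M) (V W : set M).

Definition pr2 T (v w : T) (i : 'I_2) : T := if i == ord0 then v else w.
Definition tr3 T (a b c : T) (i : 'I_3) : T := if i == i0 then a else if i == i1 then b else c.

Definition om x v w : R := complex.Re (Om x (pr2 v w)).
Definition up x a b c : C := Up x (tr3 a b c).

Lemma SU3_is_frame x e : SU3_frame Om Up x e -> is_frame x e.
Proof. by case. Qed.

Lemma omE x e v w : SU3_frame Om Up x e -> tangent x v -> tangent x w ->
  om x v w = Omega0 (coordinates e v) (coordinates e w).
Proof.
move=> [_ HOm _] tv tw; rewrite /om HOm // => i; rewrite /pr2; by case: ifP.
Qed.

Lemma upE x e a b c : SU3_frame Om Up x e -> tangent x a -> tangent x b -> tangent x c ->
  up x a b c = \sum_j cross (zcoord (coordinates e a)) (zcoord (coordinates e b)) 0 j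
                      * zcoord (coordinates e c) 0 j.
Proof.
move=> [_ _ HUp] ta tb tc; rewrite /up HUp ?Upsilon0_cross //.
by move=> i; rewrite /tr3; case: ifP => // _; case: ifP.
Qed.

Lemma om_smooth V (Y Z : M -> tvec M) x : fopen V -> smooth_field V Y -> smooth_field V Z ->
  V x -> smoothat x (fun y => om y (Y y) (Z y)).
Proof.
move=> oV sY sZ Vx; case: hSU3 => fOm _ _ _.
have sYZ i : smooth_field V (pr2 Y Z i) by rewrite /pr2; case: ifP.
have [H _] := form_smooth fOm oV (fun _ _ => I) sYZ Vx.
apply: smoothat_eq H; apply: nearbyT => y /=; congr (complex.Re (Om y _)).
by apply/funext => i; rewrite /pr2; case: ifP.
Qed.

Lemma up_smooth V (Y Z W : M -> tvec M) x : fopen V ->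
  smooth_field V Y -> smooth_field V Z -> smooth_field V W ->
  V x -> csmoothat x (fun y => up y (Y y) (Z y) (W y)).
Proof.
move=> oV sY sZ sW Vx; case: hSU3 => _ _ fUp _.
have sYZ i : smooth_field V (tr3 Y Z W i).
  by rewrite /tr3; case: ifP => // _; case: ifP.
have [H H'] := form_smooth fUp oV (fun _ _ => I) sYZ Vx.
have E y : Up y (fun i => tr3 Y Z W i y) = up y (Y y) (Z y) (W y).
  by congr (Up y _); apply/funext => i; rewrite /tr3; case: ifP => // _; case: ifP.
by split; [apply: smoothat_eq H|apply: smoothat_eq H']; apply: nearbyT => y /=; rewrite E.
Qed.

Lemma exists_SU3_frame x : exists e, SU3_frame Om Up x e.
Proof. by case: hSU3. Qed.

Lemma Omega0_nondegenerate (a : 'rV[R]_(3 + 3)) : (forall b, Omega0 b a = 0) -> a = 0.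
Proof.
move=> H; apply: zcoord_inj; apply/rowP => j.
have H1 := H (delta_mx 0 (ex j)); have H2 := H (delta_mx 0 (ey j)).
move: H1 H2; rewrite /Omega0 (bigD1 j) //= [X in _ + X = _ -> _]big1; last first.
  by move=> k kj; rewrite !mxE /= (inj_eq (@lshift_inj _ _)) (negPf kj) eq_rlshift !mul0r subrr.
rewrite [X in _ -> X = _ -> _](bigD1 j) //= [X in _ -> _ + X = _ -> _]big1; last first.
  by move=> k kj; rewrite !mxE /= (inj_eq (@rshift_inj _ _)) (negPf kj) eq_lrshift !mul0r subrr.
rewrite !mxE !eqxx /= eq_rlshift eq_lrshift !mul0r !mul1r !subr0 addr0 sub0r addr0.
by move=> -> /eqP; rewrite oppr_eq0 => /eqP ->.
Qed.

Lemma Omega0_skew (a b : 'rV[R]_(3 + 3)) : Omega0 a b = - Omega0 b a.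
Proof. by rewrite /Omega0 -sumrN; apply: eq_bigr => j _; ring. Qed.

Lemma Omega0_sumr n (c : 'I_n -> R) (a : 'I_n -> 'rV[R]_(3 + 3)) b :
  Omega0 b (\sum_l c l *: a l) = \sum_l c l * Omega0 b (a l).
Proof.
rewrite /Omega0; under [RHS]eq_bigr do rewrite mulr_sumr.
rewrite exchange_big; apply: eq_bigr => j _ /=; rewrite !summxE !mulr_sumr -sumrB.
by apply: eq_bigr => l _; rewrite !mxE; ring.
Qed.

Lemma om_skew x v w : tangent x v -> tangent x w -> om x v w = - om x w v.
Proof.
by have [e se] := exists_SU3_frame x; move=> tv tw; rewrite !(omE se) // Omega0_skew.
Qed.

Lemma om_self x v : tangent x v -> om x v v = 0.
Proof. by move=> tv; have := om_skew tv tv; lra. Qed.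

Lemma om_sumr x n (c : 'I_n -> R) v (w : 'I_n -> tvec M) : tangent x v ->
  (forall l, tangent x (w l)) ->
  om x v (fun f => \sum_l c l * w l f) = \sum_l c l * om x v (w l).
Proof.
move=> tv tw; have [e se] := exists_SU3_frame x.
rewrite (omE se) //; last exact: tangent_comb.
rewrite (coordinates_comb _ (SU3_is_frame se) tw) Omega0_sumr.
by apply: eq_bigr => l _; rewrite (omE se).
Qed.

Lemma om_suml x n (c : 'I_n -> R) v (w : 'I_n -> tvec M) : tangent x v ->
  (forall l, tangent x (w l)) ->
  om x (fun f => \sum_l c l * w l f) v = \sum_l c l * om x (w l) v.
Proof.
move=> tv tw; rewrite om_skew // ?om_sumr //; try exact: tangent_comb.
by rewrite -sumrN; apply: eq_bigr => l _; rewrite (om_skew (tw l) tv) mulrN.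
Qed.

Lemma om_nondegenerate x (e : frame M 6) c : is_frame x e ->
  (forall i, om x (e i) (lincomb c e) = 0) -> c = 0.
Proof.
move=> fe H; have [e' se] := exists_SU3_frame x.
have te : forall i, tangent x (e i) by case: fe.
have te' : forall i, tangent x (e' i) by case: (SU3_is_frame se).
have tc : tangent x (lincomb c e) by apply: tangent_lincomb.
have v0 : coordinates e' (lincomb c e) = 0.
  apply: Omega0_nondegenerate => d.
  have td : tangent x (lincomb d e') by apply: tangent_lincomb.
  rewrite -(coordinates_lincomb d (SU3_is_frame se)) -(omE se) //.
  rewrite (frame_coordinates fe td) om_suml //.
  by rewrite big1 // => i _; rewrite H mulr0.
apply: (frame_inj fe); rewrite (frame_coordinates (SU3_is_frame se) tc) v0.
by apply/funext => f; rewrite /lincomb !big1 // => i _; rewrite mxE mul0r.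
Qed.

(** The components of the field in a chart solve the linear system given by the
    values of the nondegenerate form Omega on coordinate fields. *)
Lemma smooth_by_Om V (Y : M -> tvec M) : fopen V -> (forall x, V x -> tangent x (Y x)) ->
  (forall (W : set M) Z x, fopen W -> smooth_field W Z -> W `<=` V -> W x ->
     smoothat x (fun y => om y (Z y) (Y y))) ->
  smooth_field V Y.
Proof.
move=> oV tY HY x Vx; split; first exact: tY.
move=> f Cf; have [U [c [Ux cU]]] := manifold_charts hM x.
pose W := U `&` V; have oW : fopen W by apply: fopenI => //; apply: chart_fopen cU.
have sd i : smooth_field W (coordvec c ^~ i).
  by apply: (smooth_field_sub (V := U)) (coordvec_field cU i) => y [].
have Wx : W x by [].
pose A i j y := om y (coordvec c y i) (coordvec c y j).
pose Yj (j : 'I_6) y := Y y (c j).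
have decomp y : W y -> Y y = lincomb (\row_j Yj j y) (coordvec c y).
  by move=> [Uy Vy]; apply: (coordvec_decomp cU Uy); apply: tY.
have smY j : smoothat x (Yj j).
  apply: (@smoothat_solve _ _ x 6 A (fun i y => om y (coordvec c y i) (Y y))).
  - by move=> i k; apply: (om_smooth oW).
  - by move=> i; apply: (HY W) => // y [].
  - rewrite -unitfE -unitmxE -unitmx_tr -row_free_unit -kermx_eq0; apply/rowV0P => b.
    move=> /sub_kermxP b0; apply: (om_nondegenerate (coordvec_frame cU Ux)) => i.
    have := congr1 (fun B : 'rV[R]_6 => B 0 i) b0; rewrite !mxE => <-.
    rewrite om_sumr //; try by move=> *; apply: (coordvec_tangent cU).
    by apply: eq_bigr => l _; rewrite !mxE.
  - apply: nearby_mono (oW x Wx) => y Wy i; have [Uy Vy] := Wy.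
    rewrite [in RHS](decomp y Wy) om_sumr //; try by move=> *; apply: (coordvec_tangent cU).
    by apply: eq_bigr => l _; rewrite mxE mulrC.
pose rhs y := \sum_j Yj j y * coordvec c y j f.
apply: (@smoothat_eq _ _ _ rhs).
  apply: nearby_mono (oW x Wx) => y Wy /=.
  by rewrite (decomp y Wy); apply: eq_bigr => j _; rewrite mxE.
by apply: smoothat_sum => j; apply: smoothatM => //; case: (sd j x Wx) => _; apply.
Qed.

Definition frm x : frame M 6 := xget (fun=> fun=> 0) [set e | SU3_frame Om Up x e].

Lemma frmP x : SU3_frame Om Up x (frm x).
Proof. by apply: xgetPex; apply: exists_SU3_frame. Qed.

(** T_xM as C^3, in some SU(3)-frame. *)
Definition zc x v : 'rV[C]_3 := zcoord (coordinates (frm x) v).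
Definition vec x (w : 'rV[C]_3) : tvec M := lincomb (rz w) (frm x).

Lemma vec_tangent x (w : 'rV[C]_3) : tangent x (vec x w).
Proof. by apply: tangent_lincomb; case: (SU3_is_frame (frmP x)). Qed.

Lemma zc_vec x (w : 'rV[C]_3) : zc x (vec x w) = w.
Proof. by rewrite /zc /vec (coordinates_lincomb _ (SU3_is_frame (frmP x))) zcoord_rz. Qed.

Lemma vec_zc x v : tangent x v -> vec x (zc x v) = v.
Proof.
by move=> tv; rewrite /vec /zc rz_zcoord -(frame_coordinates (SU3_is_frame (frmP x))).
Qed.

Lemma vec0 x : vec x 0 = fun=> 0.
Proof.
apply/funext => f; rewrite /vec /lincomb big1 // => i _.
by rewrite !mxE; case: (fintype.split i) => j; rewrite !mxE mul0r.
Qed.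

Lemma om_herm x v w : tangent x v -> tangent x w ->
  om x v w = complex.Im (herm (zc x v) (zc x w)).
Proof. by move=> tv tw; rewrite (omE (frmP x)) // Omega0_herm. Qed.

Lemma up_cross x a b c : tangent x a -> tangent x b -> tangent x c ->
  up x a b c = \sum_j cross (zc x a) (zc x b) 0 j * zc x c 0 j.
Proof. exact: upE (frmP x). Qed.

(** The vectors dual under Omega to the imaginary and the real part of
    v |-> Upsilon(a,b,v). *)
Definition sharp_im x a b : tvec M := vec x (- conjv (cross (zc x a) (zc x b))).
Definition sharp_re x a b : tvec M := vec x ('i%C *: conjv (cross (zc x a) (zc x b))).

Lemma om_sharp_im x a b v : tangent x a -> tangent x b -> tangent x v ->
  om x v (sharp_im x a b) = complex.Im (up x a b v).
Proof.
move=> ta tb tv; rewrite om_herm //; last exact: vec_tangent.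
by rewrite zc_vec up_cross // -Omega0_conj_im Omega0_herm zcoordN zcoord_rz.
Qed.

Lemma om_sharp_re x a b v : tangent x a -> tangent x b -> tangent x v ->
  om x v (sharp_re x a b) = complex.Re (up x a b v).
Proof.
move=> ta tb tv; rewrite om_herm //; last exact: vec_tangent.
by rewrite zc_vec up_cross // -Omega0_conj_re Omega0_herm zcoord_rz.
Qed.

(** Contraction with Upsilon followed by duality under Omega preserves smoothness. *)
Lemma smooth_by_up V (Y a b : M -> tvec M) (s : R) (p : C -> R) :
  (p = @complex.Re R \/ p = @complex.Im R) ->
  fopen V -> (forall x, V x -> tangent x (Y x)) -> smooth_field V a -> smooth_field V b ->
  (forall x v, V x -> tangent x v -> om x v (Y x) = s * p (up x (a x) (b x) v)) ->
  smooth_field V Y.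
Proof.
move=> hp oV tY sa sb E; apply: (smooth_by_Om oV tY) => W Z x oW sZ WV Wx.
apply: (@smoothat_eq _ _ _ (fun y => s * p (up y (a y) (b y) (Z y)))).
  apply: nearby_mono (oW x Wx) => y Wy /=; rewrite E //; first exact: WV.
  by case: (sZ y Wy).
apply: smoothatM; first exact: smoothat_cst.
have [sre sim] := up_smooth oW (smooth_field_sub WV sa) (smooth_field_sub WV sb) sZ Wx.
by case: hp => ->.
Qed.


Lemma unitary_real_unit (U : 'M[C]_3) : \det U = 1 -> unitary_real U \in unitmx.
Proof.
move=> dU; rewrite -row_free_unit -kermx_eq0; apply/rowV0P => b /sub_kermxP b0.
have uU : U \in unitmx by rewrite unitmxE dU unitr1.
apply: zcoord_inj; rewrite -[LHS](mulmxK uU) -zcoord_unitary_real b0.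
have -> : zcoord (0 : 'rV[R]_(3 + 3)) = 0 by apply/rowP => j; rewrite !mxE.
by rewrite mul0mx.
Qed.

Lemma change_SU3 x e (A : 'M[R]_(3 + 3)) : SU3_frame Om Up x e -> A \in unitmx ->
  (forall a b, Omega0 (a *m A) (b *m A) = Omega0 a b) ->
  (forall a, Upsilon0 (fun i => a i *m A) = Upsilon0 a) ->
  SU3_frame Om Up x (change_frame A e).
Proof.
move=> [fe HOm HUp] uA AOm AUp; split; first exact: change_is_frame.
  move=> v tv; rewrite HOm // -[in RHS]AOm.
  by rewrite !(coordinates_change fe uA).
move=> v tv; rewrite HUp // -[in RHS]AUp; congr Upsilon0.
by apply/funext => i; rewrite (coordinates_change fe uA).
Qed.

Lemma change_SU3_unitary x e (U : 'M[C]_3) : SU3_frame Om Up x e ->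
  map_mx Num.conj U *m U^T = 1%:M -> \det U = 1 -> SU3_frame Om Up x (change_frame (unitary_real U) e).
Proof.
move=> se uU dU; apply: (change_SU3 se) => [|a b|a].
- exact: unitary_real_unit.
- exact: Omega0_unitary_real.
- exact: Upsilon0_unitary_real.
Qed.

Lemma zcoord_delta_ex j : zcoord (delta_mx 0 (ex j) : 'rV[R]_(3 + 3)) = delta_mx 0 j.
Proof.
apply/rowP => k; rewrite !mxE /= (inj_eq (@lshift_inj _ _)) eq_rlshift.
by case: (k == j); rewrite /= ?complexr0.
Qed.

Lemma zcoord_delta_ey j : zcoord (delta_mx 0 (ey j) : 'rV[R]_(3 + 3)) = 'i%C *: delta_mx 0 j.
Proof.
apply/rowP => k; rewrite !mxE /= (inj_eq (@rshift_inj _ _)) eq_lrshift.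
by case: (k == j); rewrite /= ?mulr1 ?mulr0.
Qed.

(** Contracting Upsilon with e_4 and e_5 and dualizing under Omega gives e_3 and
    e_6; contracting with e_3 and e_4, or e_5, gives e_2 and e_1. *)
Lemma SU3_field_smooth V (s : 'I_6 -> M -> tvec M) : fopen V ->
  (forall x, V x -> SU3_frame Om Up x (s^~ x)) ->
  smooth_field V (s (ey i0)) -> smooth_field V (s (ey i1)) -> forall i, smooth_field V (s i).
Proof.
move=> oV fs s4 s5.
have ts i x : V x -> tangent x (s i x) by move=> /fs [[ts _] _ _]; apply: ts.
have cs x i : V x -> coordinates (s^~ x) (s i x) = delta_mx 0 i.
  by move=> Vx; apply: (coordinates_frame i (SU3_is_frame (fs x Vx))).
pose co x v := coordinates (s^~ x) v.
have oms x v i : V x -> tangent x v -> om x v (s i x) = Omega0 (co x v) (delta_mx 0 i).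
  by move=> Vx tv; rewrite (omE (fs x Vx)) ?cs //; apply: ts.
have ups x i j v : V x -> tangent x v -> up x (s i x) (s j x) v =
   \sum_k cross (zcoord (delta_mx 0 i)) (zcoord (delta_mx 0 j)) 0 k * zcoord (co x v) 0 k.
  by move=> Vx tv; rewrite (upE (fs x Vx)) ?cs //; apply: ts.
have O_ex (c : 'rV[R]_(3 + 3)) j : Omega0 c (delta_mx 0 (ex j)) = - complex.Im (zcoord c 0 j).
  rewrite Omega0_herm zcoord_delta_ex /herm (bigD1 j) //= big1 ?addr0.
    by rewrite !mxE !eqxx mulr1 /=.
  by move=> k kj; rewrite !mxE (negPf kj) andbF mulr0.
have O_ey (c : 'rV[R]_(3 + 3)) j : Omega0 c (delta_mx 0 (ey j)) = complex.Re (zcoord c 0 j).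
  rewrite Omega0_herm zcoord_delta_ey /herm (bigD1 j) //= big1 ?addr0.
    by rewrite !mxE !eqxx mulr1 /=; ring.
  by move=> k kj; rewrite !mxE (negPf kj) andbF !mulr0.
have Re' : (@complex.Re R = @complex.Re R \/ @complex.Re R = @complex.Im R) by left.
have Im' : (@complex.Im R = @complex.Re R \/ @complex.Im R = @complex.Im R) by right.
have s6 : smooth_field V (s (ey i2)).
  apply: (smooth_by_up (s := -1) Re' oV _ s4 s5) => [x|x v Vx tv]; first exact: ts.
  rewrite oms // ups // O_ey sum3 !crossE !zcoord_delta_ey !mxE /=.
  by ring.
have s3 : smooth_field V (s (ex i2)).
  apply: (smooth_by_up (s := 1) Im' oV _ s4 s5) => [x|x v Vx tv]; first exact: ts.
  rewrite oms // ups // O_ex sum3 !crossE !zcoord_delta_ey !mxE /=.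
  by ring.
have s2 : smooth_field V (s (ex i1)).
  apply: (smooth_by_up (s := 1) Re' oV _ s3 s4) => [x|x v Vx tv]; first exact: ts.
  rewrite oms // ups // O_ex sum3 !crossE !zcoord_delta_ey !zcoord_delta_ex !mxE /=.
  by ring.
have s1 : smooth_field V (s (ex i0)).
  apply: (smooth_by_up (s := -1) Re' oV _ s3 s5) => [x|x v Vx tv]; first exact: ts.
  rewrite oms // ups // O_ex sum3 !crossE !zcoord_delta_ey !zcoord_delta_ex !mxE /=.
  by ring.
by move=> i; case: (@split_ordP 3 3 i) => j ->; move: j; apply: forall3.
Qed.

(** An SU(3)-frame whose members e_4 and e_5 orthonormalize two fields a, b that
    Omega does not pair. In C^3, n is Hermitian-orthogonal to a and b,
    S = |a|^2 b - <a,b> a and T = - i S, so that D = |S|^2, E = D / |a|^2, and the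
    normalizing factors are k1 = 1/|a| and k2 = 1/|S|. Written in this way they
    involve Omega and Upsilon only, hence are smooth. *)
Section GramSchmidt.
Variables (V : set M) (a b : M -> tvec M).
Hypotheses (oV : fopen V) (sa : smooth_field V a) (sb : smooth_field V b).
Hypothesis iso_ab : forall x, V x -> om x (a x) (b x) = 0.
Hypothesis free_ab : forall x, V x -> forall s t : R,
  (fun f => s * a x f + t * b x f) = (fun=> 0) -> s = 0 /\ t = 0.

Let n x := sharp_im x (a x) (b x).
Let S x := sharp_im x (n x) (a x).
Let T x := sharp_re x (n x) (a x).
Let D x := om x (T x) (S x).
Let E x := om x (T x) (b x).
Let k1 x := Num.sqrt (E x / D x).
Let k2 x := (Num.sqrt (D x))^-1.
Let U1 x : 'rV[C]_3 := (- 'i%C * (k1 x)%:C%C) *: zc x (a x).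
Let U2 x : 'rV[C]_3 := (- 'i%C * (k2 x)%:C%C) *: zc x (S x).

Definition gram_schmidt (i : 'I_6) (x : M) : tvec M :=
  change_frame (unitary_real (mx3 (U1 x) (U2 x) (conjv (cross (U1 x) (U2 x))))) (frm x) i.

Let ta x : V x -> tangent x (a x). Proof. by case/sa. Qed.
Let tb x : V x -> tangent x (b x). Proof. by case/sb. Qed.
Let tn x : tangent x (n x). Proof. exact: vec_tangent. Qed.
Let tS x : tangent x (S x). Proof. exact: vec_tangent. Qed.
Let tT x : tangent x (T x). Proof. exact: vec_tangent. Qed.

Let sn : smooth_field V n.
Proof.
apply: (smooth_by_up (p := @complex.Im R) (s := 1) _ oV _ sa sb) => [|x _|x v Vx tv].
- by right.
- exact: tn.
- by rewrite mul1r om_sharp_im //; [apply: ta|apply: tb].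
Qed.

Let sS : smooth_field V S.
Proof.
apply: (smooth_by_up (p := @complex.Im R) (s := 1) _ oV _ sn sa) => [|x _|x v Vx tv].
- by right.
- exact: tS.
- by rewrite mul1r om_sharp_im //; apply: ta.
Qed.

Let sT : smooth_field V T.
Proof.
apply: (smooth_by_up (p := @complex.Re R) (s := 1) _ oV _ sn sa) => [|x _|x v Vx tv].
- by left.
- exact: tT.
- by rewrite mul1r om_sharp_re //; apply: ta.
Qed.

Let zS x : zc x (S x) = herm (zc x (a x)) (zc x (a x)) *: zc x (b x)
  - herm (zc x (a x)) (zc x (b x)) *: zc x (a x).
Proof. by rewrite /S /sharp_im zc_vec /n /sharp_im zc_vec conj_cross_cross. Qed.

Let zT x : zc x (T x) = - 'i%C *: zc x (S x).
Proof. by rewrite /T /S /sharp_re /sharp_im !zc_vec scaleNr scalerN opprK. Qed.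

Let G x := complex.Re (herm (zc x (a x)) (zc x (b x))).

Let herm_ab x : V x -> herm (zc x (a x)) (zc x (b x)) = (G x)%:C%C.
Proof.
move=> Vx; have := iso_ab Vx; rewrite om_herm; [|exact: ta|exact: tb].
by rewrite /G; case: (herm _ _) => p q /= ->.
Qed.

Let herm_ba x : V x -> herm (zc x (b x)) (zc x (a x)) = (G x)%:C%C.
Proof. by move=> Vx; rewrite herm_conj herm_ab // [LHS]conjc_real. Qed.

Let herm_Sa x : V x -> herm (zc x (S x)) (zc x (a x)) = 0.
Proof.
move=> Vx; rewrite zS hermBl !hermZl herm_ab // herm_ba // herm_self.
by rewrite ![(_%:C%C)^*]conjc_real; ring.
Qed.

Let DE x : V x -> D x = sqnorm (zc x (S x)).
Proof.
move=> Vx; rewrite /D om_herm // zT hermZl herm_self /=; ring.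
Qed.

Let EE x : V x -> D x = sqnorm (zc x (a x)) * E x.
Proof.
move=> Vx; rewrite DE // /E om_herm //; last exact: tb.
have : (sqnorm (zc x (S x)))%:C%C =
    (sqnorm (zc x (a x)))%:C%C * herm (zc x (S x)) (zc x (b x)).
  by rewrite -herm_self [X in herm _ X]zS hermBr !hermZr herm_Sa // herm_self mulr0 subr0.
rewrite zT hermZl; case: (herm (zc x (S x)) _) => p q /= [-> _]; ring.
Qed.

Let a0 x : V x -> zc x (a x) <> 0.
Proof.
move=> Vx a0; have [|/eqP] := free_ab Vx (s := 1) (t := 0); last by rewrite oner_eq0.
apply/funext => f; rewrite mul0r addr0 mul1r -(vec_zc (ta Vx)) a0.
by rewrite vec0.
Qed.

Let S0 x : V x -> zc x (S x) <> 0.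
Proof.
move=> Vx; rewrite zS herm_ab // herm_self => S0.
have [|_ A0] := free_ab Vx (s := - G x) (t := sqnorm (zc x (a x))); last first.
  by apply: (a0 Vx); apply: sqnorm_eq0.
pose c (i : 'I_2) := pr2 (- G x) (sqnorm (zc x (a x))) i.
pose w (i : 'I_2) := pr2 (a x) (b x) i.
have tw i : tangent x (w i) by rewrite /w /pr2; case: ifP => _; [apply: ta|apply: tb].
have -> : (fun f => - G x * a x f + sqnorm (zc x (a x)) * b x f) = (fun f => \sum_i c i * w i f).
  by apply/funext => f; rewrite big_ord_recl big_ord1 /c /w /pr2.
rewrite -(vec_zc (tangent_comb c tw)) /zc (coordinates_comb _ (SU3_is_frame (frmP x)) tw).
rewrite zcoord_sum big_ord_recl big_ord1.
have -> : (c ord0)%:C%C *: zcoord (coordinates (frm x) (w ord0)) +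
  (c (lift ord0 ord0))%:C%C *: zcoord (coordinates (frm x) (w (lift ord0 ord0))) = 0.
  by rewrite -[RHS]S0 addrC /c /w /pr2 /= rmorphN scaleNr.
exact: vec0.
Qed.

Let A_gt0 x : V x -> 0 < sqnorm (zc x (a x)).
Proof.
move=> Vx; rewrite lt_def sqnorm_ge0 andbT; apply/eqP => /sqnorm_eq0; exact: a0.
Qed.

Let D_gt0 x : V x -> 0 < D x.
Proof.
move=> Vx; rewrite DE // lt_def sqnorm_ge0 andbT; apply/eqP => /sqnorm_eq0; exact: S0.
Qed.

Let k1E x : V x -> k1 x = (Num.sqrt (sqnorm (zc x (a x))))^-1.
Proof.
move=> Vx; rewrite -sqrtrV ?sqnorm_ge0 // /k1 (EE Vx) invfM mulrCA mulfV ?mulr1 //.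
apply: contraTneq (D_gt0 Vx); rewrite (EE Vx) => ->; by rewrite mulr0 ltxx.
Qed.

Let k1_smooth x : V x -> smoothat x k1.
Proof.
move=> Vx; have sE : smoothat x E by apply: (om_smooth oV sT sb).
have sD : smoothat x D by apply: (om_smooth oV sT sS).
have D0 := D_gt0 Vx.
apply: smoothat_sqrt; last by apply: smoothatM => //; apply: smoothatV => //; rewrite gt_eqF.
by rewrite divr_gt0 //; move: D0; rewrite EE // pmulr_rgt0 // A_gt0.
Qed.

Let k2_smooth x : V x -> smoothat x k2.
Proof.
move=> Vx; have sD : smoothat x D by apply: (om_smooth oV sT sS).
have D0 := D_gt0 Vx.
by apply: smoothatV; rewrite ?gt_eqF ?sqrtr_gt0 //; apply: smoothat_sqrt.
Qed.

Let UU x : V x -> [/\ herm (U1 x) (U1 x) = 1, herm (U2 x) (U2 x) = 1 & herm (U1 x) (U2 x) = 0].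
Proof.
move=> Vx; have A0 := A_gt0 Vx; have D0 := D_gt0 Vx.
have sq (k N : R) : k ^+ 2 * N = 1 -> ((- 'i%C * k%:C%C : C)^* * ((- 'i%C * k%:C%C) * N%:C%C)) = 1.
  move=> kN; rewrite -[RHS]/((1 : R)%:C%C) -[X in _ = X%:C%C]kN; apply/eqP.
  by rewrite eq_complex /=; apply/andP; split; apply/eqP; ring.
split.
- rewrite hermZl hermZr herm_self; apply: sq; rewrite k1E // exprVn sqr_sqrtr ?ltW //.
  by rewrite mulVf // gt_eqF.
- rewrite hermZl hermZr herm_self -DE //; apply: sq; rewrite /k2 exprVn sqr_sqrtr ?ltW //.
  by rewrite mulVf // gt_eqF.
- by rewrite hermZl hermZr [herm _ _]herm_conj herm_Sa // rmorph0 !mulr0.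
Qed.

Lemma gram_schmidt_SU3 x : V x -> SU3_frame Om Up x (gram_schmidt^~ x).
Proof.
move=> Vx; have [uu vv uv] := UU Vx.
by apply: (change_SU3_unitary (frmP x)); [apply: completion_unitary|apply: completion_det].
Qed.

Let vecZ x (c : R) (w : 'rV[C]_3) : vec x (c%:C%C *: w) = fun f => c * vec x w f.
Proof.
apply/funext => f; rewrite /vec /lincomb mulr_sumr; apply: eq_bigr => i _; rewrite mulrA.
congr (_ * _); rewrite !mxE; case: (fintype.split i) => j; rewrite !mxE; case: (w 0 j) => p q /=; ring.
Qed.

Let iN (z : C) : 'i%C * (- 'i%C * z) = z.
Proof. by case: z => p q; apply/eqP; rewrite eq_complex /=; apply/andP; split; apply/eqP; ring. Qed.

Let gram_schmidt4 x : V x -> gram_schmidt (ey i0) x = fun f => k1 x * a x f.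
Proof.
move=> Vx; rewrite /gram_schmidt /change_frame rowK (unsplitK (inr i0)) -/(vec x _).
rewrite rowK /= /U1 scalerA mulrA -mulrA iN vecZ vec_zc //; exact: ta.
Qed.

Lemma gram_schmidt4_span x : V x -> exists p : R,
  gram_schmidt (ey i0) x = fun f => p * a x f.
Proof. by move=> Vx; exists (k1 x); apply: gram_schmidt4. Qed.

Let gram_schmidt5 x : gram_schmidt (ey i1) x = fun f => k2 x * S x f.
Proof.
rewrite /gram_schmidt /change_frame rowK (unsplitK (inr i1)) -/(vec x _).
by rewrite rowK /= /U2 scalerA iN vecZ vec_zc.
Qed.

Lemma gram_schmidt5_span x : V x -> exists p q : R,
  gram_schmidt (ey i1) x = fun f => p * a x f + q * b x f.
Proof.
move=> Vx; exists (k2 x * - G x), (k2 x * sqnorm (zc x (a x))).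
rewrite gram_schmidt5 -(vec_zc (tS x)) zS herm_ab // herm_self; apply/funext => f.
have -> : (sqnorm (zc x (a x)))%:C%C *: zc x (b x) - (G x)%:C%C *: zc x (a x) =
   (sqnorm (zc x (a x)))%:C%C *: zc x (b x) + (- G x)%:C%C *: zc x (a x).
  by rewrite rmorphN scaleNr.
have vecD (w w' : 'rV[C]_3) : vec x (w + w') f = vec x w f + vec x w' f.
  rewrite /vec /lincomb -big_split /=; apply: eq_bigr => i _; rewrite -mulrDl.
  congr (_ * _); rewrite !mxE; case: (fintype.split i) => j; rewrite !mxE;
  by case: (w 0 j) => ? ?; case: (w' 0 j) => ? ?.
rewrite vecD !vecZ !vec_zc; [ring|exact: ta|exact: tb].
Qed.

Lemma gram_schmidt_smooth i : smooth_field V (gram_schmidt i).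
Proof.
apply: (SU3_field_smooth oV gram_schmidt_SU3) => x Vx.
  rewrite gram_schmidt4 //; split.
    have := tangent_comb (fun _ : 'I_1 => k1 x) (fun=> ta Vx).
    by congr (tangent x _); apply/funext => f; rewrite big_ord1.
  move=> f Cf; apply: (@smoothat_eq _ _ _ (fun y => k1 y * a y f)).
    by apply: nearby_mono (oV Vx) => y Vy /=; rewrite gram_schmidt4.
  by apply: smoothatM; [apply: k1_smooth|case: (sa Vx) => _; apply].
rewrite gram_schmidt5; split.
  have := tangent_comb (fun _ : 'I_1 => k2 x) (fun=> tS x).
  by congr (tangent x _); apply/funext => f; rewrite big_ord1.
move=> f Cf; apply: (@smoothat_eq _ _ _ (fun y => k2 y * S y f)).
  by apply: nearbyT => y /=; rewrite gram_schmidt5.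
by apply: smoothatM; [apply: k2_smooth|case: (sS Vx) => _; apply].
Qed.

End GramSchmidt.

End SU3Geometry.

(** * Wedge products *)

Section WedgeFormulas.
Context {R : realType}.

(** A permutation is given by the image of the first letter and a permutation of
    the remaining ones; this expands a sum over permutations recursively. *)
Lemma sum_permS (V : nmodType) n (F : 'S_n.+1 -> V) :
  \sum_s F s = \sum_i \sum_(s : 'S_n) F (lift_perm ord0 i s).
Proof.
rewrite (partition_big (fun s : 'S_n.+1 => s ord0) predT) //=; apply: eq_bigr => i _.
pose drop0 (s : 'S_n.+1) k := odflt k (unlift (s ord0) (s (lift ord0 k))).
have drop0K (s : 'S_n.+1) k : lift (s ord0) (drop0 s k) = s (lift ord0 k).
  rewrite /drop0; case: unliftP => [j -> //|/perm_inj/esym/eqP].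
  by rewrite (negPf (neq_lift _ _)).
have inj0 s : injective (drop0 s).
  move=> k l E; apply: (@lift_inj _ ord0); apply: (@perm_inj _ s).
  by rewrite -!drop0K E.
rewrite (reindex (lift_perm ord0 i)) /=; last first.
  exists (fun s => perm (inj0 s)) => s => [_|/eqP si]; apply/permP => k.
    by rewrite permE /drop0 lift_perm_lift lift_perm_id liftK.
  case: (unliftP ord0 k) => [j ->|->]; last by rewrite lift_perm_id.
  by rewrite lift_perm_lift permE -si drop0K.
by apply: eq_bigl => s; rewrite lift_perm_id eqxx.
Qed.

Lemma sum_perm0 (V : nmodType) (F : 'S_0 -> V) : \sum_s F s = F 1%g.
Proof. by rewrite (big_pred1 1%g) // => s; apply/esym/eqP/permP => -[]. Qed.

Lemma form1_eta (X : fspace R) (a : dform X 1) x (v : 'I_1 -> tvec X) : a x v = a x (fun=> v ord0).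
Proof. by congr (a x _); apply/funext => i; rewrite (ord1 i). Qed.

Lemma wedge11 (X : fspace R) (a b : dform X 1) x (v : 'I_(1 + 1) -> tvec X) :
  (a \wedge b)%F x v = a x (fun=> v ord0) * b x (fun=> v ord_max)
                     - a x (fun=> v ord_max) * b x (fun=> v ord0).
Proof.
have -> : (a \wedge b)%F x v = \sum_(s : 'S_2) (-1) ^+ s *
      a x (fun i => v (s (lshift 1 i))) * b x (fun j => v (s (rshift 1 j))).
  by rewrite /wedge invr1 mul1r.
rewrite sum_permS !big_ord_recl !big_ord0 !sum_permS.
rewrite !big_ord_recl !big_ord0 !sum_perm0 !odd_lift_perm odd_perm1 /=.
rewrite expr0 expr1 !addr0 mul1r mulN1r.
have E (i : 'I_2) : a x (fun j => v (lift_perm ord0 i (lift_perm ord0 ord0 1%g) (lshift 1 j))) = a x (fun=> v i).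
  rewrite form1_eta (_ : lshift 1 ord0 = ord0); last exact: val_inj.
  by rewrite lift_perm_id.
have E' (i : 'I_2) : b x (fun j => v (lift_perm ord0 i (lift_perm ord0 ord0 1%g) (rshift 1 j))) = b x (fun=> v (lift i ord0)).
  rewrite form1_eta (_ : rshift 1 ord0 = lift ord0 ord0); last exact: val_inj.
  by rewrite lift_perm_lift lift_perm_id.
rewrite !E !E' (_ : lift ord0 ord0 = ord_max); last exact: val_inj.
by rewrite (_ : lift ord_max ord0 = ord0); [ring|exact: val_inj].
Qed.

(** Each of the three pairings of four vectors comes from eight permutations, which
    contribute equally; the result is twice a Pfaffian. *)
Lemma wedge22 (X : fspace R) (w : dform X 2) x (v : 'I_(2 + 2) -> tvec X) (b : nat -> nat -> R[i]) :
  (forall i j : 'I_4, w x (fun k : 'I_2 => if k == ord0 then v i else v j) = b i j) ->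
  (forall i j, b i j = - b j i) ->
  (w \wedge w)%F x v = 2 * (b 0%N 1%N * b 2%N 3%N - b 0%N 2%N * b 1%N 3%N + b 0%N 3%N * b 1%N 2%N).
Proof.
move=> wE bN; rewrite /wedge.
have E (s : 'S_4) : w x (fun i => v (s (lshift 2 i))) * w x (fun j => v (s (rshift 2 j))) =
   b (s (inord 0)) (s (inord 1)) * b (s (inord 2)) (s (inord 3)).
  rewrite -!wE; congr (w x _ * w x _); apply/funext => k;
  by case: (unliftP ord0 k) => [j ->|->] /=; rewrite ?(ord1 j); congr (v (s _));
    apply: val_inj; rewrite /= inordK.
under eq_bigr do rewrite -mulrA E.
rewrite !sum_permS; under eq_bigr do rewrite sum_permS.
under eq_bigr do under eq_bigr do rewrite sum_permS.
under eq_bigr do under eq_bigr do under eq_bigr do rewrite sum_permS.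
have o0 : inord 0 = ord0 :> 'I_4 by apply: val_inj; rewrite /= inordK.
have o1 : inord 1 = lift ord0 ord0 :> 'I_4 by apply: val_inj; rewrite /= inordK.
have o2 : inord 2 = lift ord0 (lift ord0 ord0) :> 'I_4 by apply: val_inj; rewrite /= inordK.
have o3 : inord 3 = lift ord0 (lift ord0 (lift ord0 ord0)) :> 'I_4 by apply: val_inj; rewrite /= inordK.
rewrite o0 o1 o2 o3 !big_ord_recl !big_ord0 !sum_perm0.
rewrite !odd_lift_perm !odd_perm1 !lift_perm_lift !lift_perm_id /= /bump /= !expr0 !expr1.
rewrite !mul1r !mulN1r.
rewrite !(bN 1%N 0%N, bN 2%N 0%N, bN 3%N 0%N, bN 2%N 1%N, bN 3%N 1%N, bN 3%N 2%N).
have -> : (2`! * 2`!)%:R^-1 = 4^-1 :> R[i] by [].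
by field.
Qed.

End WedgeFormulas.

(** * Local adapted frame fields *)

Section AdaptedSections.
Context {R : realType} {M : fspace R} {Om : dform M 2} {Up : dform M 3}.
Context {n : nat} {G : groupType} {CG : set (G -> R)} {act : G -> M -> M}.
Hypothesis hM : manifold 6 M.
Hypothesis hSU3 : SU3_structure Om Up.
Hypothesis hsym : symmetric_SU3 n CG act Om Up.
Local Notation GG := (FSpace CG).
Local Notation i0 := (ord0 : 'I_3).
Local Notation i1 := (lift ord0 ord0 : 'I_3).
Local Notation i2 := (lift ord0 (lift ord0 ord0) : 'I_3).
Local Notation ex := (lshift 3).
Local Notation ey := (rshift 3).
Local Notation om := (om Om).
Implicit Types (x y : M) (v : tvec M) (V : set M).

Lemma orbit_map_smooth x (g : G) : @smooth_map_at R GG M (fun g => act g x) g.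
Proof.
case: (sym_action hsym) => _ _ sact h /sact Ch.
have := @prod_slice_l R GG M g x _ Ch.
exact.
Qed.

Lemma act1x x : act 1%g x = x.
Proof. by case: (sym_action hsym). Qed.

(** The vector field on M generated by w in the Lie algebra T_1 G. *)
Definition generator (w : tvec GG) x : tvec M := push (fun g : GG => act g x) (1%g : GG) w.

Lemma generator_tangent (w : tvec GG) x : tangent (1%g : GG) w -> tangent x (generator w x).
Proof. by move=> tw; have := push_tangent (orbit_map_smooth x 1%g) tw; rewrite act1x. Qed.

Lemma generator_field (w : tvec GG) : tangent (1%g : GG) w -> smooth_field setT (generator w).
Proof.
move=> tw x _; split=> [|f Cf]; first exact: generator_tangent.
case: (sym_action hsym) => _ _ sact.
have := @smoothat_partial_derivation R GG M 1%g x w (fun p => f (act p.1 p.2)) tw.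
have sf : @smoothat R (prodspace GG M) (1%g, x) (fun p => f (act p.1 p.2)).
  by apply/smoothat_gen/sact.
move=> /(_ sf); apply: smoothat_eq; apply: nearbyT => y /=.
by rewrite /generator pushE //; apply: smoothat_gen.
Qed.

Lemma orbit_tangent_tangent x v : orbit_tangent CG act x v -> tangent x v.
Proof. by case=> w tw ->; apply: generator_tangent. Qed.

Lemma orbit_tangent_comb m x (c : 'I_m -> R) (v : 'I_m -> tvec M) :
  (forall i, orbit_tangent CG act x (v i)) -> orbit_tangent CG act x (fun f => \sum_i c i * v i f).
Proof.
move=> ov; have /choice[w Hw] i : exists w, tangent (1%g : GG) w /\ v i = generator w x.
  by case: (ov i) => w tw E; exists w.
exists (fun h => \sum_i c i * w i h); first by apply: tangent_comb => i; case: (Hw i).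
rewrite push_comb; apply/funext => f; apply: eq_bigr => i _.
by case: (Hw i) => _ ->.
Qed.

Lemma orbit_tangent_kill x v h : orbit_tangent CG act x v ->
  (forall g, h (act g x) = h x) -> v h = 0.
Proof.
case=> w tw -> H; rewrite /push; case: asboolP => // _.
have -> : h \o (fun g : GG => act g x) = fun=> h x by apply/funext => g /=.
exact: tan_cst tw.
Qed.

Lemma orbit_proj_act g x : orbit_proj act (act g x) = orbit_proj act x.
Proof.
case: (sym_action hsym) => _ actM _.
have E : orbit_set act (act g x) = orbit_set act x.
  apply/seteqP; split=> [_ [k ->]|_ [k ->]]; first by exists (k * g)%g; rewrite actM.
  by exists (k * g^-1)%g; rewrite -actM -mulgA mulVg mulg1.
rewrite /orbit_proj; move: (ex_intro _ _ _) (ex_intro _ _ _); rewrite E => p p'.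
by congr exist; apply: Prop_irrelevance.
Qed.

Lemma push_orbit_tangent x v : orbit_tangent CG act x v -> push (orbit_proj act) x v = fun=> 0.
Proof.
move=> ov; apply/funext => h; rewrite /push; case: asboolP => // _.
by apply: (orbit_tangent_kill ov) => g /=; rewrite orbit_proj_act.
Qed.

Lemma Om_real x v w : tangent x v -> tangent x w -> Om x (pr2 v w) = (om x v w)%:C%C.
Proof.
move=> tv tw; case: hSU3 => _ rOm _ _.
have := rOm x (pr2 v w); rewrite /om.
have t i : tangent x (pr2 v w i) by rewrite /pr2; case: ifP.
by move=> /(_ t); case: (Om x _) => p q /= ->.
Qed.

(** Half of Omega wedge Omega, which vanishes on the orbits. So Omega has rank at
    most two there. *)
Lemma coisotropic_pfaffian x v0 v1 v2 v3 :
  orbit_tangent CG act x v0 -> orbit_tangent CG act x v1 ->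
  orbit_tangent CG act x v2 -> orbit_tangent CG act x v3 ->
  om x v0 v1 * om x v2 v3 - om x v0 v2 * om x v1 v3 + om x v0 v3 * om x v1 v2 = 0.
Proof.
move=> o0 o1 o2 o3.
pose v (i : nat) := nth v3 [:: v0; v1; v2] i.
have ov i : orbit_tangent CG act x (v i) by case: i => [|[|[|[|i]]]].
have tv i : tangent x (v i) by apply: orbit_tangent_tangent.
have H0 := @sym_coisotropic _ _ _ _ _ _ _ _ hsym x (fun i : 'I_4 => v i) (fun i => ov i).
have := @wedge22 R M Om x (fun i : 'I_4 => v i) (fun i j => (om x (v i) (v j))%:C%C).
rewrite H0 => H; have {H} := H (fun i j => Om_real (tv i) (tv j)).
have skew i j : (om x (v i) (v j))%:C%C = - (om x (v j) (v i))%:C%C :> R[i].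
  by rewrite (om_skew hSU3 (tv i) (tv j)) rmorphN.
move=> /(_ skew)/esym/eqP; rewrite mulf_eq0 pnatr_eq0 /= -!rmorphM -rmorphB -rmorphD /=.
by rewrite fmorph_eq0 => /eqP.
Qed.

Lemma orbit_tangent_basis x : exists b : 'I_4 -> tvec M,
  (forall i, orbit_tangent CG act x (b i)) /\
  (forall c : 'rV[R]_4, lincomb c b = (fun=> 0) -> c = 0).
Proof.
have [b Hb] := sym_cohomogeneity_two hsym x.
have o0 : orbit_tangent CG act x (fun=> 0).
  exists (fun=> 0); first exact: tangent0.
  by apply/funext => f; rewrite /push; case: asboolP.
have l0 : lincomb 0 b = fun=> 0.
  by apply/funext => f; rewrite /lincomb big1 // => i _; rewrite mxE mul0r.
have indep (c : 'rV[R]_4) : lincomb c b = (fun=> 0) -> c = 0.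
  move=> c0; have [d [_ dU]] := (Hb _).1 o0.
  by rewrite -(dU c) // -(dU 0).
exists b; split=> // i; apply/Hb; exists (delta_mx 0 i); split; first by rewrite lincomb_delta.
move=> c cE; apply/eqP; rewrite -subr_eq0; apply/eqP/indep/funext => f.
rewrite /lincomb.
under eq_bigr do rewrite !mxE mulrBl.
rewrite sumrB -/(lincomb _ _ f).
have := congr1 (fun v : tvec M => v f) (lincomb_delta b i); rewrite /lincomb.
under eq_bigr do rewrite mxE.
move=> ->; rewrite cE /lincomb; apply/eqP; rewrite subr_eq0 //.
Qed.

(** Otherwise B W B^T = 0 for an invertible matrix W of size 6 and a matrix B of
    rank 4, although 4 + 4 > 6. *)
Lemma not_isotropic x (b : 'I_4 -> tvec M) : (forall i, tangent x (b i)) ->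
  (forall c : 'rV[R]_4, lincomb c b = (fun=> 0) -> c = 0) ->
  exists i j, om x (b i) (b j) != 0.
Proof.
move=> tb indep; apply: contrapT => none.
have om0 i j : om x (b i) (b j) = 0.
  by apply: contrapT => H; apply: none; exists i, j; apply/eqP.
have [e se] := exists_SU3_frame hSU3 x; have fe := SU3_is_frame se.
have te : forall i, tangent x (e i) by case: fe.
pose B : 'M[R]_(4, 6) := \matrix_i coordinates e (b i).
pose W : 'M[R]_6 := \matrix_(i, j) om x (e i) (e j).
have rB : row_free B.
  rewrite -kermx_eq0; apply/rowV0P => c /sub_kermxP c0; apply: indep.
  have tc : tangent x (lincomb c b) by apply: tangent_lincomb.
  have E : coordinates e (lincomb c b) = 0.
    rewrite (coordinates_comb _ fe) //; apply: etrans c0; rewrite mulmx_sum_row.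
    apply: eq_bigr => i _.
    by rewrite rowK.
  rewrite (frame_coordinates fe tc) E.
  by apply/funext => f; rewrite /lincomb big1 // => i _; rewrite mxE mul0r.
have uW : W \in unitmx.
  rewrite -unitmx_tr -row_free_unit -kermx_eq0; apply/rowV0P => c /sub_kermxP c0.
  apply: (om_nondegenerate hSU3 fe) => i.
  have := congr1 (fun A : 'rV[R]_6 => A 0 i) c0; rewrite !mxE => <-.
  by rewrite (om_sumr hSU3) //; apply: eq_bigr => j _; rewrite !mxE.
have BWB : B *m W *m B^T = 0.
  apply/matrixP => i j; rewrite [RHS]mxE -(om0 i j).
  rewrite [in RHS](frame_coordinates fe (tb j)) (om_sumr hSU3) // mxE; apply: eq_bigr => l _.
  rewrite mulrC !mxE; congr (_ * _).
  rewrite [in RHS](frame_coordinates fe (tb i)) (om_suml hSU3) //; apply: eq_bigr => k _.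
  by rewrite !mxE.
have := mulmx0_rank_max BWB.
rewrite mxrankMfree ?row_free_unit // mxrank_tr (eqP rB).
by [].
Qed.


Lemma two_others (i j : 'I_4) : i != j ->
  exists k l, [/\ k != l, k != i, k != j, l != i & l != j].
Proof.
move=> ij.
have c : (1 < #|finset.setC [set i; j]%SET|)%N.
  by have := cardsC [set i; j]%SET; rewrite cards2 ij card_ord => /eqP; rewrite (eqn_add2l 2 _ 2) => /eqP ->.
have [k [l [kin lin kl]]] := card_gt1P c.
exists k, l; move: kin lin; rewrite !finset.inE !negb_or => /andP[-> ->] /andP[-> ->].
by split.
Qed.

Lemma forall6 (Q : 'I_(3 + 3) -> Prop) : (forall j, Q (ex j)) -> (forall j, Q (ey j)) -> forall i, Q i.
Proof. by move=> Qx Qy i; case: (split_ordP i) => j ->. Qed.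

Lemma o6E : (o6 1 = ex i0) * (o6 2 = ex i1) * (o6 3 = ex i2) *
            (o6 4 = ey i0) * (o6 5 = ey i1) * (o6 6 = ey i2).
Proof. by do !split; apply: val_inj; rewrite /= inordK. Qed.

(** The first two coordinates of v are Omega(v, e_4) and Omega(v, e_5), which vanish
    on the orbit. Conversely X, Y, e_4, e_5 span all v with this property. *)
Lemma radical_adapted x (e : frame M 6) (X Y : tvec M) : SU3_frame Om Up x e ->
  orbit_tangent CG act x X -> orbit_tangent CG act x Y -> om x X Y != 0 ->
  orbit_tangent CG act x (e (ey i0)) -> orbit_tangent CG act x (e (ey i1)) ->
  (forall v, orbit_tangent CG act x v -> om x v (e (ey i0)) = 0 /\ om x v (e (ey i1)) = 0) ->
  adapted CG act Om Up x e.
Proof.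
move=> se oX oY XY0 o4 o5 rad; split=> // v tv; have fe := SU3_is_frame se.
have te : forall i, tangent x (e i) by case: fe.
have coE w j : tangent x w -> om x w (e (ey j)) = coordinates e w 0 (ex j).
  move=> tw; rewrite (omE se) // (coordinates_frame _ fe) Omega0_herm zcoord_delta_ey /herm.
  rewrite (bigD1 j) //= big1 ?addr0; first by rewrite !mxE !eqxx mulr1 /=; ring.
  by move=> k kj; rewrite !mxE (negPf kj) andbF !mulr0.
rewrite !o6E; split=> [ov|[v1 v2]].
  by have [H4 H5] := rad v ov; rewrite -!coE.
have [tX tY] := (orbit_tangent_tangent oX, orbit_tangent_tangent oY).
pose p := coordinates e X; pose q := coordinates e Y; pose c := coordinates e v.
have [X4 X5] := rad X oX; have [Y4 Y5] := rad Y oY; rewrite !coE // in X4 X5 Y4 Y5.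
pose d := om x X Y.
have dE : d = p 0 (ex i2) * q 0 (ey i2) - p 0 (ey i2) * q 0 (ex i2).
  rewrite /d (omE se) // /Omega0 sum3 -/p -/q.
  by rewrite [p 0 (ex i0)]X4 [p 0 (ex i1)]X5 [q 0 (ex i0)]Y4 [q 0 (ex i1)]Y5; ring.
have d0 : d != 0 by [].
pose al := (c 0 (ex i2) * q 0 (ey i2) - c 0 (ey i2) * q 0 (ex i2)) / d.
pose be := (p 0 (ex i2) * c 0 (ey i2) - p 0 (ey i2) * c 0 (ex i2)) / d.
pose a (i : 'I_4) := nth 0 [:: al; be; c 0 (ey i0) - al * p 0 (ey i0) - be * q 0 (ey i0);
   c 0 (ey i1) - al * p 0 (ey i1) - be * q 0 (ey i1)] i.
pose w (i : 'I_4) := nth X [:: X; Y; e (ey i0); e (ey i1)] i.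
have ow i : orbit_tangent CG act x (w i) by case: i => -[|[|[|[|//]]]].
have tw i : tangent x (w i) by apply: orbit_tangent_tangent.
have -> : v = fun f => \sum_i a i * w i f.
  rewrite (frame_coordinates fe tv) [RHS](frame_coordinates fe (tangent_comb a tw)).
  congr lincomb; rewrite (coordinates_comb _ fe) // !big_ord_recl big_ord0 /w /a /=.
  rewrite !(coordinates_frame _ fe) -/p -/q -/c.
  apply/rowP; apply: forall6; apply: forall3; rewrite !mxE /=
    ?(inj_eq (@rshift_inj _ _)) ?eq_lrshift ?eq_rlshift /= ?mulr0 ?mulr1 ?addr0.
  - by rewrite [p 0 _]X4 [q 0 _]Y4 !mulr0 addr0.
  - by rewrite [p 0 _]X5 [q 0 _]Y5 !mulr0 addr0.
  - by rewrite /al /be dE; field; rewrite -dE.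
  - ring.
  - ring.
  - by rewrite /al /be dE; field; rewrite -dE.
exact: orbit_tangent_comb.
Qed.

(** Some two generators X_i, X_j of the action are paired by Omega at x0. Made
    orthogonal to them, two other generators span the radical of Omega on the
    orbits, by the vanishing Pfaffian; the frame with e_4, e_5 in this radical
    is adapted. *)
Lemma adapted_section x0 : exists V (s : 'I_6 -> M -> tvec M),
  [/\ V x0, fopen V, forall i, smooth_field V (s i) &
      forall x, V x -> adapted CG act Om Up x (s^~ x)].
Proof.
have [b [ob indep]] := orbit_tangent_basis x0.
have tb i : tangent x0 (b i) by apply: orbit_tangent_tangent.
have [i [j bij]] := not_isotropic tb indep.
have ij : i != j by apply: contraNneq bij => ->; rewrite (om_self hSU3 (tb j)).
have [k [l [kl ki kj li lj]]] := two_others ij.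
have /choice[w Hw] m : exists w, tangent (1%g : GG) w /\ b m = generator w x0.
  by case: (ob m) => w tw E; exists w.
pose X m := generator (w m).
have sX m : smooth_field setT (X m) by apply: generator_field; case: (Hw m).
have oX m x : orbit_tangent CG act x (X m x) by exists (w m) => //; case: (Hw m).
have tX m x : tangent x (X m x) by apply: orbit_tangent_tangent.
have X0 m : X m x0 = b m by case: (Hw m).
have oT : fopen (setT : set M) by move=> x _; apply: nearbyT.
have som m m' x : smoothat x (fun y => om y (X m y) (X m' y)) by apply: (om_smooth hSU3 oT).
pose d x := om x (X i x) (X j x).
pose V0 := [set x | d x != 0].
have sd x : smoothat x d by apply: som.
have oV0 : fopen V0 by move=> x dx; apply: (nearby_neq0 (sd x) dx).
(* a_k and a_l are X_k and X_l made orthogonal to X_i and X_j. *)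
pose c m (u : 'I_3) x := nth 0 [:: 1; - om x (X m x) (X j x) / d x; om x (X m x) (X i x) / d x] u.
pose Y m (u : 'I_3) := nth (X m) [:: X m; X i; X j] u.
pose a m x : tvec M := fun f => \sum_u c m u x * Y m u x f.
have sY m u : smooth_field V0 (Y m u).
  apply: (@smooth_field_sub _ _ setT) => //.
  by case: u => -[|[|[|//]]] ?; apply: sX.
have oY m u x : orbit_tangent CG act x (Y m u x) by case: u => -[|[|[|//]]] ?; apply: oX.
have sa m : smooth_field V0 (a m).
  apply: smooth_field_comb => // -[[|[|[|//]]] ?] x dx; rewrite /c /=.
  - exact: smoothat_cst.
  - by apply: smoothatM; [apply: smoothatN; apply: som|apply: (smoothatV dx (sd x))].
  - by apply: smoothatM; [apply: som|apply: (smoothatV dx (sd x))].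
have oa m x : orbit_tangent CG act x (a m x) by apply: orbit_tangent_comb.
have ta m x : tangent x (a m x) by apply: orbit_tangent_tangent.
have omY m x v : tangent x v -> om x v (a m x) =
    om x v (X m x) - om x (X m x) (X j x) / d x * om x v (X i x) + om x (X m x) (X i x) / d x * om x v (X j x).
  move=> tv; rewrite (om_sumr hSU3) //; last by move=> u; apply: orbit_tangent_tangent.
  by rewrite sum3 /c /Y /=; ring.
have ai m x : V0 x -> om x (X i x) (a m x) = 0.
  move=> dx; rewrite omY // (om_self hSU3 (tX i x)) (om_skew hSU3 (tX i x) (tX m x)) -/(d x).
  by field.
have aj m x : V0 x -> om x (X j x) (a m x) = 0.
  move=> dx; rewrite omY // (om_self hSU3 (tX j x)) (om_skew hSU3 (tX j x) (tX m x)).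
  by rewrite (om_skew hSU3 (tX j x) (tX i x)) -/(d x); field.
have rad m x v : V0 x -> orbit_tangent CG act x v -> om x v (a m x) = 0.
  move=> dx ov; have tv := orbit_tangent_tangent ov.
  have := coisotropic_pfaffian (oX i x) (oX j x) ov (oa m x).
  rewrite (ai m x dx) (aj m x dx) mulr0 subr0 mul0r addr0 => /eqP.
  by rewrite mulf_eq0 (negPf dx) /= => /eqP.
have V0x0 : V0 x0 by rewrite /V0 /= /d !X0.
have a0E m f : a m x0 f = b m f - om x0 (b m) (b j) / d x0 * b i f + om x0 (b m) (b i) / d x0 * b j f.
  by rewrite /a sum3 /c /Y /= !X0; ring.
have free0 (s t : R) : (fun f => s * a k x0 f + t * a l x0 f) = (fun=> 0) -> s = 0 /\ t = 0.
  move=> E.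
  pose e1 := - (s * (om x0 (b k) (b j) / d x0)) - t * (om x0 (b l) (b j) / d x0).
  pose e2 := s * (om x0 (b k) (b i) / d x0) + t * (om x0 (b l) (b i) / d x0).
  pose C : 'rV[R]_4 := s *: delta_mx 0 k + t *: delta_mx 0 l + e1 *: delta_mx 0 i + e2 *: delta_mx 0 j.
  have C0 : C = 0.
    apply: indep; rewrite -E; apply/funext => f; rewrite !a0E.
    have -> : C = \sum_(u < 4) nth 0 [:: s; t; e1; e2] u *: nth 0 [:: delta_mx 0 k; delta_mx 0 l; delta_mx 0 i; delta_mx 0 j] u.
      by rewrite !big_ord_recl big_ord0 /= addr0 !addrA.
    rewrite lincomb_comb !big_ord_recl big_ord0 /= !lincomb_delta /e1 /e2; ring.
  have := congr1 (fun A : 'rV[R]_4 => A 0 k) C0; have := congr1 (fun A : 'rV[R]_4 => A 0 l) C0.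
  rewrite !mxE /= !eqxx /= !(negPf kl) (eq_sym l k) (negPf kl) (negPf ki) (negPf kj) (negPf li) (negPf lj).
  by rewrite !mulr0 !mulr1 !addr0 add0r => -> ->.
(* h1 and h2 witness the independence of a_k, a_l at x0, hence also nearby. *)
have [h1 [Ch1 a1]] : exists h, Cinfty h /\ a k x0 h != 0.
  apply: contrapT => none; have [] := free0 1 0; last by move/eqP; rewrite oner_eq0.
  have tz := tangent0 x0.
  apply/funext => f; rewrite mul1r mul0r addr0.
  rewrite (tangent_ext (ta k x0) tz) // => h Ch.
  by apply: contrapT => nh; apply: none; exists h; split=> //; apply/eqP.
pose det2 h x := a k x h1 * a l x h - a k x h * a l x h1.
have [h2 [Ch2 a2]] : exists h, Cinfty h /\ det2 h x0 != 0.
  apply: contrapT => none; have [] := free0 (- a l x0 h1) (a k x0 h1); last first.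
    by move=> _ /eqP; rewrite (negPf a1).
  have tz := tangent0 x0.
  pose cc (u : 'I_2) := pr2 (- a l x0 h1) (a k x0 h1) u; pose ww (u : 'I_2) := pr2 (a k x0) (a l x0) u.
  have tww u : tangent x0 (ww u) by rewrite /ww /pr2; case: ifP.
  have -> : (fun f => - a l x0 h1 * a k x0 f + a k x0 h1 * a l x0 f) = fun f => \sum_u cc u * ww u f.
    by apply/funext => f; rewrite big_ord_recl big_ord1.
  apply: (tangent_ext (tangent_comb cc tww) tz) => h Ch.
  rewrite big_ord_recl big_ord1 /cc /ww /pr2 /=.
  apply: contrapT => nh; apply: none; exists h; split=> //; apply/eqP => H; apply: nh.
  by rewrite -H /det2; ring.
pose V := [set x | V0 x /\ det2 h2 x != 0].
have sah m h x : V0 x -> Cinfty h -> smoothat x (fun y => a m y h).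
  by move=> dx Ch; case: (sa m x dx) => _; apply.
have oV : fopen V.
  move=> x [dx ex]; apply: nearbyI (oV0 x dx) _; apply: nearby_neq0 => //.
  by apply: smoothatB; apply: smoothatM; apply: sah.
have VV0 : V `<=` V0 by move=> x [].
have iso x : V x -> om x (a k x) (a l x) = 0 by move=> [dx _]; apply: rad.
have free x : V x -> forall s t : R, (fun f => s * a k x f + t * a l x f) = (fun=> 0) -> s = 0 /\ t = 0.
  move=> [dx ex] s t E.
  have E1 := congr1 (fun v : tvec M => v h1) E; have E2 := congr1 (fun v : tvec M => v h2) E.
  rewrite /= in E1 E2.
  have sdet : s * det2 h2 x = 0.
    have -> : s * det2 h2 x = (s * a k x h1 + t * a l x h1) * a l x h2
                   - (s * a k x h2 + t * a l x h2) * a l x h1 by rewrite /det2; ring.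
    by rewrite E1 E2 !mul0r subrr.
  have tdet : t * det2 h2 x = 0.
    have -> : t * det2 h2 x = (s * a k x h2 + t * a l x h2) * a k x h1
                   - (s * a k x h1 + t * a l x h1) * a k x h2 by rewrite /det2; ring.
    by rewrite E1 E2 !mul0r subrr.
  by move/eqP: sdet; move/eqP: tdet; rewrite !mulf_eq0 (negPf ex) !orbF => /eqP -> /eqP ->.
have sak := smooth_field_sub VV0 (sa k); have sal := smooth_field_sub VV0 (sa l).
exists V, (gram_schmidt Om Up (a k) (a l)); split=> //.
  by move=> m; apply: (gram_schmidt_smooth hM hSU3 oV).
move=> x Vx; have se := gram_schmidt_SU3 hSU3 sak sal iso free Vx.
have dx := VV0 x Vx.
have [r E4] := gram_schmidt4_span hSU3 (a l) sak Vx.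
have [p [q E5]] := gram_schmidt5_span hSU3 sak sal iso Vx.
pose cc (u : 'I_2) := pr2 p q u; pose ww (u : 'I_2) := pr2 (a k x) (a l x) u.
have oww u : orbit_tangent CG act x (ww u) by rewrite /ww /pr2; case: ifP.
have E5' : gram_schmidt Om Up (a k) (a l) (ey i1) x = fun f => \sum_u cc u * ww u f.
  by rewrite E5; apply/funext => f; rewrite big_ord_recl big_ord1.
apply: (radical_adapted se (oX i x) (oX j x) dx).
- have -> : gram_schmidt Om Up (a k) (a l) (ey i0) x = fun f => \sum_(u < 1) r * a k x f.
    by rewrite E4; apply/funext => f; rewrite big_ord1.
  exact: orbit_tangent_comb.
- by rewrite E5'; apply: orbit_tangent_comb.
- move=> v ov; have tv := orbit_tangent_tangent ov; split.
    have -> : gram_schmidt Om Up (a k) (a l) (ey i0) x = fun f => \sum_(u < 1) r * a k x f.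
      by rewrite E4; apply/funext => f; rewrite big_ord1.
    by rewrite (om_sumr hSU3) // big_ord1 rad ?mulr0.
  rewrite E5' (om_sumr hSU3) //; last by move=> u; apply: orbit_tangent_tangent.
  by rewrite big1 // => u _; rewrite /ww /pr2; case: ifP; rewrite rad ?mulr0.
Qed.

End AdaptedSections.

(** * Points of frame bundles and the action of O(2) *)

Section FramePoints.
Context {R : realType} {X : fspace R} {n : nat} (S : X -> frame X n -> Prop).

Lemma frame_point_ex x e : S x e -> exists p : frame_space S, fbase p = x /\ fframe p = e.
Proof. by move=> Sxe; exists (exist _ (x, e) Sxe). Qed.

Lemma frame_point_eq (p p' : frame_space S) : fbase p = fbase p' -> fframe p = fframe p' -> p = p'.
Proof.
case: p p' => [[x e] H] [[x' e'] H']; rewrite /fbase /fframe /= => E E'.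
by subst x' e'; congr exist; apply: Prop_irrelevance.
Qed.

(** A total constructor, so that a frame field defines a map into the frame space. *)
Definition mkframe (p0 : frame_space S) x e : frame_space S :=
  if pselect (S x e) is left H then exist _ (x, e) H else p0.

Lemma fbase_mkframe p0 x e : S x e -> fbase (mkframe p0 x e) = x.
Proof. by move=> Sxe; rewrite /mkframe; case: pselect. Qed.

Lemma fframe_mkframe p0 x e : S x e -> fframe (mkframe p0 x e) = e.
Proof. by move=> Sxe; rewrite /mkframe; case: pselect. Qed.

Variables (Y : fspace R) (p0 : frame_space S) (b : Y -> X) (e : Y -> frame X n) (y : Y).
Hypothesis Sbe : nearby y [set y' | S (b y') (e y')].
Hypothesis sb : smooth_map_at b y.
Hypothesis se : forall i h, Cinfty h -> smoothat y (fun y' => e y' i h).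

Lemma mkframe_smooth : smooth_map_at (fun y' => mkframe p0 (b y') (e y')) y.
Proof.
apply: smooth_to_frames.
  move=> h Ch; apply: (smoothat_eq _ (sb Ch)).
  by apply: nearby_mono Sbe => y' H /=; rewrite fbase_mkframe.
move=> i h Ch; apply: (smoothat_eq _ (se i Ch)).
by apply: nearby_mono Sbe => y' H /=; rewrite fframe_mkframe.
Qed.

Lemma push_fbase_mkframe v : tangent y v ->
  push (@fbase R X n S) (mkframe p0 (b y) (e y)) (push (fun y' => mkframe p0 (b y') (e y')) y v)
  = push b y v.
Proof.
move=> tv; rewrite (push_push v (fbase_smooth (mkframe p0 (b y) (e y)))).
apply: push_near => //; apply: nearby_mono Sbe => y' H /=.
exact: fbase_mkframe.
Qed.

Lemma taut_mkframe v : tangent y v ->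
  taut (mkframe p0 (b y) (e y)) (push (fun y' => mkframe p0 (b y') (e y')) y v)
  = coordinates (e y) (push b y v).
Proof.
move=> tv; rewrite /taut push_fbase_mkframe // fframe_mkframe //.
exact: nearby_self Sbe.
Qed.

End FramePoints.

Section Turns.
Context {R : realType} {M : fspace R} {Om : dform M 2} {Up : dform M 3}.
Context {n : nat} {G : groupType} {CG : set (G -> R)} {act : G -> M -> M}.
Hypothesis hM : manifold 6 M.
Hypothesis hSU3 : SU3_structure Om Up.
Local Notation C := R[i].
Local Notation i0 := (ord0 : 'I_3).
Local Notation i1 := (lift ord0 ord0 : 'I_3).
Local Notation i2 := (lift ord0 (lift ord0 ord0) : 'I_3).
Local Notation ex := (lshift 3).
Local Notation ey := (rshift 3).
Local Notation S := (adapted CG act Om Up).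

(** The copy of O(2) in SU(3) under which adapted frames at a point are permuted. *)
Definition turn_mx (al be ep : R) : 'M[C]_3 := mx3
  (\row_j (if j == i0 then al else if j == i1 then be else 0)%:C%C)
  (\row_j (if j == i0 then - ep * be else if j == i1 then ep * al else 0)%:C%C)
  (\row_j (if j == i2 then ep else 0)%:C%C).

Definition turn al be ep (e : frame M 6) : frame M 6 :=
  change_frame (unitary_real (turn_mx al be ep)) e.

Variables (al be ep : R).
Hypotheses (ab1 : al ^+ 2 + be ^+ 2 = 1) (ep1 : ep ^+ 2 = 1).

Lemma turn_det : \det (turn_mx al be ep) = 1.
Proof.
rewrite det3 /turn_mx /mx3 !mxE /=.
rewrite [RHS](_ : 1 = (ep ^+ 2 * (al ^+ 2 + be ^+ 2))%:C%C); last by rewrite ab1 ep1 mulr1.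
by apply/eqP; rewrite eq_complex /=; apply/andP; split; apply/eqP; ring.
Qed.

Lemma turn_unitary : map_mx Num.conj (turn_mx al be ep) *m (turn_mx al be ep)^T = 1%:M.
Proof.
have [E|E] : ep = 1 \/ ep = -1.
  by move/eqP: ep1; rewrite sqrf_eq1 => /orP[/eqP ->|/eqP ->]; [left|right].
all: have := ab1; rewrite E => ab; apply/matrixP; apply: forall3; apply: forall3;
  rewrite mxE sum3 /turn_mx /mx3 !mxE /=; apply/eqP; rewrite eq_complex /=;
  apply/andP; split; apply/eqP; lra.
Qed.

Lemma turnE e : [/\ turn al be ep e (ex i0) = (fun f => al * e (ex i0) f + be * e (ex i1) f),
  turn al be ep e (ex i1) = (fun f => - ep * be * e (ex i0) f + ep * al * e (ex i1) f),
  turn al be ep e (ey i0) = (fun f => al * e (ey i0) f + be * e (ey i1) f) &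
  turn al be ep e (ey i1) = (fun f => - ep * be * e (ey i0) f + ep * al * e (ey i1) f)].
Proof.
have E6 (c : 'rV[R]_(3 + 3)) f : lincomb c e f = c 0 (ex i0) * e (ex i0) f + c 0 (ex i1) * e (ex i1) f
   + c 0 (ex i2) * e (ex i2) f + (c 0 (ey i0) * e (ey i0) f + c 0 (ey i1) * e (ey i1) f + c 0 (ey i2) * e (ey i2) f).
  by rewrite -[LHS]/(\sum_(j < 3 + 3) c 0 j * e j f) big_split_ord /= !sum3.
split; apply/funext => f; rewrite /turn /change_frame E6 rowK
  ?(unsplitK (inl _ : 'I_3 + 'I_3)) ?(unsplitK (inr _ : 'I_3 + 'I_3)) /rz !row_mxEl !row_mxEr !mxE /=; ring.
Qed.

Lemma turn_adapted x e : S x e -> S x (turn al be ep e).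
Proof.
move=> [se He]; have fe := SU3_is_frame se.
have uA := unitary_real_unit turn_det.
split; first exact: (change_SU3_unitary se turn_unitary turn_det).
move=> v tv; rewrite (He v tv) !o6E.
have := coordinates_change fe uA tv; rewrite -/(turn al be ep e).
set c := coordinates e v; set c' := coordinates _ v => cE.
have zE : zcoord c = zcoord c' *m turn_mx al be ep by rewrite -zcoord_unitary_real cE.
have E0 : c 0 (ex i0) = al * c' 0 (ex i0) - ep * be * c' 0 (ex i1).
  have := congr1 (fun z : 'rV[C]_3 => complex.Re (z 0 i0)) zE.
  by rewrite [in LHS]mxE /= => ->; rewrite mxE sum3 /turn_mx /mx3 !mxE /=; ring.
have E1 : c 0 (ex i1) = be * c' 0 (ex i0) + ep * al * c' 0 (ex i1).
  have := congr1 (fun z : 'rV[C]_3 => complex.Re (z 0 i1)) zE.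
  by rewrite [in LHS]mxE /= => ->; rewrite mxE sum3 /turn_mx /mx3 !mxE /=; ring.
rewrite E0 E1; move: (c' 0 (ex i0)) (c' 0 (ex i1)) => p q; split=> [[H0 H1]|[-> ->]].
  have Ep : p = al * (al * p - ep * be * q) + be * (be * p + ep * al * q) + (1 - (al ^+ 2 + be ^+ 2)) * p by ring.
  have Eq : q = ep * (- be * (al * p - ep * be * q) + al * (be * p + ep * al * q)) + (1 - ep ^+ 2 * (al ^+ 2 + be ^+ 2)) * q by ring.
  by split; [rewrite Ep|rewrite Eq]; rewrite H0 H1 ab1 ?ep1 !(mulr0, mulr1, subrr, mul0r, addr0).
by rewrite !mulr0 subr0 addr0.
Qed.


End Turns.

Section TurnSections.
Context {R : realType} {M : fspace R} {Om : dform M 2} {Up : dform M 3}.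
Context {n : nat} {G : groupType} {CG : set (G -> R)} {act : G -> M -> M}.
Hypothesis hM : manifold 6 M.
Hypothesis hSU3 : SU3_structure Om Up.
Local Notation S := (adapted CG act Om Up).
Local Notation ey := (rshift 3).
Local Notation ex := (lshift 3).
Local Notation i0 := (ord0 : 'I_3).
Local Notation i1 := (lift ord0 ord0 : 'I_3).

Definition adapted_field (V : set M) (s : 'I_6 -> M -> tvec M) :=
  [/\ fopen V, forall i, smooth_field V (s i) & forall x, V x -> S x (s^~ x)].

Lemma turn_field V s (al be : M -> R) ep : adapted_field V s ->
  (forall x, V x -> smoothat x al) -> (forall x, V x -> smoothat x be) ->
  (forall x, V x -> al x ^+ 2 + be x ^+ 2 = 1) -> ep ^+ 2 = 1 ->
  adapted_field V (fun i x => turn (al x) (be x) ep (s^~ x) i).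
Proof.
move=> [oV ss Ss] sal sbe ab1 ep1.
have St x : V x -> S x (turn (al x) (be x) ep (s^~ x)).
  by move=> Vx; apply: turn_adapted => //; [apply: ab1|apply: Ss].
split=> //; apply: (SU3_field_smooth hM hSU3 oV) => [x /St[]//||].
- have := @smooth_field_comb _ _ 2 V (pr2 al be) (pr2 (s (ey i0)) (s (ey i1))).
  have -> : (fun x f => \sum_i pr2 al be i x * pr2 (s (ey i0)) (s (ey i1)) i x f) =
      (fun x => turn (al x) (be x) ep (s^~ x) (ey i0)).
    apply/funext => x; have [_ _ -> _] := turnE (al x) (be x) ep (s^~ x).
    by apply/funext => f; rewrite big_ord_recl big_ord1.
  apply=> [i|i x Vx]; rewrite /pr2; case: ifP => _ //.
  + exact: sal.
  + exact: sbe.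
- have := @smooth_field_comb _ _ 2 V (pr2 (fun x => - ep * be x) (fun x => ep * al x)) (pr2 (s (ey i0)) (s (ey i1))).
  have -> : (fun x f => \sum_i pr2 (fun x => - ep * be x) (fun x => ep * al x) i x
        * pr2 (s (ey i0)) (s (ey i1)) i x f) =
      (fun x => turn (al x) (be x) ep (s^~ x) (ey i1)).
    apply/funext => x; have [_ _ _ ->] := turnE (al x) (be x) ep (s^~ x).
    by apply/funext => f; rewrite big_ord_recl big_ord1.
  apply=> [i|i x Vx]; rewrite /pr2; case: ifP => _ //.
  + by apply: smoothatM; [apply: smoothat_cst|apply: sbe].
  + by apply: smoothatM; [apply: smoothat_cst|apply: sal].
Qed.

Lemma adapted_field_sub V W s : fopen W -> W `<=` V -> adapted_field V s -> adapted_field W s.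
Proof.
move=> oW WV [_ ss Ss]; split=> // [i|x /WV]; last exact: Ss.
exact: smooth_field_sub (ss i).
Qed.

End TurnSections.

(** * Normalizing the frame by a holomorphic coordinate *)

Section OrbitSurface.
Context {R : realType} {M : fspace R} {Om : dform M 2} {Up : dform M 3}.
Context {n : nat} {G : groupType} {CG : set (G -> R)} {act : G -> M -> M}.
Hypothesis hM : manifold 6 M.
Hypothesis hSU3 : SU3_structure Om Up.
Hypothesis hsym : symmetric_SU3 n CG act Om Up.
Local Notation C := R[i].
Local Notation i0 := (ord0 : 'I_3).
Local Notation i1 := (lift ord0 ord0 : 'I_3).
Local Notation i2 := (lift ord0 (lift ord0 ord0) : 'I_3).
Local Notation ex := (lshift 3).
Local Notation ey := (rshift 3).
Local Notation S := (adapted CG act Om Up).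
Local Notation P := (P_bundle CG act Om Up).
Local Notation adapted_field := (@adapted_field R M Om Up G CG act).
Local Notation Sg := (orbit_space act).
Local Notation q := (orbit_proj act).
Implicit Types (x : M) (y : Sg) (v w : tvec M) (V : set M).

Variable gS : forall y : Sg, tvec Sg -> tvec Sg -> R.
Hypothesis hgS : is_orbit_metric S gS.
Local Notation F := (F_bundle gS).

Lemma q_smooth x : smooth_map_at q x.
Proof. exact: smooth_map_all. Qed.

Definition eta_of (e : frame M 6) v : C :=
  (coordinates e v 0 (ex i0) +i* coordinates e v 0 (ex i1))%C.

Section Along.
Variables (V : set M) (s : 'I_6 -> M -> tvec M).
Hypothesis sV : adapted_field V s.

Let oV : fopen V. Proof. by case: sV. Qed.
Let ss i : smooth_field V (s i). Proof. by case: sV. Qed.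
Let Ss x : V x -> S x (s^~ x). Proof. by case: sV => _ _; apply. Qed.
Let fs x : V x -> is_frame x (s^~ x). Proof. by move=> /Ss[/SU3_is_frame]. Qed.

Lemma field_push_tangent x v : V x -> tangent x v -> exists2 w : tvec P,
  exists p : P, [/\ fbase p = x, fframe p = s^~ x, tangent p w,
     push (@fbase R M 6 S) p w = v & forall k, taut p w 0 k = coordinates (s^~ x) v 0 k] & True.
Proof.
move=> Vx tv; have [p [bp fp]] := frame_point_ex (Ss Vx).
have nS : nearby x [set x' | S x' (s^~ x')] by apply: nearby_mono (oV Vx) => x' /Ss.
have sid : @smooth_map_at R M M id x by move=> h Ch; apply: smoothat_gen.
have sse i h : Cinfty h -> smoothat x (fun x' => s i x' h).
  by move=> Ch; case: (ss i Vx) => _; apply.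
have sm := mkframe_smooth p nS sid sse.
have E : mkframe p x (s^~ x) = p.
  by apply: frame_point_eq; rewrite ?fbase_mkframe ?fframe_mkframe //; apply: Ss.
have T := taut_mkframe (b := id) p nS tv; have B := push_fbase_mkframe (b := id) p nS tv.
have tp := push_tangent sm tv.
rewrite /= in tp.
exists (push (fun y' : M => mkframe p y' (s^~ y')) x v) => //; exists p.
rewrite /= E in tp T B; rewrite push_id // in T B.
by split=> // k; rewrite T.
Qed.

Lemma metric_push x v w : V x -> tangent x v -> tangent x w ->
  gS (q x) (push q x v) (push q x w) =
  coordinates (s^~ x) v 0 (ex i0) * coordinates (s^~ x) w 0 (ex i0)
  + coordinates (s^~ x) v 0 (ex i1) * coordinates (s^~ x) w 0 (ex i1).
Proof.
move=> Vx tv tw.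
have [v' [p [bp fp tv' pv Tv]] _] := field_push_tangent Vx tv.
have [w' [p' [bp' fp' tw' pw Tw]] _] := field_push_tangent Vx tw.
have Epp : p' = p by apply: frame_point_eq; rewrite ?bp' ?fp'.
subst p'.
have := hgS tv' tw'; rewrite !Tv !Tw !o6E bp => <-.
have H u : push (q \o @fbase R M 6 S) p u = push q x (push (@fbase R M 6 S) p u).
  by rewrite -bp push_push //; apply: q_smooth.
by rewrite !H pv pw.
Qed.

Lemma orbit_vector x k : V x -> (2 <= k)%N -> forall kk : 'I_6, kk = k :> nat -> orbit_tangent CG act x (s kk x).
Proof.
move=> Vx k2 kk kkE; have [se He] := Ss Vx; apply/He.
  by case: (fs Vx) => + _; apply.
rewrite !o6E !(coordinates_frame kk (fs Vx)) !mxE /=.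
by split; case: eqP => // E; move: k2; rewrite -kkE -E.
Qed.

Lemma push_q_decomp x v : V x -> tangent x v ->
  push q x v = fun h => coordinates (s^~ x) v 0 (ex i0) * push q x (s (ex i0) x) h
                      + coordinates (s^~ x) v 0 (ex i1) * push q x (s (ex i1) x) h.
Proof.
move=> Vx tv; rewrite [in LHS](frame_coordinates (fs Vx) tv) /lincomb push_comb.
apply/funext => h; rewrite -[LHS]/(\sum_(j < 3 + 3) coordinates (s^~ x) v 0 j * push q x (s j x) h).
rewrite (bigD1 (ex i0)) //= (bigD1 (ex i1)) //= big1 ?addr0 //.
move=> j /andP[j0 j1]; rewrite (push_orbit_tangent hsym) ?mulr0 //.
apply: (orbit_vector Vx _ (k := j)) => //.
by move: j0 j1; rewrite -!val_eqE /=; case: (val j) => [|[|]].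
Qed.

Lemma cder_q x v (h : Sg -> C) : csmoothat (q x) h -> cder (push q x v) h = cder v (h \o q).
Proof. by move=> [sr si]; rewrite /cder !pushE. Qed.

End Along.

Section Holomorphic.
Variables (p4F rF : F -> C) (p4 r : P -> C).
Hypothesis hp4F : forall (p : P) (p' : F), natural_map p p' -> p4F p' = p4 p.
Hypothesis hrF : forall (p : P) (p' : F), natural_map p p' -> rF p' = r p.
Variables (U : set Sg) (Fp : set F) (z : Sg -> C) (f g : Sg -> C) (u : Sg -> R).
Hypotheses (hU : fopen U) (hFp : SO2_subbundle U Fp) (hz : holomorphic_coordinate U Fp z).
Hypothesis smooth_u : forall y, U y -> smoothat y u.
Hypothesis hf : forall (p : F) (w : tvec F), Fp p -> tangent p w ->
     (p4F p)^* * etaF p w = f (fbase p) * pull_d z p w.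
Hypothesis hg : forall (p : F) (w1 w2 w3 : tvec F), Fp p ->
     tangent p w1 -> tangent p w2 -> tangent p w3 ->
     (rF p)^* * (etaF p w1 * etaF p w2 * etaF p w3) =
     g (fbase p) * (pull_d z p w1 * pull_d z p w2 * pull_d z p w3).
Hypothesis hu : forall (p : F) (w1 w2 : tvec F), Fp p -> tangent p w1 -> tangent p w2 ->
     expR (2 * u (fbase p)) * complex.Re (etaF p w1 * (etaF p w2)^*) =
     complex.Re (pull_d z p w1 * (pull_d z p w2)^*).

Definition zchart (i : 'I_2) (y : Sg) : R :=
  if i == ord0 then complex.Re (z y) else complex.Im (z y).

Lemma zchartP : chart U zchart.
Proof. by case: hz. Qed.

Lemma z_smooth y : U y -> csmoothat y z.
Proof.
move=> Uy; split; first exact: (chart_smoothat zchartP ord0 Uy).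
exact: (chart_smoothat zchartP ord_max Uy).
Qed.

Definition image_frame (e : frame M 6) x : frame Sg 2 :=
  fun i => push q x (e (widen_ord (isT : (2 <= 6)%N) i)).

Lemma widenE : (widen_ord (isT : (2 <= 6)%N) ord0 = ex i0) * (widen_ord (isT : (2 <= 6)%N) (lift ord0 ord0) = ex i1).
Proof. by split; apply: val_inj. Qed.

Section Lift.
Variables (V : set M) (s : 'I_6 -> M -> tvec M).
Hypothesis sV : adapted_field V s.
Hypothesis VU : forall x, V x -> U (q x).

Let oV : fopen V. Proof. by case: sV. Qed.
Let ss i : smooth_field V (s i). Proof. by case: sV. Qed.
Let Ss x : V x -> S x (s^~ x). Proof. by case: sV => _ _; apply. Qed.
Let fs x : V x -> is_frame x (s^~ x). Proof. by move=> /Ss[/SU3_is_frame]. Qed.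
Let ts x i : V x -> tangent x (s i x). Proof. by move=> /fs[]. Qed.

Local Notation N x := (image_frame (s^~ x) x).

(** The two images are independent because the orbit metric takes a combination
    of them to the sum of the squares of its coefficients. *)
Lemma image_orthonormal x : V x -> orthonormal_frame gS (q x) (N x).
Proof.
move=> Vx; have Uy := VU Vx.
have tN i : tangent (q x) (N x i) by apply: push_tangent (ts _ Vx); apply: q_smooth.
have gN (i j : 'I_2) : gS (q x) (N x i) (N x j) = (i == j)%:R.
  rewrite /image_frame (metric_push sV) ?(coordinates_frame _ (fs Vx)) //; try exact: ts.
  rewrite !mxE /=; case: (unliftP ord0 i) => [i'|] ->; case: (unliftP ord0 j) => [j'|] ->;
    rewrite ?(ord1 i') ?(ord1 j') ?widenE -?val_eqE /=; ring.
split=> //.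
have fz := coordvec_frame zchartP Uy.
have -> : N x = change_frame (\matrix_i coordinates (coordvec zchart (q x)) (N x i)) (coordvec zchart (q x)).
  by apply/funext => i; rewrite /change_frame rowK -(frame_coordinates fz).
apply: change_is_frame => //.
rewrite -row_free_unit -kermx_eq0; apply/rowV0P => b /sub_kermxP b0.
pose v : tvec M := fun h => \sum_(i < 2) b 0 i * s (widen_ord (isT : (2 <= 6)%N) i) x h.
have tv : tangent x v by apply: tangent_comb => i; apply: ts.
have qv : push q x v = fun=> 0.
  rewrite /v push_comb -/(lincomb b (N x)).
  have -> : lincomb b (N x) = lincomb (\sum_i b 0 i *: coordinates (coordvec zchart (q x)) (N x i)) (coordvec zchart (q x)).
    rewrite lincomb_comb; apply/funext => h; apply: eq_bigr => i _.
    by rewrite -(frame_coordinates fz).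
  have -> : \sum_i b 0 i *: coordinates (coordvec zchart (q x)) (N x i) = 0.
    by apply: etrans b0; rewrite mulmx_sum_row; apply: eq_bigr => i _; rewrite rowK.
  by apply/funext => h; rewrite /lincomb big1 // => i _; rewrite mxE mul0r.
have q0 : push q x (fun=> 0) = fun=> 0 by apply/funext => h; rewrite /push; case: asboolP.
have c0 : coordinates (s^~ x) (fun=> 0) = 0.
  apply: (coordinatesP (fs Vx)); apply/funext => h.
  by rewrite /lincomb big1 // => i _; rewrite mxE mul0r.
have := metric_push sV Vx tv tv; rewrite qv -q0 (metric_push sV) //; try exact: tangent0.
rewrite c0 !mxE (coordinates_comb _ (fs Vx)) //; last by move=> i; apply: ts.
rewrite big_ord_recl big_ord1 !(coordinates_frame _ (fs Vx)) !mxE !widenE /=.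
rewrite !mulr0 !mulr1 !addr0 !add0r -!expr2 => /esym/eqP.
rewrite paddr_eq0 ?sqr_ge0 // !sqrf_eq0 => /andP[/eqP b00 /eqP b01].
apply/rowP => i; rewrite mxE; case: (unliftP ord0 i) => [i'|] ->; last exact: b00.
by rewrite (ord1 i').
Qed.

(** The lifts to the coframe bundle of the surface are taken along x |-> N x. *)
Lemma image_tangent x v : V x -> tangent x v -> exists p : F, exists2 w : tvec F,
  [/\ fbase p = q x, fframe p = N x, tangent p w & 
      (exists2 p0 : P, fbase p0 = x & fframe p0 = s^~ x /\ natural_map p0 p)] &
  etaF p w = eta_of (s^~ x) v /\ pull_d z p w = cder v (z \o q).
Proof.
move=> Vx tv; have Uy := VU Vx; have [p [bp fp]] := frame_point_ex (image_orthonormal Vx).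
have [p0 [bp0 fp0]] := frame_point_ex (Ss Vx).
have nS : nearby x [set x' | orthonormal_frame gS (q x') (N x')].
  by apply: nearby_mono (oV Vx) => x' /image_orthonormal.
have sse i h : Cinfty h -> smoothat x (fun x' => N x' i h).
  move=> Ch; apply: (@smoothat_eq _ _ _ (fun x' => s (widen_ord (isT : (2 <= 6)%N) i) x' (h \o q))).
    by apply: nearbyT => x' /=; rewrite /image_frame pushE //; apply: smoothat_gen.
  by case: (ss (widen_ord (isT : (2 <= 6)%N) i) Vx) => _; apply.
have sm := mkframe_smooth p nS (@q_smooth x) sse.
have E : mkframe p (q x) (N x) = p.
  by apply: frame_point_eq; rewrite ?fbase_mkframe ?fframe_mkframe //; apply: image_orthonormal.
have T := taut_mkframe p nS tv.
have B := push_fbase_mkframe p nS tv.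
have tp := push_tangent sm tv; rewrite /= E in tp T B.
exists p, (push (fun x' : M => mkframe p (q x') (N x')) x v).
  split=> //; exists p0 => //; split=> //; split; first by rewrite bp bp0.
  by rewrite fp fp0 bp0.
have [fN _] := image_orthonormal Vx.
split.
  rewrite /etaF T /eta_of.
  have -> : coordinates (N x) (push q x v) = \row_i coordinates (s^~ x) v 0 (widen_ord (isT : (2 <= 6)%N) i).
    apply: (coordinatesP fN); rewrite (push_q_decomp sV Vx tv); apply/funext => h.
    by rewrite /lincomb big_ord_recl big_ord1 !mxE /image_frame !widenE.
  rewrite [ord_max](_ : _ = lift ord0 ord0 :> 'I_2); last exact: val_inj.
  by rewrite !mxE !widenE.
by rewrite /pull_d B cder_q //; apply: z_smooth.
Qed.

(** The relations that define f, g and u on the coframe bundle, evaluated on lifts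
    of vectors of M. *)
Lemma relations_on_M x : V x -> (forall p : F, fbase p = q x -> fframe p = N x -> Fp p) ->
  exists c : C, [/\ forall v, tangent x v -> cder v (z \o q) = c * eta_of (s^~ x) v,
    expR (2 * u (q x)) = complex.Re (c * c^*) &
    forall p0 : P, fbase p0 = x -> fframe p0 = s^~ x ->
      (p4 p0)^* = f (q x) * c /\ (r p0)^* = g (q x) * (c * c * c)].
Proof.
move=> Vx Fpx; case: hz => _ hz'.
have [p [w1 [bp fp tw1 [p0 bp0 [fp0 nat]]] [e1 d1]]] := image_tangent Vx (ts (ex i0) Vx).
have Fpp : Fp p by apply: Fpx.
have [c Hc] := hz' p Fpp.
have eta1 : eta_of (s^~ x) (s (ex i0) x) = 1.
  rewrite /eta_of !(coordinates_frame (ex i0) (fs Vx)) !mxE /=.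
  by apply/eqP; rewrite eq_complex /= !eqxx.
rewrite eta1 in e1.
have d1' : pull_d z p w1 = c by rewrite (Hc _ tw1) e1 mulr1.
exists c; split.
- move=> v tv; have [p' [w [bp' fp' tw _] [e d]]] := image_tangent Vx tv.
  have E : p' = p by apply: frame_point_eq; rewrite ?bp' ?fp'.
  by subst p'; rewrite -d -e (Hc _ tw).
- have := hu Fpp tw1 tw1; rewrite e1 d1' bp => <-.
  by rewrite rmorph1 mulr1 /= mulr1.
- move=> p0' bp0' fp0'; have E : p0' = p0 by apply: frame_point_eq; rewrite ?bp0' ?fp0' ?bp0 ?fp0.
  subst p0'; rewrite -(hp4F nat) -(hrF nat).
  have := hf Fpp tw1; have := hg Fpp tw1 tw1 tw1.
  by rewrite e1 d1' bp !mulr1 => -> ->.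
Qed.

Lemma image_Fp_open x : V x -> (forall p : F, fbase p = q x -> fframe p = N x -> Fp p) ->
  nearby x [set x' | V x' /\ forall p : F, fbase p = q x' -> fframe p = N x' -> Fp p].
Proof.
move=> Vx Fpx; have [p [bp fp]] := frame_point_ex (image_orthonormal Vx).
have nS : nearby x [set x' | orthonormal_frame gS (q x') (N x')].
  by apply: nearby_mono (oV Vx) => x' /image_orthonormal.
have sse i h : Cinfty h -> smoothat x (fun x' => N x' i h).
  move=> Ch; apply: (@smoothat_eq _ _ _ (fun x' => s (widen_ord (isT : (2 <= 6)%N) i) x' (h \o q))).
    by apply: nearbyT => x' /=; rewrite /image_frame pushE //; apply: smoothat_gen.
  by case: (ss (widen_ord (isT : (2 <= 6)%N) i) Vx) => _; apply.
have sm := mkframe_smooth p nS (@q_smooth x) sse.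
have E : mkframe p (q x) (N x) = p.
  by apply: frame_point_eq; rewrite ?fbase_mkframe ?fframe_mkframe //; apply: image_orthonormal.
have := SO2_open hFp (Fpx p bp fp); rewrite -E => nF.
have := smooth_map_near sm nF; apply: nearbyS2 (oV Vx) => x' Vx' Fx'; split=> // p' bp' fp'.
have -> // : p' = mkframe p (q x') (N x').
have ox := image_orthonormal Vx'.
by apply: frame_point_eq; rewrite ?fbase_mkframe ?fframe_mkframe.
Qed.

End Lift.

Lemma push2 x (a b : R) v w :
  push q x (fun h => a * v h + b * w h) = fun h => a * push q x v h + b * push q x w h.
Proof. by apply/funext => h; rewrite /push; case: asboolP => // _; rewrite !mulr0 addr0. Qed.

Lemma image_frame_turn (al be ep : R) e x (p : F) (N := image_frame e x) :
  fframe p = image_frame (turn al be ep e) x ->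
  fframe p = fun i => if i == ord0 then fun h => al * N ord0 h + be * N (lift ord0 ord0) h
    else fun h => - ep * be * N ord0 h + ep * al * N (lift ord0 ord0) h.
Proof.
move=> ->; have [E0 E1 _ _] := turnE al be ep e.
apply/funext => i; rewrite /N /image_frame !widenE.
case: (unliftP ord0 i) => [j ->|->] /=; first by rewrite (ord1 j) !widenE E1 push2.
by rewrite !widenE E0 push2.
Qed.

Lemma SO2_frame (a b : R) (p p' : F) : Fp p -> fbase p' = fbase p -> a ^+ 2 + b ^+ 2 = 1 ->
  fframe p' = (fun i f => if i == ord0 then a * fframe p ord0 f + b * fframe p (lift ord0 ord0) f
     else - b * fframe p ord0 f + a * fframe p (lift ord0 ord0) f) -> Fp p'.
Proof.
move=> Fpp bp ab E; apply/(SO2_torsor hFp Fpp bp); exists a, b; split=> //.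
by rewrite (_ : ord_max = lift ord0 ord0) //; apply: val_inj.
Qed.

(** A reflection in the copy of O(2) inside SU(3) corrects the orientation. *)
Lemma oriented_section x0 : U (q x0) -> exists V (s : 'I_6 -> M -> tvec M),
  [/\ adapted_field V s, V x0, forall x, V x -> U (q x) &
      forall x, V x -> forall p : F, fbase p = q x -> fframe p = image_frame (s^~ x) x -> Fp p].
Proof.
move=> Ux0; have [V0 [s0 [V0x0 oV0 ss0 Ss0]]] := adapted_section hM hSU3 hsym x0.
pose V1 := [set x | V0 x /\ U (q x)].
have oV1 : fopen V1.
  by move=> x [V0x Ux]; apply: nearbyI (oV0 x V0x) (smooth_map_near (@q_smooth x) (hU Ux)).
have sV1 : adapted_field V1 s0 by apply: (adapted_field_sub oV1) (And3 oV0 ss0 Ss0) => x [].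
have V1U x : V1 x -> U (q x) by case.
have V1x0 : V1 x0 by [].
have fs : is_frame x0 (s0^~ x0) by case: (Ss0 x0 V0x0) => /SU3_is_frame.
have ts i : tangent x0 (s0 i x0) by case: fs.
have [p1 Fp1 bp1] := SO2_nonempty hFp Ux0.
have [[tf1 _] g1] : orthonormal_frame gS (q x0) (fframe p1) by rewrite -bp1; apply: (svalP p1).
pose N := image_frame (s0^~ x0) x0.
have [fN _] : orthonormal_frame gS (q x0) N by apply: (image_orthonormal sV1).
pose c i j := coordinates N (fframe p1 i) 0 j.
pose v i : tvec M := fun h => c i ord0 * s0 (ex i0) x0 h + c i (lift ord0 ord0) * s0 (ex i1) x0 h.
have vE i : v i = fun h => \sum_j pr2 (c i ord0) (c i (lift ord0 ord0)) j * pr2 (s0 (ex i0) x0) (s0 (ex i1) x0) j h.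
  by apply/funext => h; rewrite big_ord_recl big_ord1.
have tpr j : tangent x0 (pr2 (s0 (ex i0) x0) (s0 (ex i1) x0) j) by rewrite /pr2; case: ifP.
have tv i : tangent x0 (v i) by rewrite vE; apply: tangent_comb.
have p1E i : fframe p1 i = fun h => c i ord0 * N ord0 h + c i (lift ord0 ord0) * N (lift ord0 ord0) h.
  by rewrite (frame_coordinates fN (tf1 i)); apply/funext => h; rewrite /lincomb big_ord_recl big_ord1.
have qv i : push q x0 (v i) = fframe p1 i by rewrite push2 p1E /N /image_frame !widenE.
have cv i : (coordinates (s0^~ x0) (v i) 0 (ex i0) = c i ord0) * (coordinates (s0^~ x0) (v i) 0 (ex i1) = c i (lift ord0 ord0)).
  rewrite vE (coordinates_comb _ fs) // big_ord_recl big_ord1 /pr2 /= !(coordinates_frame _ fs).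
  by split; rewrite !mxE /=; ring.
have gc i j : c i ord0 * c j ord0 + c i (lift ord0 ord0) * c j (lift ord0 ord0) = (i == j)%:R.
  by rewrite -g1 -!qv (metric_push sV1) // !cv.
have := gc ord0 ord0; have := gc ord0 (lift ord0 ord0); have := gc (lift ord0 ord0) (lift ord0 ord0).
move: (p1E ord0) (p1E (lift ord0 ord0)).
set a00 := c ord0 ord0; set a01 := c ord0 (lift ord0 ord0).
set a10 := c (lift ord0 ord0) ord0; set a11 := c (lift ord0 ord0) (lift ord0 ord0).
rewrite !eqxx (_ : (ord0 == lift ord0 ord0) = false) //= !mulr1n mulr0n => E0 E1 H11 H01 H00.
pose d := a00 * a11 - a01 * a10.
have d1 : d ^+ 2 = 1.
  have -> : d ^+ 2 = (a00 * a00 + a01 * a01) * (a10 * a10 + a11 * a11) - (a00 * a10 + a01 * a11) ^+ 2.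
    by rewrite /d; ring.
  by rewrite H00 H11 H01 /= expr0n mulr1 subr0.
have A10 : a10 = - d * a01.
  have -> : - d * a01 = (a00 * a00 + a01 * a01) * a10 - (a00 * a10 + a01 * a11) * a00 by rewrite /d; ring.
  by rewrite H00 H01 /= mul0r subr0 mul1r.
have A11 : a11 = d * a00.
  have -> : d * a00 = (a00 * a00 + a01 * a01) * a11 - (a00 * a10 + a01 * a11) * a01 by rewrite /d; ring.
  by rewrite H00 H01 /= mul0r subr0 mul1r.
pose s1 i x := turn 1 0 d (s0^~ x) i.
have sV1' : adapted_field V1 s1.
  apply: (turn_field (al := fun=> 1) (be := fun=> 0) hM hSU3 sV1) => // [x _|x _|x _].
  - exact: smoothat_cst.
  - exact: smoothat_cst.
  - by rewrite expr1n expr0n addr0.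
have Fp0 (p : F) : fbase p = q x0 -> fframe p = image_frame (s1^~ x0) x0 -> Fp p.
  move=> bp /image_frame_turn; rewrite -/N => fp.
  apply: (@SO2_frame a00 (- d * a01) p1) => //; first by rewrite bp bp1.
    have -> : a00 ^+ 2 + (- d * a01) ^+ 2 = a00 * a00 + a01 * a01 + (d ^+ 2 - 1) * (a01 * a01) by ring.
    by rewrite d1 H00; ring.
  have dd : d * d = 1 by rewrite -expr2.
  rewrite fp; apply/funext => i; case: ifP => _; apply/funext => h; rewrite E0 E1 A10 A11.
    have -> : a00 * (a00 * N ord0 h + a01 * N (lift ord0 ord0) h) +
      - d * a01 * (- d * a01 * N ord0 h + d * a00 * N (lift ord0 ord0) h) =
      (a00 * a00 + a01 * a01) * N ord0 h + (d * d - 1) * (a01 * a01 * N ord0 h - a01 * a00 * N (lift ord0 ord0) h) by ring.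
    by rewrite H00 dd; ring.
  have -> : - (- d * a01) * (a00 * N ord0 h + a01 * N (lift ord0 ord0) h) +
    a00 * (- d * a01 * N ord0 h + d * a00 * N (lift ord0 ord0) h) =
    (a00 * a00 + a01 * a01) * (d * N (lift ord0 ord0) h) by ring.
  by rewrite H00; ring.
pose V := [set x | V1 x /\ forall p : F, fbase p = q x -> fframe p = image_frame (s1^~ x) x -> Fp p].
have oV : fopen V by move=> x [V1x Fpx]; apply: (image_Fp_open sV1' V1U).
exists V, s1; split=> //.
- by apply: (adapted_field_sub oV) sV1' => x [].
- by move=> x [/V1U].
- by move=> x [].
Qed.

(** Rotating the frame by the argument of c in dz = c eta makes c positive, and then
    c = e^u by the definition of u. *)
Lemma gauge x0 : U (q x0) -> exists V (s : 'I_6 -> M -> tvec M),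
  [/\ adapted_field V s, V x0, forall x, V x -> U (q x) &
      forall x, V x -> [/\ forall v, tangent x v -> cder v (z \o q) = (expR (u (q x)))%:C%C * eta_of (s^~ x) v,
        forall p0 : P, fbase p0 = x -> fframe p0 = s^~ x ->
          (p4 p0)^* = f (q x) * (expR (u (q x)))%:C%C /\
          (r p0)^* = g (q x) * ((expR (u (q x)))%:C%C) ^+ 3 &
        forall p : F, fbase p = q x -> fframe p = image_frame (s^~ x) x -> Fp p]].
Proof.
move=> /oriented_section[V [s [sV Vx0 VU Fps]]].
pose c x := cder (s (ex i0) x) (z \o q).
have [oV ss Ss] := sV.
have fs x : V x -> is_frame x (s^~ x) by move=> /Ss[/SU3_is_frame].
have ts x i : V x -> tangent x (s i x) by move=> /fs[].
have eta1 x : V x -> eta_of (s^~ x) (s (ex i0) x) = 1.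
  move=> Vx; rewrite /eta_of !(coordinates_frame (ex i0) (fs x Vx)) !mxE /=.
  by apply/eqP; rewrite eq_complex /= !eqxx.
have rel x : V x -> (forall v, tangent x v -> cder v (z \o q) = c x * eta_of (s^~ x) v) /\
    expR (2 * u (q x)) = complex.Re (c x * (c x)^*).
  move=> Vx; have [c' [Hc Hu _]] := relations_on_M sV VU Vx (Fps x Vx).
  have E : c x = c' by rewrite /c Hc ?eta1 ?mulr1 //; apply: ts.
  by rewrite E.
pose al x := complex.Re (c x) * expR (- u (q x)).
pose be x := - complex.Im (c x) * expR (- u (q x)).
have sz x : V x -> csmoothat x (z \o q).
  move=> Vx; have [sr si] := z_smooth (VU x Vx).
  by split; [apply: (smooth_map_atE (@q_smooth x) sr)|apply: (smooth_map_atE (@q_smooth x) si)].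
have sc x : V x -> csmoothat x c.
  by move=> Vx; have [sr si] := sz x Vx; split; apply: (smooth_field_at oV (ss _) Vx).
have su x : V x -> smoothat x (fun x => expR (- u (q x))).
  move=> Vx; apply/smoothat_expR/smoothatN.
  exact: (smooth_map_atE (@q_smooth x) (smooth_u (VU x Vx))).
have c2 x : V x -> complex.Re (c x) ^+ 2 + complex.Im (c x) ^+ 2 = expR (2 * u (q x)).
  by move=> /rel[_ ->]; case: (c x) => a b /=; ring.
have eu x : expR (2 * u (q x)) * (expR (- u (q x)) * expR (- u (q x))) = 1.
  by rewrite -!expRD (_ : _ + _ = 0) ?expR0 //; ring.
have ab1 x : V x -> al x ^+ 2 + be x ^+ 2 = 1.
  move=> Vx; rewrite -(eu x) -c2 // /al /be; ring.
pose s' i x := turn (al x) (be x) 1 (s^~ x) i.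
have sV' : adapted_field V s'.
  apply: (turn_field hM hSU3 sV) => // [x Vx|x Vx|].
  - by have [sr _] := sc x Vx; apply: smoothatM => //; apply: su.
  - by have [_ si] := sc x Vx; apply: smoothatM; [apply: smoothatN|apply: su].
  - by rewrite expr1n.
exists V, s'; split=> // x Vx.
have Fp' (p : F) : fbase p = q x -> fframe p = image_frame (s'^~ x) x -> Fp p.
  move=> bp /image_frame_turn fp.
  have [p0 [bp0 fp0]] := frame_point_ex (image_orthonormal sV VU Vx).
  apply: (@SO2_frame (al x) (be x) p0); rewrite ?bp0 ?bp ?ab1 //; first exact: Fps bp0 fp0.
  rewrite fp fp0; apply/funext => i; case: ifP => _; apply/funext => h //.
  by rewrite !mulN1r mul1r.
have [c' [Hc Hu Hp]] := relations_on_M sV' VU Vx Fp'.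
have c'E : c' = (expR (u (q x)))%:C%C.
  have [_ _ Ss'] := sV'; have fs' : is_frame x (s'^~ x) by case: (Ss' x Vx) => /SU3_is_frame.
  have ts' i : tangent x (s' i x) by case: fs'.
  have eta1' : eta_of (s'^~ x) (s' (ex i0) x) = 1.
    rewrite /eta_of !(coordinates_frame (ex i0) fs') !mxE /=.
    by apply/eqP; rewrite eq_complex /= !eqxx.
  have := Hc _ (ts' (ex i0)); rewrite eta1' mulr1 => <-.
  have [Hcs _] := rel x Vx; rewrite Hcs //.
  have [E0 _ _ _] := turnE (al x) (be x) 1 (s^~ x).
  have -> : eta_of (s^~ x) (s' (ex i0) x) = (al x +i* be x)%C.
    rewrite /s' E0.
    have -> : (fun h => al x * s (ex i0) x h + be x * s (ex i1) x h) =
      fun h => \sum_j pr2 (al x) (be x) j * pr2 (s (ex i0) x) (s (ex i1) x) j h.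
      by apply/funext => h; rewrite big_ord_recl big_ord1.
    rewrite /eta_of (coordinates_comb _ (fs x Vx)); last by move=> j; rewrite /pr2; case: ifP => _; apply: ts.
    rewrite big_ord_recl big_ord1 /pr2 /= !(coordinates_frame _ (fs x Vx)) !mxE /=.
    by apply/eqP; rewrite eq_complex /=; apply/andP; split; apply/eqP; ring.
  have e1 : expR (u (q x)) = expR (2 * u (q x)) * expR (- u (q x)).
    by rewrite -expRD; congr expR; ring.
  have c2x := c2 x Vx; rewrite e1 -c2x /al /be; case: (c x) => a b.
  by apply/eqP; rewrite eq_complex /=; apply/andP; split; apply/eqP; ring.
split=> [v tv|p0 bp0 fp0|//]; first by rewrite -c'E Hc.
have [-> ->] := Hp p0 bp0 fp0; rewrite c'E; split=> //; ring.
Qed.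

End Holomorphic.

End OrbitSurface.

(** * Brackets of vector fields and the Jacobi identity *)

Section ChartBrackets.
Context {R : realType} {X : fspace R} {n : nat} (U : set X) (c : 'I_n -> X -> R).
Hypothesis cU : chart U c.

Lemma coordvec_comm x f i j : U x -> smoothat x f ->
  coordvec c x i (fun y => coordvec c y j f) = coordvec c x j (fun y => coordvec c y i f).
Proof.
move=> Ux smf; have [phi [A [oA Ax CA E]]] := chart_represents cU Ux smf.
have H k : represents c (fun y => coordvec c y k f) x (partial k phi).
  exists A; split=> //; first exact: Cinf_partial.
  have := nearbyI (nearby_nearby E) (chart_fopen cU Ux).
  apply: nearby_mono => y [nE Uy] Ay.
  by rewrite (@coordvecE _ _ _ _ _ cU _ _ phi) //; exists A.
rewrite !(coordvecE cU _ Ux (H _)).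
exact: partial_sym oA Ax (CA 1%N).
Qed.

(** The second derivatives of f cancel in the bracket because the coordinate
    derivations commute. *)
Lemma bracket_chart V Y Z x : fopen V -> smooth_field V Y -> smooth_field V Z -> V x -> U x ->
  bracket Y Z x = lincomb (\row_i bracket Y Z x (c i)) (coordvec c x).
Proof.
move=> oV sY sZ Vx Ux; have [tY _] := sY x Vx; have [tZ _] := sZ x Vx.
have tc i := coordvec_tangent cU i Ux.
have smc i : smoothat x (c i) by apply: (chart_smoothat cU).
have expand (W : X -> tvec X) f : smooth_field V W -> smoothat x f ->
    nearby x [set y | W y f = \sum_i W y (c i) * coordvec c y i f].
  move=> sW smf; apply: nearbyS2 (oV x Vx) (chart_fopen cU Ux) => y Vy Uy.
  have [tW _] := sW y Vy; rewrite /= {1}(coordvec_decomp cU Uy tW) /lincomb.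
  by apply: eq_bigr => i _; rewrite mxE.
have second (W W' : X -> tvec X) f : smooth_field V W -> smooth_field V W' -> smoothat x f ->
    W x (fun y => W' y f) = \sum_i W x (fun y => W' y (c i)) * coordvec c x i f
     + \sum_i \sum_j W' x (c i) * W x (c j) * coordvec c x j (fun y => coordvec c y i f).
  move=> sW sW' smf; have [tW _] := sW x Vx.
  have smd i : smoothat x (fun y => coordvec c y i f).
    exact: (smooth_field_at (chart_fopen cU) (coordvec_field cU i) Ux smf).
  have smW' i : smoothat x (fun y => W' y (c i)) by apply: (smooth_field_at oV sW' Vx).
  rewrite (tangent_germ tW (expand W' f sW' smf)) (tan_sum tW); last first.
    by move=> i; apply: smoothatM.
  rewrite -big_split; apply: eq_bigr => i _ /=.
  rewrite (tangentM tW (smW' i) (smd i)) [LHS]addrC [X in X + _ = _]mulrC; congr (_ + _).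
  have -> : W x (fun y => coordvec c y i f) = \sum_j W x (c j) * coordvec c x j (fun y => coordvec c y i f).
    by rewrite {1}(coordvec_decomp cU Ux tW) /lincomb; apply: eq_bigr => j _; rewrite mxE.
  by rewrite mulr_sumr; apply: eq_bigr => j _; rewrite mulrA.
apply/funext => f; rewrite {1}/bracket; case: asboolP => [smf|nsf]; last first.
  by rewrite /lincomb big1 // => i _; rewrite (tangent_junk (tc i)) ?mulr0.
rewrite (second Y Z) // (second Z Y) // opprD addrACA [X in _ + X](_ : _ = 0); last first.
  apply/eqP; rewrite subr_eq0; apply/eqP; rewrite exchange_big.
  apply: eq_bigr => i _; apply: eq_bigr => j _; rewrite (coordvec_comm _ _ Ux smf).
  by rewrite [Y x (c i) * _]mulrC.
rewrite addr0 -sumrB; apply: eq_bigr => i _; rewrite mxE -mulrBl; congr (_ * _).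
by rewrite /bracket; case: asboolP => // /(_ (smc i)).
Qed.

End ChartBrackets.

Section FrameFields.
Context {R : realType} {X : fspace R} {n : nat}.
Hypothesis hX : manifold n X.
Variables (V : set X) (s : 'I_n -> X -> tvec X).
Hypothesis oV : fopen V.
Hypothesis ss : forall i, smooth_field V (s i).
Hypothesis fs : forall x, V x -> is_frame x (s^~ x).
Implicit Types (Y Z : X -> tvec X) (x : X).

Lemma bracketE Y Z x f : smoothat x f ->
  bracket Y Z x f = Y x (fun y => Z y f) - Z x (fun y => Y y f).
Proof. by rewrite /bracket; case: asboolP. Qed.

Lemma bracket_field Y Z : smooth_field V Y -> smooth_field V Z -> smooth_field V (bracket Y Z).
Proof.
move=> sY sZ x Vx; have [U [c [Ux cU]]] := manifold_charts hX x; split.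
  rewrite (bracket_chart cU oV sY sZ Vx Ux); apply: tangent_lincomb => i.
  exact: (coordvec_tangent cU).
move=> f Cf; apply: (@smoothat_eq _ _ _ (fun y => Y y (fun y => Z y f) - Z y (fun y => Y y f))).
  by apply: nearbyT => y /=; rewrite bracketE //; apply: smoothat_gen.
have smf := smoothat_gen x Cf.
by apply: smoothatB; apply: (smooth_field_at oV _ Vx) => //; apply: (smooth_field_at oV _ Vx).
Qed.

Lemma coordinates_smooth Z x l : smooth_field V Z -> V x ->
  smoothat x (fun y => coordinates (s^~ y) (Z y) 0 l).
Proof.
move=> sZ Vx; have [U [c [Ux cU]]] := manifold_charts hX x.
have smc i : smoothat x (c i) by apply: (chart_smoothat cU).
have ts y i : V y -> tangent y (s i y) by move=> /fs[].
apply: (@smoothat_solve _ _ x n (fun m l y => s l y (c m)) (fun m y => Z y (c m))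
         (fun l y => coordinates (s^~ y) (Z y) 0 l)).
- by move=> i j; apply: (smooth_field_at oV).
- by move=> i; apply: (smooth_field_at oV).
- have := transition_unit (coordvec_frame cU Ux) (fs Vx).
  rewrite unitmxE unitfE -det_tr; congr (\det _ != 0); apply/matrixP => i j; rewrite !mxE.
  by rewrite (coordinatesP (coordvec_frame cU Ux) (coordvec_decomp cU Ux (ts x j Vx))) mxE.
- apply: nearby_mono (oV Vx) => y Vy i; have [tZ _] := sZ y Vy.
  rewrite {2}(frame_coordinates (fs Vy) tZ) /lincomb.
  by apply: eq_bigr => j _; rewrite mulrC.
Qed.

(** The coefficient B_jk^l in [s_j, s_k] = sum_l B_jk^l s_l. *)
Definition structure_fun j k (l : 'I_n) x : R := coordinates (s^~ x) (bracket (s j) (s k) x) 0 l.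
Local Notation B := structure_fun.

Lemma bracket_tangent j k x : V x -> tangent x (bracket (s j) (s k) x).
Proof. by move=> Vx; case: (bracket_field (ss j) (ss k) Vx). Qed.

Lemma structure_smooth j k l x : V x -> smoothat x (B j k l).
Proof. by move=> Vx; apply: coordinates_smooth => //; apply: bracket_field. Qed.

Lemma structureE j k x f : V x -> smoothat x f ->
  s j x (fun y => s k y f) - s k x (fun y => s j y f) = \sum_l B j k l x * s l x f.
Proof.
move=> Vx smf; rewrite -(@bracketE (s j) (s k)) //.
by rewrite (frame_coordinates (fs Vx) (bracket_tangent j k Vx)).
Qed.

Lemma structure_skew j k l x : V x -> B j k l x = - B k j l x.
Proof.
move=> Vx; have t1 := bracket_tangent j k Vx; have t2 := bracket_tangent k j Vx.
have E : lincomb (coordinates (s^~ x) (bracket (s j) (s k) x)) (s^~ x)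
    = lincomb (- coordinates (s^~ x) (bracket (s k) (s j) x)) (s^~ x).
  rewrite -(frame_coordinates (fs Vx) t1).
  have -> : lincomb (- coordinates (s^~ x) (bracket (s k) (s j) x)) (s^~ x) =
    fun f => - lincomb (coordinates (s^~ x) (bracket (s k) (s j) x)) (s^~ x) f.
    by apply/funext => f; rewrite /lincomb -sumrN; apply: eq_bigr => i _; rewrite mxE mulNr.
  rewrite -(frame_coordinates (fs Vx) t2); apply/funext => f.
  by rewrite /bracket; case: asboolP => _; rewrite ?oppr0 ?opprB.
by have := congr1 (fun c : 'rV[R]_n => c 0 l) (frame_inj (fs Vx) E); rewrite mxE.
Qed.

(** The Jacobi identity for s_i, s_j, s_k with all brackets expanded in the frame. *)
Lemma jacobi i j k m x : V x ->
    (s i x (B j k m) + \sum_l B j k l x * B i l m x)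
  + (s j x (B k i m) + \sum_l B k i l x * B j l m x)
  + (s k x (B i j m) + \sum_l B i j l x * B k l m x) = 0.
Proof.
move=> Vx; have ts a : tangent x (s a x) by case: (fs Vx).
pose J a b d : 'rV[R]_n := \row_m (s a x (B b d m) + \sum_l B b d l x * B a l m x).
have JE a b d f : smoothat x f -> lincomb (J a b d) (s^~ x) f =
    s a x (fun y => \sum_l B b d l y * s l y f) - \sum_l B b d l x * s l x (fun y => s a y f).
  move=> smf; have sms l : smoothat x (fun y => s l y f) by apply: (smooth_field_at oV).
  rewrite (tan_sum (ts a)); last by move=> l; apply: smoothatM => //; apply: structure_smooth.
  transitivity (\sum_l (s a x (B b d l) * s l x f
      + B b d l x * (s a x (fun y => s l y f) - s l x (fun y => s a y f)))).
    rewrite big_split /=.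
    have -> : \sum_l B b d l x * (s a x (fun y => s l y f) - s l x (fun y => s a y f)) =
       \sum_l B b d l x * \sum_m' B a l m' x * s m' x f.
      by apply: eq_bigr => l _; rewrite structureE.
    have -> : \sum_l B b d l x * \sum_m' B a l m' x * s m' x f =
       \sum_m' (\sum_l B b d l x * B a l m' x) * s m' x f.
      under eq_bigr do rewrite mulr_sumr.
      rewrite exchange_big; apply: eq_bigr => m' _ /=; rewrite mulr_suml.
      by apply: eq_bigr => l _; rewrite mulrA.
    by rewrite -big_split; apply: eq_bigr => l _; rewrite mxE mulrDl.
  rewrite -sumrB; apply: eq_bigr => l _.
  by rewrite (tangentM (ts a) (structure_smooth b d l Vx) (sms l)); ring.
have JE' a b d f : smoothat x f -> lincomb (J a b d) (s^~ x) f =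
    s a x (fun y => s b y (fun y => s d y f)) - s a x (fun y => s d y (fun y => s b y f))
     - (s b x (fun y => s d y (fun y => s a y f)) - s d x (fun y => s b y (fun y => s a y f))).
  move=> smf; have sms l : smoothat x (fun y => s l y f) by apply: (smooth_field_at oV).
  have sms2 l l' : smoothat x (fun y => s l y (fun y => s l' y f)) by apply: (smooth_field_at oV).
  rewrite JE // -structureE // -(tangentB (ts a)) //; congr (_ - _).
  apply: (tangent_germ (ts a)).
  apply: nearbyS2 (oV Vx) (smoothat_nearby smf) => y Vy smy /=.
  by rewrite structureE.
have E : lincomb (J i j k + J j k i + J k i j) (s^~ x) = lincomb 0 (s^~ x).
  apply: (tangent_ext_smooth (x := x)); try exact: tangent_lincomb.
  move=> f smf.
  have -> : lincomb 0 (s^~ x) f = 0 by rewrite /lincomb big1 // => a _; rewrite mxE mul0r.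
  have -> : lincomb (J i j k + J j k i + J k i j) (s^~ x) f =
    lincomb (J i j k) (s^~ x) f + lincomb (J j k i) (s^~ x) f + lincomb (J k i j) (s^~ x) f.
    by rewrite /lincomb -!big_split; apply: eq_bigr => a _; rewrite !mxE !mulrDl.
  rewrite !JE' //; ring.
by have := congr1 (fun c : 'rV[R]_n => c 0 m) (frame_inj (fs Vx) E); rewrite !mxE.
Qed.

End FrameFields.

(** * Lifting frame fields to the bundle of adapted frames *)

Section OneForms.
Context {R : realType} {X : fspace R}.

(** The right-hand side of the Koszul formula for a 1-form; it serves both to
    evaluate a given differential and to establish one. *)
Lemma koszul1 (w : dform X 1) (Z : 'I_2 -> X -> tvec X) x :
  \sum_(i < 2) (-1) ^+ i * cder (Z i x) (fun y => w y (fun l => Z (lift i l) y))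
    + \sum_(j < 2) \sum_(i < 2 | (i < j)%N) (-1) ^+ j *
        w x (fun l => if lift j l == i then bracket (Z i) (Z j) x else Z (lift j l) x) =
  cder (Z ord0 x) (fun y => w y (fun=> Z ord_max y))
    - cder (Z ord_max x) (fun y => w y (fun=> Z ord0 y)) - w x (fun=> bracket (Z ord0) (Z ord_max) x).
Proof.
have S2 (f : 'I_2 -> R[i]) : \sum_i f i = f ord0 + f (lift ord0 ord0).
  by rewrite big_ord_recl big_ord1.
rewrite !S2 [X in _ + (X + _)]big_pred0 // [X in _ + (_ + X)](big_pred1 ord0); last first.
  by case=> [[|[|?]] ?].
rewrite add0r /= expr0 expr1 mul1r !mulN1r [w x _]form1_eta /=.
have L1 : lift ord0 ord0 = ord_max :> 'I_2 by apply: val_inj.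
have L0 : lift ord_max ord0 = ord0 :> 'I_2 by apply: val_inj.
have -> : (fun y => w y (fun l : 'I_1 => Z (lift ord0 l) y)) = (fun y => w y (fun=> Z ord_max y)).
  by apply/funext => y; rewrite form1_eta L1.
have -> : (fun y => w y (fun l : 'I_1 => Z (lift (lift ord0 ord0) l) y)) = (fun y => w y (fun=> Z ord0 y)).
  by apply/funext => y; rewrite form1_eta L1 L0.
by rewrite L1.
Qed.

Lemma is_d1 (U V : set X) (w : dform X 1) (t : dform X 2) (Y Z : X -> tvec X) x :
  is_d U w t -> fopen V -> V `<=` U -> smooth_field V Y -> smooth_field V Z -> V x ->
  t x (pr2 (Y x) (Z x)) = cder (Y x) (fun y => w y (fun=> Z y))
    - cder (Z x) (fun y => w y (fun=> Y y)) - w x (fun=> bracket Y Z x).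
Proof.
move=> dw oV VU sY sZ Vx.
have sYZ i : smooth_field V (pr2 Y Z i) by rewrite /pr2; case: ifP.
have := dw V (pr2 Y Z) oV VU sYZ x Vx; rewrite koszul1.
by have -> : (fun i => pr2 Y Z i x) = pr2 (Y x) (Z x) by apply/funext => i; rewrite /pr2; case: ifP.
Qed.

(** By the chain rule it suffices to test a field on the generators. *)
Lemma generated_field (T : Type) (gen : set (T -> R)) (V : set (Defs.generated gen)) Z :
  (forall x, V x -> tangent x (Z x)) ->
  (forall x f, V x -> gen f -> smoothat x (fun y => Z y f)) -> fopen V -> smooth_field V Z.
Proof.
move=> tZ sZ oV x Vx; split; first exact: tZ.
move=> f /(_ x)[k [g [A [phi [gC oA Ax Cphi H]]]]].
have smg (y : Defs.generated gen) i : smoothat y (g i) by apply/smoothat_gen/Cinfty_gen/gC.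
have nA : nearby (x : Defs.generated gen) [set y | A (jointly g y)].
  by apply: nearby_generated; exists k, g, A.
apply: (@smoothat_eq R (Defs.generated gen) _
          (fun y => \sum_i partial i phi (jointly g y) * Z y (g i))).
  apply: nearbyS2 nA (oV x Vx) => y Ay Vy /=.
  have n : nearby y [set y : Defs.generated gen | f y = (phi \o jointly g) y].
    by apply: nearby_generated; exists k, g, A; split.
  by rewrite (tangent_germ (tZ y Vy) n) (tangent_chain (tZ y Vy) (smg y) oA Ay Cphi).
apply: smoothat_sum => i; apply: smoothatM; last by apply: sZ => //; apply: gC.
by apply: (smoothat_comp (smg x) oA Ax); apply: Cinf_partial.
Qed.

End OneForms.

Section Lifts.
Context {R : realType} {M : fspace R} {Om : dform M 2} {Up : dform M 3}.
Context {n : nat} {G : groupType} {CG : set (G -> R)} {act : G -> M -> M}.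
Hypothesis hM : manifold 6 M.
Local Notation C := R[i].
Local Notation S := (adapted CG act Om Up).
Local Notation P := (P_bundle CG act Om Up).
Variables (V : set M) (s : 'I_6 -> M -> tvec M).
Hypothesis sV : adapted_field (CG := CG) (act := act) (Om := Om) (Up := Up) V s.
Implicit Types (p : P) (x y : M).

Let oV : fopen V. Proof. by case: sV. Qed.
Let ss i : smooth_field V (s i). Proof. by case: sV. Qed.
Let Ss x : V x -> S x (s^~ x). Proof. by case: sV => _ _; apply. Qed.
Let fs x : V x -> is_frame x (s^~ x). Proof. by move=> /Ss[/SU3_is_frame]. Qed.
Let ts x i : V x -> tangent x (s i x). Proof. by move=> /fs[]. Qed.
Let fp p : is_frame (fbase p) (fframe p). Proof. by case: (svalP p) => /SU3_is_frame. Qed.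

Definition gauge_of p : 'M[R]_6 := transition (s^~ (fbase p)) (fframe p).
Definition frame_extension p y : P := mkframe p y (change_frame (gauge_of p) (s^~ y)).
(** The vector field s_k, lifted to P along the local sections of P that are
    constant combinations of the frame s. *)
Definition field_lift k p : tvec P := push (frame_extension p) (fbase p) (s k (fbase p)).

(** The matrix of a change of adapted frames preserves Omega0, Upsilon0 and the
    vanishing of the first two coordinates; none of this depends on the point. *)
Lemma gauge_adapted p y : V (fbase p) -> V y -> S y (change_frame (gauge_of p) (s^~ y)).
Proof.
move=> Vp Vy; set A := gauge_of p; set x := fbase p.
have [sx Hx] := Ss Vp; have [sp Hp] : S x (fframe p) := svalP p.
have [sy Hy] := Ss Vy.
have uA : A \in unitmx := transition_unit (fs Vp) (fp p).
have tl c : tangent x (lincomb c (fframe p)) by apply: tangent_lincomb; case: (fp p).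
have cA c : coordinates (s^~ x) (lincomb c (fframe p)) = c *m A.
  by rewrite -(coordinates_transition (fs Vp) (fp p) (tl c)) (coordinates_lincomb _ (fp p)).
split.
  apply: (change_SU3 sy uA).
    move=> a b; rewrite -!cA -(omE sx) // (omE sp) //; by rewrite !(coordinates_lincomb _ (fp p)).
  move=> a; have [_ _ Upx] := sx; have [_ _ Upp] := sp.
  transitivity (Up x (fun i => lincomb (a i) (fframe p))).
    by rewrite Upx //; congr Upsilon0; apply/funext => i; rewrite cA.
  by rewrite Upp //; congr Upsilon0; apply/funext => i; rewrite (coordinates_lincomb _ (fp p)).
move=> v tv; rewrite (Hy v tv) -!(coordinates_change (fs Vy) uA tv) -cA.
set c := coordinates _ v; rewrite -(Hx _ (tl c)) (Hp _ (tl c)).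
by rewrite (coordinates_lincomb _ (fp p)).
Qed.

Lemma frame_extension_base p : V (fbase p) -> frame_extension p (fbase p) = p.
Proof.
move=> Vp; have Sp := gauge_adapted Vp Vp.
apply: frame_point_eq; rewrite /frame_extension ?fbase_mkframe ?fframe_mkframe //.
exact: transitionE (fs Vp) (fp p).
Qed.

Lemma gauge_near p : V (fbase p) ->
  nearby (fbase p) [set y | S y (change_frame (gauge_of p) (s^~ y))].
Proof. by move=> Vp; apply: nearby_mono (oV Vp) => y; apply: gauge_adapted. Qed.

Let sid x : @smooth_map_at R M M id x. Proof. by move=> h Ch; apply: smoothat_gen. Qed.

Let change_smooth p i h x : V x -> smoothat x h ->
  smoothat x (fun y => change_frame (gauge_of p) (s^~ y) i h).
Proof.
move=> Vx smh; apply: smoothat_sum => j; apply: smoothatM; first exact: smoothat_cst.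
exact: (smooth_field_at oV).
Qed.

Lemma frame_extension_smooth p : V (fbase p) -> smooth_map_at (frame_extension p) (fbase p).
Proof.
move=> Vp; apply: (@mkframe_smooth R M 6 S M p id) => //; first exact: gauge_near.
by move=> i h Ch; apply: change_smooth => //; apply: smoothat_gen.
Qed.

Lemma field_lift_tangent k p : V (fbase p) -> tangent p (field_lift k p).
Proof.
move=> Vp; have := push_tangent (frame_extension_smooth Vp) (ts k Vp).
by rewrite frame_extension_base.
Qed.

Lemma push_field_lift k p : V (fbase p) -> push (@fbase R M 6 S) p (field_lift k p) = s k (fbase p).
Proof.
move=> Vp; rewrite -{1}(frame_extension_base Vp).
have := push_fbase_mkframe (b := id) p (gauge_near Vp) (ts k Vp).
by rewrite push_id //; apply: ts.
Qed.

Lemma field_lift_base k p h : V (fbase p) -> smoothat (fbase p) h ->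
  field_lift k p (fun p' => h (fbase p')) = s k (fbase p) h.
Proof. by move=> Vp smh; rewrite -(push_field_lift k Vp) pushE. Qed.

Lemma gauge_smooth p i j : V (fbase p) -> smoothat p (fun p' => gauge_of p' i j).
Proof.
move=> Vp; have [U [c [Ux cU]]] := manifold_charts hM (fbase p).
have sb : smooth_map_at (@fbase R M 6 S) p := fbase_smooth p.
have smc m : smoothat (fbase p) (c m) by apply: (chart_smoothat cU).
apply: (@smoothat_solve _ _ p 6 (fun m l p' => s l (fbase p') (c m)) (fun m p' => fframe p' i (c m))
         (fun l p' => gauge_of p' i l)).
- move=> m l; apply: (smooth_map_atE sb (f := fun x => s l x (c m))).
  exact: (smooth_field_at oV).
- move=> m; apply: fframe_smoothat => // x e [se _].
  by case: (SU3_is_frame se).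
- have := transition_unit (coordvec_frame cU Ux) (fs Vp).
  rewrite unitmxE unitfE -det_tr; congr (\det _ != 0); apply/matrixP => a b; rewrite !mxE.
  by rewrite (coordinatesP (coordvec_frame cU Ux) (coordvec_decomp cU Ux (ts b Vp))) mxE.
- have := smooth_map_near sb (oV Vp); apply: nearby_mono => p' Vp' m.
  rewrite /= -{1}(transitionE (fs Vp') (fp p')) /change_frame /lincomb.
  by apply: eq_bigr => l _; rewrite [row _ _ _ _]mxE mulrC.
Qed.

Lemma field_lift_frame k p i h : V (fbase p) -> Cinfty h ->
  field_lift k p (fun p' => fframe p' i h) =
  \sum_j gauge_of p i j * s k (fbase p) (fun y => s j y h).
Proof.
move=> Vp Ch; have smh x : smoothat x h by apply: smoothat_gen.
have smf : smoothat (frame_extension p (fbase p)) (fun p' : P => fframe p' i h).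
  exact: fframe_smooth.
rewrite /field_lift pushE //.
have sms j : smoothat (fbase p) (fun y => s j y h) by apply: (smooth_field_at oV).
transitivity (s k (fbase p) (fun y => \sum_j gauge_of p i j * s j y h)).
  apply: (tangent_germ (ts k Vp)); apply: nearby_mono (gauge_near Vp) => y Sy /=.
  rewrite /frame_extension fframe_mkframe // /change_frame /lincomb.
  by apply: eq_bigr => j _; rewrite [row _ _ _ _]mxE.
rewrite (tan_sum (ts k Vp)); last by move=> j; apply: smoothatM => //; apply: smoothat_cst.
by apply: eq_bigr => j _; rewrite (tangentZ _ (ts k Vp)).
Qed.

Definition over_V : set P := [set p | V (fbase p)].

Lemma over_V_open : fopen over_V.
Proof. by move=> p Vp; apply: (smooth_map_near (fbase_smooth p) (oV Vp)). Qed.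

Lemma field_lift_field k : smooth_field over_V (field_lift k).
Proof.
apply: generated_field => [p|p f Vp|]; [exact: field_lift_tangent| |exact: over_V_open].
have sb : smooth_map_at (@fbase R M 6 S) p := fbase_smooth p.
case=> [[h Ch ->]|[i [h Ch ->]]].
  apply: (@smoothat_eq _ _ _ (fun p' : P => s k (fbase p') h)).
    apply: nearby_mono (over_V_open Vp) => p' Vp' /=.
    by rewrite field_lift_base //; apply: smoothat_gen.
  by apply: (smooth_map_atE sb (f := fun x => s k x h)); case: (ss k Vp) => _; apply.
apply: (@smoothat_eq _ _ _ (fun p' : P => \sum_j gauge_of p' i j * s k (fbase p') (fun y => s j y h))).
  apply: nearby_mono (over_V_open Vp) => p' Vp' /=.
  by rewrite -field_lift_frame.
apply: smoothat_sum => j; apply: smoothatM; first exact: gauge_smooth.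
apply: (smooth_map_atE sb (f := fun x => s k x (fun y => s j y h))).
by apply: (smooth_field_at oV _ Vp) => //; apply: (smooth_field_at oV _ Vp) => //; apply: smoothat_gen.
Qed.

Lemma push_bracket_lift j k p : V (fbase p) ->
  push (@fbase R M 6 S) p (bracket (field_lift j) (field_lift k) p)
  = bracket (s j) (s k) (fbase p).
Proof.
move=> Vp; apply/funext => h; rewrite /push; case: asboolP => [smh|nsm]; last first.
  by rewrite /bracket; case: asboolP.
have sb : smooth_map_at (@fbase R M 6 S) p := fbase_smooth p.
rewrite !bracketE //; last exact: (smooth_map_atE sb smh).
have E a b : field_lift a p (fun p' => field_lift b p' (h \o @fbase R M 6 S)) =
    s a (fbase p) (fun y => s b y h).
  have smb : smoothat (fbase p) (fun y => s b y h) by apply: (smooth_field_at oV).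
  rewrite -(field_lift_base a Vp smb); apply: (tangent_germ (field_lift_tangent a Vp)).
  apply: nearbyS2 (over_V_open Vp) (smooth_map_near sb (smoothat_nearby smh)) => p' Vp' smh' /=.
  by rewrite -field_lift_base.
by rewrite !E.
Qed.

(** Pulling a structure equation back to V by the section s of P: since the
    tautological components of the lifts are constant along the section, the
    differential of a form constant on the coframe is minus its value on brackets. *)
Lemma structure_transport x p : V x -> fbase p = x -> fframe p = s^~ x ->
  exists Zl : 'I_6 -> tvec P,
    [/\ forall k, tangent p (Zl k), forall k, taut p (Zl k) = delta_mx 0 k &
     forall (w : dform P 1) (t : dform P 2) (L : 'rV[R]_6 -> C), is_d setT w t ->
       (forall p' v, w p' (fun=> v) = L (taut p' v)) ->
       forall j k, t p (pr2 (Zl j) (Zl k)) = - L (coordinates (s^~ x) (bracket (s j) (s k) x))].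
Proof.
move=> Vx bp fpx; have Vp : V (fbase p) by rewrite bp.
have tautE p' k : V (fbase p') -> fframe p' = s^~ (fbase p') -> taut p' (field_lift k p') = delta_mx 0 k.
  by move=> Vp' fp'; rewrite /taut push_field_lift // fp' (coordinates_frame _ (fs Vp')).
have fpb : fframe p = s^~ (fbase p) by rewrite fpx bp.
exists (fun k => field_lift k p); split=> [k|k|w t L dw wL j k].
- exact: field_lift_tangent.
- exact: tautE.
rewrite (is_d1 dw over_V_open (fun _ _ => I) (field_lift_field j) (field_lift_field k) Vp).
have A1 : gauge_of p = 1%:M.
  apply/row_matrixP => i; rewrite /gauge_of /transition rowK fpb (coordinates_frame _ (fs Vp)).
  by rewrite row1.
have ext y : V y -> fbase (frame_extension p y) = y /\ fframe (frame_extension p y) = s^~ y.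
  move=> Vy; have Sy := gauge_adapted Vp Vy; rewrite /frame_extension fbase_mkframe // fframe_mkframe //.
  split=> //; rewrite A1; apply: funext => i; rewrite /change_frame row1.
  exact: lincomb_delta.
have part (part : C -> R) a b : field_lift a p (fun p' => part (w p' (fun=> field_lift b p'))) = 0.
  rewrite {1}/field_lift {1}/push; case: asboolP => // _.
  rewrite -(tan_cst (part (L (delta_mx 0 b))) (ts a Vp)); apply: (tangent_germ (ts a Vp)).
  apply: nearby_mono (oV Vp) => y Vy /=; have [by1 fy] := ext y Vy.
  by rewrite wL (tautE (frame_extension p y)) // ?by1.
have cd a b : cder (field_lift a p) (fun p' => w p' (fun=> field_lift b p')) = 0.
  by rewrite /cder !part.
by rewrite !cd subrr sub0r wL /taut push_bracket_lift // fpb bp.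
Qed.

End Lifts.

(** * The structure equations in the normalized gauge *)

Section StructureTable.
Context {R : realType}.
Local Notation C := R[i].
Local Notation ii := (0 +i* 1)%C.

(* The coframe eta, theta, omega^3, omega^6 on the k-th vector of an adapted frame. *)
Definition unit_at (m k : nat) : R := if k == m then 1 else 0.
Definition eta_at k : C := (unit_at 0 k +i* unit_at 1 k)%C.
Definition theta_at k : C := (unit_at 3 k +i* unit_at 4 k)%C.
Definition w3_at k : C := (unit_at 2 k)%:C%C.
Definition w6_at k : C := (unit_at 5 k)%:C%C.
Definition wd (X Y : nat -> C) j k : C := X j * Y k - X k * Y j.

Record torsion := Torsion { re1 : R; im1 : R; re2 : R; im2 : R; re3 : R; im3 : R;
  re4 : R; im4 : R; rer : R; imr : R }.

(** The components of the brackets [s_j, s_k], j < k, of an adapted frame field in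
    the gauge dz = e^u eta, as read off from the structure equations; u1 and u2 are
    the derivatives of u along the first two fields. *)
Definition half_table (t : torsion) (u1 u2 : R) (j k : nat) : seq R :=
  match j, k with
  | 0, 1 => [:: - u2; u1; 5; 0; 0; 0]
  | 0, 2 => [:: 0; 0; - im1 t; 0; 0; - im2 t]
  | 0, 3 => [:: 0; 0; 0; - 3 * re4 t - imr t; - im4 t + rer t + u2; 0]
  | 0, 4 => [:: 0; 0; 0; - im4 t + rer t - u2; - re4 t + imr t; 3]
  | 0, 5 => [:: 0; 0; - im2 t; 0; - 4; - re3 t]
  | 1, 2 => [:: 0; 0; re1 t; 0; 0; re2 t]
  | 1, 3 => [:: 0; 0; 0; - im4 t + rer t; - re4 t + imr t - u1; - 3]
  | 1, 4 => [:: 0; 0; 0; - re4 t + imr t + u1; - 3 * im4 t - rer t; 0]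
  | 1, 5 => [:: 0; 0; re2 t; 4; 0; - im3 t]
  | 2, 3 => [:: 0; 0; - im2 t; 0; 0; 4 * re4 t + im1 t]
  | 2, 4 => [:: 0; 0; re2 t; 0; 0; - re1 t + 4 * im4 t]
  | 2, 5 => [:: 0; 0; 0; - re3 t - im1 t; re1 t - im3 t; 0]
  | 3, 4 => [:: 0; 0; 3; 0; 0; 0]
  | 3, 5 => [:: 0; 0; 4 * re4 t + re3 t; 0; 0; - im2 t]
  | 4, 5 => [:: 0; 0; 4 * im4 t + im3 t; 0; 0; re2 t]
  | _, _ => [::]
  end.

Lemma below6 (Q : nat -> Prop) : Q 0%N -> Q 1%N -> Q 2%N -> Q 3%N -> Q 4%N -> Q 5%N ->
  forall k, (k < 6)%N -> Q k.
Proof. by move=> Q0 Q1 Q2 Q3 Q4 Q5 [|[|[|[|[|[|]]]]]]. Qed.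

Section Torsion.
Variable t : torsion.
Let P4 := (re4 t +i* im4 t)%C.

(* The forms xi_0, ..., xi_3 on the k-th frame vector, for torsion of Type I. *)
Definition xi0_at k := P4^* * theta_at k + P4 * (theta_at k)^*.
Definition xi1_at k := (2^-1)%:C%C * (- 3 * eta_at k + (re1 t +i* im1 t)%C * w3_at k
  + (re2 t +i* im2 t)%C * w6_at k).
Definition xi2_at k := (2^-1)%:C%C * (- ii * theta_at k - ii * (re2 t +i* im2 t)%C * w3_at k
  + (re3 t +i* im3 t)%C * w6_at k).
Definition xi3_at k := P4 * theta_at k - ii * (rer t +i* imr t)%C * (theta_at k)^*.

End Torsion.

Variables (B : nat -> nat -> nat -> R) (t : torsion) (u1 u2 : R) (Ral : nat -> R).
Let al k := (Ral k)%:C%C.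
Let X0 := xi0_at t.
Let X1 := xi1_at t.
Let X2 := xi2_at t.
Let X3 := xi3_at t.
Let tb k := (theta_at k)^*.
Let eb k := (eta_at k)^*.
Let X1b k := (X1 k)^*.
Let X2b k := (X2 k)^*.
Hypothesis gauge_eq : forall j k, (j < k < 6)%N -> (B j k 0 +i* B j k 1)%C =
  (u1 * unit_at 0 j + u2 * unit_at 1 j)%:C%C * eta_at k
   - (u1 * unit_at 0 k + u2 * unit_at 1 k)%:C%C * eta_at j.
Hypothesis eta_eq : forall j k, (j < k < 6)%N -> - (B j k 0 +i* B j k 1)%C =
  ii * wd al eta_at j k - 2 * ii * wd X1 w3_at j k + wd X0 theta_at j k + wd X3 tb j k
   + 2 * wd X2 w6_at j k + ii * (- wd eta_at w3_at j k + wd theta_at w6_at j k).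
Hypothesis w3_eq : forall j k, (j < k < 6)%N -> - (B j k 2)%:C%C =
  - (ii * wd X1b eta_at j k) + ii * wd X1 eb j k + wd X2b theta_at j k + wd X2 tb j k
   - 2 * wd X0 w6_at j k + ii / 2 * (wd eta_at eb j k - wd theta_at tb j k).
Hypothesis theta_eq : forall j k, (j < k < 6)%N -> - (B j k 3 +i* B j k 4)%C =
  - wd X0 eta_at j k - wd X3 eb j k - 2 * wd X2 w3_at j k + ii * wd al theta_at j k
   - 2 * ii * wd X1 w6_at j k + ii * (- wd w3_at theta_at j k + wd eta_at w6_at j k).
Hypothesis w6_eq : forall j k, (j < k < 6)%N -> - (B j k 5)%:C%C =
  - wd X2b eta_at j k - wd X2 eb j k + 2 * wd X0 w3_at j k - ii * wd X1b theta_at j k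
   + ii * wd X1 tb j k + ii / 2 * (wd tb eta_at j k - wd theta_at eb j k).

(** Comparing the structure equation of eta with the gauge condition determines
    alpha; the equations of omega^3, theta and omega^6 then give the remaining
    components of the brackets. *)
Lemma structure_table j k : (j < k < 6)%N -> forall l, (l < 6)%N ->
  B j k l = (half_table t u1 u2 j k)`_l.
Proof.
have split_eq (z w : C) : z = w -> complex.Re z = complex.Re w /\ complex.Im z = complex.Im w by move=> ->.
pose W (a b : nat -> R) j k := a j * b k - a k * b j.
pose e := unit_at; pose w a b := W (e a) (e b).
(* alpha - 2 omega^3 is the connection form of the surface. *)
pose psi k := Ral k - 2 * e 2%N k.
have eta_re j' k' : (j' < k' < 6)%N -> B j' k' 0 = W psi (e 1%N) j' k' /\ B j' k' 1 = - W psi (e 0%N) j' k'.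
  move=> jk; have := split_eq _ _ (eta_eq jk).
  rewrite /wd /tb /eb /X1b /X2b /al /X0 /X1 /X2 /X3 /xi0_at /xi1_at /xi2_at /xi3_at /eta_at /theta_at /w3_at /w6_at /W /psi /e /=.
  move: (Ral j') (Ral k') (B j' k' 0) (B j' k' 1) (B j' k' 2) (B j' k' 3) (B j' k' 4) (B j' k' 5).
  move: (unit_at 0 j') (unit_at 1 j') (unit_at 2 j') (unit_at 3 j') (unit_at 4 j') (unit_at 5 j').
  move: (unit_at 0 k') (unit_at 1 k') (unit_at 2 k') (unit_at 3 k') (unit_at 4 k') (unit_at 5 k').
  case: (t) => a1 b1 a2 b2 a3 b3 a b c d /=.
  move=> e1k e2k e3k e4k e5k e6k e1j e2j e3j e4j e5j e6j aj ak B0 B1 B2 B3 B4 B5 [E E'].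
  by split; apply: oppr_inj; rewrite ?E ?E'; field.
have w3_re j' k' : (j' < k' < 6)%N -> B j' k' 2 = 5 * w 0 1 j' k' - im1 t * w 0 2 j' k' - im2 t * w 0 5 j' k'
    + re1 t * w 1 2 j' k' + re2 t * w 1 5 j' k' - im2 t * w 2 3 j' k' + re2 t * w 2 4 j' k' + 3 * w 3 4 j' k'
    + (4 * re4 t + re3 t) * w 3 5 j' k' + (4 * im4 t + im3 t) * w 4 5 j' k'.
  move=> jk; rewrite /w; have := split_eq _ _ (w3_eq jk).
  rewrite /wd /tb /eb /X1b /X2b /al /X0 /X1 /X2 /X3 /xi0_at /xi1_at /xi2_at /xi3_at /eta_at /theta_at /w3_at /w6_at /W /psi /e /=.
  move: (Ral j') (Ral k') (B j' k' 0) (B j' k' 1) (B j' k' 2) (B j' k' 3) (B j' k' 4) (B j' k' 5).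
  move: (unit_at 0 j') (unit_at 1 j') (unit_at 2 j') (unit_at 3 j') (unit_at 4 j') (unit_at 5 j').
  move: (unit_at 0 k') (unit_at 1 k') (unit_at 2 k') (unit_at 3 k') (unit_at 4 k') (unit_at 5 k').
  case: (t) => a1 b1 a2 b2 a3 b3 a b c d /=.
  move=> e1k e2k e3k e4k e5k e6k e1j e2j e3j e4j e5j e6j aj ak B0 B1 B2 B3 B4 B5 [E E'].
  by apply: oppr_inj; rewrite E; field.
have theta_re j' k' : (j' < k' < 6)%N ->
    B j' k' 3 = (- 3 * re4 t - imr t) * w 0 3 j' k' + (rer t - im4 t) * (w 0 4 j' k' + w 1 3 j' k')
      + (imr t - re4 t) * w 1 4 j' k' + 4 * w 1 5 j' k' - 2 * w 2 4 j' k' - (re3 t + im1 t) * w 2 5 j' k'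
      + W Ral (e 4%N) j' k' /\
    B j' k' 4 = (rer t - im4 t) * w 0 3 j' k' + (imr t - re4 t) * (w 0 4 j' k' + w 1 3 j' k') - 4 * w 0 5 j' k'
      - (3 * im4 t + rer t) * w 1 4 j' k' + 2 * w 2 3 j' k' + (re1 t - im3 t) * w 2 5 j' k'
      - W Ral (e 3%N) j' k'.
  move=> jk; rewrite /w; have := split_eq _ _ (theta_eq jk).
  rewrite /wd /tb /eb /X1b /X2b /al /X0 /X1 /X2 /X3 /xi0_at /xi1_at /xi2_at /xi3_at /eta_at /theta_at /w3_at /w6_at /W /psi /e /=.
  move: (Ral j') (Ral k') (B j' k' 0) (B j' k' 1) (B j' k' 2) (B j' k' 3) (B j' k' 4) (B j' k' 5).
  move: (unit_at 0 j') (unit_at 1 j') (unit_at 2 j') (unit_at 3 j') (unit_at 4 j') (unit_at 5 j').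
  move: (unit_at 0 k') (unit_at 1 k') (unit_at 2 k') (unit_at 3 k') (unit_at 4 k') (unit_at 5 k').
  case: (t) => a1 b1 a2 b2 a3 b3 a b c d /=.
  move=> e1k e2k e3k e4k e5k e6k e1j e2j e3j e4j e5j e6j aj ak B0 B1 B2 B3 B4 B5 [E E'].
  by split; apply: oppr_inj; rewrite ?E ?E'; field.
have w6_re j' k' : (j' < k' < 6)%N -> B j' k' 5 = - im2 t * w 0 2 j' k' + 3 * w 0 4 j' k' - re3 t * w 0 5 j' k'
    + re2 t * w 1 2 j' k' - 3 * w 1 3 j' k' - im3 t * w 1 5 j' k' + (4 * re4 t + im1 t) * w 2 3 j' k'
    + (4 * im4 t - re1 t) * w 2 4 j' k' - im2 t * w 3 5 j' k' + re2 t * w 4 5 j' k'.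
  move=> jk; rewrite /w; have := split_eq _ _ (w6_eq jk).
  rewrite /wd /tb /eb /X1b /X2b /al /X0 /X1 /X2 /X3 /xi0_at /xi1_at /xi2_at /xi3_at /eta_at /theta_at /w3_at /w6_at /W /psi /e /=.
  move: (Ral j') (Ral k') (B j' k' 0) (B j' k' 1) (B j' k' 2) (B j' k' 3) (B j' k' 4) (B j' k' 5).
  move: (unit_at 0 j') (unit_at 1 j') (unit_at 2 j') (unit_at 3 j') (unit_at 4 j') (unit_at 5 j').
  move: (unit_at 0 k') (unit_at 1 k') (unit_at 2 k') (unit_at 3 k') (unit_at 4 k') (unit_at 5 k').
  case: (t) => a1 b1 a2 b2 a3 b3 a b c d /=.
  move=> e1k e2k e3k e4k e5k e6k e1j e2j e3j e4j e5j e6j aj ak B0 B1 B2 B3 B4 B5 [E E'].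
  by apply: oppr_inj; rewrite E; field.
have gauge_re j' k' : (j' < k' < 6)%N ->
    B j' k' 0 = - u2 * w 0 1 j' k' /\ B j' k' 1 = u1 * w 0 1 j' k'.
  move=> jk; have := split_eq _ _ (gauge_eq jk); rewrite /w /W /e /eta_at /= => - [-> ->].
  by split; ring.
have psiE m : (m < 6)%N -> Ral m = [:: - u2; u1; 2; 0; 0; 0]`_m.
  have H j' k' jk := conj (eta_re j' k' jk) (gauge_re j' k' jk).
  have K m' : (0 < m' < 6)%N -> psi m' * e 1%N 0%N - psi 0%N * e 1%N m' = u2 * w 0%N 1%N 0%N m' /\
      psi 0%N * e 0%N m' - psi m' * e 0%N 0%N = - u1 * w 0%N 1%N 0%N m'.
    by move=> /H[[E E1] [E' E1']]; move: E E1; rewrite E' E1' /W; lra.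
  move: m; apply: below6; [have := K 1%N isT|have := K 1%N isT|have := K 2%N isT|
    have := K 3%N isT|have := K 4%N isT|have := K 5%N isT];
    by rewrite /w /W /psi /e /unit_at /=; lra.
have all_re j' k' : (j' < k' < 6)%N -> forall l, (l < 6)%N -> B j' k' l = [:: - u2 * w 0 1 j' k'; u1 * w 0 1 j' k';
    5 * w 0 1 j' k' - im1 t * w 0 2 j' k' - im2 t * w 0 5 j' k'
    + re1 t * w 1 2 j' k' + re2 t * w 1 5 j' k' - im2 t * w 2 3 j' k' + re2 t * w 2 4 j' k' + 3 * w 3 4 j' k'
    + (4 * re4 t + re3 t) * w 3 5 j' k' + (4 * im4 t + im3 t) * w 4 5 j' k';
    (- 3 * re4 t - imr t) * w 0 3 j' k' + (rer t - im4 t) * (w 0 4 j' k' + w 1 3 j' k')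
      + (imr t - re4 t) * w 1 4 j' k' + 4 * w 1 5 j' k' - 2 * w 2 4 j' k' - (re3 t + im1 t) * w 2 5 j' k'
      + W Ral (e 4%N) j' k';
    (rer t - im4 t) * w 0 3 j' k' + (imr t - re4 t) * (w 0 4 j' k' + w 1 3 j' k') - 4 * w 0 5 j' k'
      - (3 * im4 t + rer t) * w 1 4 j' k' + 2 * w 2 3 j' k' + (re1 t - im3 t) * w 2 5 j' k'
      - W Ral (e 3%N) j' k';
    - im2 t * w 0 2 j' k' + 3 * w 0 4 j' k' - re3 t * w 0 5 j' k'
    + re2 t * w 1 2 j' k' - 3 * w 1 3 j' k' - im3 t * w 1 5 j' k' + (4 * re4 t + im1 t) * w 2 3 j' k'
    + (4 * im4 t - re1 t) * w 2 4 j' k' - im2 t * w 3 5 j' k' + re2 t * w 4 5 j' k']`_l.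
  move=> jk; apply: below6 => /=.
  - by case: (gauge_re _ _ jk).
  - by case: (gauge_re _ _ jk).
  - exact: w3_re.
  - by case: (theta_re _ _ jk).
  - by case: (theta_re _ _ jk).
  - exact: w6_re.
have R0 := psiE 0%N isT; have R1 := psiE 1%N isT; have R2 := psiE 2%N isT.
have R3 := psiE 3%N isT; have R4 := psiE 4%N isT; have R5 := psiE 5%N isT.
move=> jk l l6; rewrite all_re //.
move: R0 R1 R2 R3 R4 R5 jk; rewrite /w /W /e /=; move: (Ral) => A R0 R1 R2 R3 R4 R5.
clear - l6 R0 R1 R2 R3 R4 R5; case: t => a1 b1 a2 b2 a3 b3 a b c d.
move: j k => [|[|[|[|[|j]]]]] [|[|[|[|[|[|k]]]]]] //= _;
  move: l l6; apply: below6; rewrite /unit_at /= ?R0 ?R1 ?R2 ?R3 ?R4 ?R5; ring.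
Qed.
End StructureTable.

Section GaugeStructure.
Context {R : realType} {M : fspace R} {Om : dform M 2} {Up : dform M 3}.
Context {n : nat} {G : groupType} {CG : set (G -> R)} {act : G -> M -> M}.
Hypothesis hM : manifold 6 M.
Local Notation C := R[i].
Local Notation ii := (0 +i* 1)%C.
Local Notation S := (adapted CG act Om Up).
Local Notation P := (P_bundle CG act Om Up).
Variables (alpha xi0 xi1 xi2 xi3 : dform P 1).
Hypothesis real_alpha : real_form alpha.
Hypothesis hstr : structure_equations alpha xi0 xi1 xi2 xi3.
Variables (p1 p2 p3 p4 q1 q2 r : P -> C) (h1 h2 h3 h4 : P -> R).
Hypothesis htor : torsion_equations xi0 xi1 xi2 xi3 p1 p2 p3 p4 q1 q2 r h1 h2 h3 h4.
Hypothesis htypeI : typeI q1 q2 h1 h2 h3 h4.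

Variables (V : set M) (s : 'I_6 -> M -> tvec M).
Hypothesis sV : adapted_field (CG := CG) (act := act) (Om := Om) (Up := Up) V s.
Variables (Z : M -> C) (u : M -> R).
Hypothesis smZ : forall x, V x -> csmoothat x Z.
Hypothesis smu : forall x, V x -> smoothat x u.
Hypothesis dZ : forall x v, V x -> tangent x v ->
  cder v Z = (expR (u x))%:C%C * eta_of (s^~ x) v.
Hypothesis u_inv : forall x (k : 'I_6), V x -> (1 < k)%N -> s k x u = 0.

Let oV : fopen V. Proof. by case: sV. Qed.
Let ss i : smooth_field V (s i). Proof. by case: sV. Qed.
Let Ss x : V x -> S x (s^~ x). Proof. by case: sV => _ _; apply. Qed.
Let fs x : V x -> is_frame x (s^~ x). Proof. by move=> /Ss[/SU3_is_frame]. Qed.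
Let ts x i : V x -> tangent x (s i x). Proof. by move=> /fs[]. Qed.

Definition torsion_at (p : P) := Torsion (complex.Re (p1 p)) (complex.Im (p1 p))
  (complex.Re (p2 p)) (complex.Im (p2 p)) (complex.Re (p3 p)) (complex.Im (p3 p))
  (complex.Re (p4 p)) (complex.Im (p4 p)) (complex.Re (r p)) (complex.Im (r p)).

Lemma pr2_0 T (a b : T) : pr2 a b ord0 = a. Proof. by []. Qed.
Lemma pr2_1 T (a b : T) : pr2 a b ord_max = b. Proof. by []. Qed.

Definition du1 x : R := s (inord 0) x u.
Definition du2 x : R := s (inord 1) x u.

Let unitE (m : nat) (k : 'I_6) : (m < 6)%N ->
  (delta_mx 0 k : 'rV[R]_6) 0 (inord m) = unit_at m k.
Proof.
move=> m6; rewrite mxE eqxx /unit_at -val_eqE /= inordK // eq_sym.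
by case: ifP.
Qed.

Let exE : (lshift 3 (ord0 : 'I_3) = inord 0) * (lshift 3 (lift ord0 ord0 : 'I_3) = inord 1).
Proof. by split; apply: val_inj; rewrite /= inordK. Qed.

Lemma eta_of_frame x k : V x -> eta_of (s^~ x) (s k x) = eta_at k.
Proof. by move=> Vx; rewrite /eta_of (coordinates_frame _ (fs Vx)) !exE !unitE. Qed.

Lemma u_derivative x (k : 'I_6) : V x -> s k x u = du1 x * unit_at 0 k + du2 x * unit_at 1 k.
Proof.
move=> Vx; rewrite /du1 /du2; have [->|->|k2] : [\/ k = inord 0, k = inord 1 | (1 < k)%N].
- case: k => [[|[|k]] k6]; [apply: Or31|apply: Or32|exact: Or33]; by apply: val_inj; rewrite /= inordK.
- by rewrite /unit_at inordK //= mulr1 mulr0 addr0.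
- by rewrite /unit_at inordK //= mulr1 mulr0 add0r.
- by rewrite (u_inv Vx k2) /unit_at !gtn_eqF ?mulr0 ?addr0 //; apply: ltn_trans k2.
Qed.

(** Where the derivatives of f along the frame are e^u times those of a
    coordinate, the bracket of two of its vectors can be read off from u. *)
Lemma gauge_bracket x (f : M -> R) m (j k : 'I_6) : (m < 6)%N -> V x -> (forall y, V y -> smoothat y f) ->
  (forall y (k : 'I_6), V y -> s k y f = expR (u y) * unit_at m k) ->
  structure_fun s j k (inord m) x = s j x u * unit_at m k - s k x u * unit_at m j.
Proof.
move=> m6 Vx smf df; have eu0 : expR (u x) != 0 by rewrite gt_eqF ?expR_gt0.
apply: (mulfI eu0).
have := structureE hM oV ss fs j k Vx (smf x Vx).
have second a b : s a x (fun y => s b y f) = expR (u x) * (s a x u * unit_at m b).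
  have E : nearby x [set y | s b y f = unit_at m b * expR (u y)].
    by apply: nearby_mono (oV Vx) => y Vy /=; rewrite df // mulrC.
  rewrite (tangent_germ (ts a Vx) E) (tangentZ _ (ts a Vx)); last exact/smoothat_expR/smu.
  by rewrite (tan_expR (ts a Vx) (smu Vx)); ring.
rewrite !second -mulrBr => ->; rewrite (bigD1 (inord m)) //= big1 => [|l lm]; last first.
  rewrite df // /unit_at (_ : (val l == m) = false) ?mulr0 //.
  by apply: contraNF lm => /eqP <-; rewrite inord_val.
by rewrite df // /unit_at inordK // eqxx mulr1 addr0 mulrC.
Qed.

Lemma gauge_eq x (j k : 'I_6) : V x ->
  (structure_fun s j k (inord 0) x +i* structure_fun s j k (inord 1) x)%C =
  (du1 x * unit_at 0 j + du2 x * unit_at 1 j)%:C%C * eta_at k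
   - (du1 x * unit_at 0 k + du2 x * unit_at 1 k)%:C%C * eta_at j.
Proof.
move=> Vx; have dZk y (a : 'I_6) : V y -> s a y (fun y => complex.Re (Z y)) = expR (u y) * unit_at 0 a /\
    s a y (fun y => complex.Im (Z y)) = expR (u y) * unit_at 1 a.
  move=> Vy; have := dZ Vy (ts a Vy); rewrite eta_of_frame // /cder => E.
  split; [have := congr1 (@complex.Re R) E|have := congr1 (@complex.Im R) E]; rewrite /= => ->; ring.
rewrite -!u_derivative // (@gauge_bracket x (fun y => complex.Re (Z y)) 0) //; first last.
- by move=> y a Vy; case: (dZk y a Vy).
- by move=> y /smZ[].
rewrite (@gauge_bracket x (fun y => complex.Im (Z y)) 1) //; first last.
- by move=> y a Vy; case: (dZk y a Vy).
- by move=> y /smZ[].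
by apply/eqP; rewrite eq_complex /=; apply/andP; split; apply/eqP; ring.
Qed.

Lemma halve (z w : C) : 2 * z = w -> z = (2^-1)%:C%C * w.
Proof.
case: z w => [a b] [c d] E; have E1 := congr1 (@complex.Re R) E; have E2 := congr1 (@complex.Im R) E.
move: E1 E2; rewrite /= => E1 E2.
by apply/eqP; rewrite eq_complex /=; apply/andP; split; apply/eqP; lra.
Qed.

(** The structure equations hold on P; the lifts of the frame carry them to V, and
    the Type I condition fixes the forms xi_i. *)
Lemma frame_brackets x p (j k l : 'I_6) : V x -> fbase p = x -> fframe p = s^~ x -> (j < k)%N ->
  structure_fun s j k l x = (half_table (torsion_at p) (du1 x) (du2 x) j k)`_l.
Proof.
move=> Vx bp fp jk; have [Zl [tZ tautZ transport]] := structure_transport hM sV Vx bp fp.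
pose B a b c := structure_fun s (inord a) (inord b) (inord c) x.
have -> : structure_fun s j k l x = B j k l by rewrite /B !inord_val.
have tauto m a : (0 < m < 7)%N -> taut p (Zl a) 0 (o6 m) = unit_at m.-1 a.
  by case: m => // m m6; rewrite tautZ unitE.
have formE : [/\ forall (p' : P) v, Defs.eta p' (fun=> v) = (taut p' v 0 (o6 1) +i* taut p' v 0 (o6 2))%C &
    forall (p' : P) v, Defs.theta p' (fun=> v) = (taut p' v 0 (o6 4) +i* taut p' v 0 (o6 5))%C].
  by split=> p' v; rewrite /Defs.eta /Defs.theta /omega /form1 /form_mul ?fctE /=;
    apply/eqP; rewrite eq_complex /=; apply/andP; split; apply/eqP; ring.
have [etaE thetaE] := formE.
have val_at a : (a < 6)%N -> [/\ Defs.eta p (fun=> Zl (inord a)) = eta_at a,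
    Defs.theta p (fun=> Zl (inord a)) = theta_at a, omega S 3 p (fun=> Zl (inord a)) = w3_at a
    & omega S 6 p (fun=> Zl (inord a)) = w6_at a].
  by move=> a6; rewrite etaE thetaE /omega /form1 !tauto // inordK.
have xi_at a : (a < 6)%N -> [/\ xi0 p (fun=> Zl (inord a)) = xi0_at (torsion_at p) a,
    xi1 p (fun=> Zl (inord a)) = xi1_at (torsion_at p) a, xi2 p (fun=> Zl (inord a)) = xi2_at (torsion_at p) a
    & xi3 p (fun=> Zl (inord a)) = xi3_at (torsion_at p) a].
  move=> a6; have [Ee Et E3 E6] := val_at a a6.
  have [q1E q2E h1E h2E] := htypeI p.
  have h13 : h1 p = - 3 by have := congr1 (@complex.Re R) h1E; rewrite /=; lra.
  have h30 : h3 p = 0 by have := congr1 (@complex.Im R) h1E.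
  have h20 : h2 p = 0 by have := congr1 (@complex.Re R) h2E.
  have h40 : h4 p = 0 by have := congr1 (@complex.Im R) h2E.
  have c2 (w : C) : (complex.Re w +i* complex.Im w)%C = w by case: w.
  have C3 : (- 3)%:C%C = - 3 :> C by rewrite rmorphN rmorph_nat.
  have tv (i : 'I_1) : tangent p ((fun=> Zl (inord a)) i) by [].
  split.
  - rewrite (tor_xi0 htor tv) /form_mul /fbar /rfun ?fctE /form_mul /fbar Et E3 E6 h20 h30 /xi0_at /= c2.
    by rewrite !mul0r subr0 addr0.
  - apply: halve; have := tor_xi1 htor tv.
    rewrite /form_mul /fbar /rfun ?fctE /form_mul /fbar Et Ee E3 E6 h13 h20 q1E /= !c2 => ->.
    by rewrite C3 !mul0r mulr0 subr0 addr0.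
  - apply: halve; have := tor_xi2 htor tv.
    rewrite /form_mul /fbar /rfun ?fctE /form_mul /fbar Et Ee E3 E6 h40 h30 q2E /= !c2 => ->.
    by rewrite !mul0r mulr0 sub0r add0r addr0 mulrA.
  - rewrite (tor_xi3 htor tv) /form_mul /fbar /rfun ?fctE /form_mul /fbar Et E3 E6 q1E q2E /xi3_at /= !c2.
    by rewrite !mul0r mulr0 subr0 addr0 mulrA.
pose Ral a := complex.Re (alpha p (fun=> Zl (inord a))).
have al_at a : alpha p (fun=> Zl (inord a)) = (Ral a)%:C%C.
  rewrite /Ral; have := real_alpha (fun i : 'I_1 => tZ (inord a)).
  by case: (alpha _ _) => ? ? /= ->.
have o6E1 m : o6 m.+1 = inord m by [].
have inP a b : (a < b < 6)%N -> [/\ (a < 6)%N & (b < 6)%N] by move=> /andP[ab b6]; split=> //; apply: ltn_trans b6.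
have jk6 : (j < k < 6)%N by rewrite jk ltn_ord.
apply: (@structure_table R B (torsion_at p) (du1 x) (du2 x) Ral) => // a b ab; have [a6 b6] := inP _ _ ab;
  have [Eea Eta E3a E6a] := val_at a a6; have [Eeb Etb E3b E6b] := val_at b b6;
  have [x0a x1a x2a x3a] := xi_at a a6; have [x0b x1b x2b x3b] := xi_at b b6.
- by have := gauge_eq (inord a) (inord b) Vx; rewrite !inordK.
- have := transport _ _ (fun c => (c 0 (o6 1) +i* c 0 (o6 2))%C) (str_eta hstr) etaE (inord a) (inord b).
  rewrite !fctE /form_mul ?fctE !wedge11 !pr2_0 !pr2_1 /fbar ?Eea ?Eeb ?Eta ?Etb ?E3a ?E3b ?E6a ?E6b
    ?x0a ?x0b ?x1a ?x1b ?x2a ?x2b ?x3a ?x3b ?al_at.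
  by rewrite /wd => <-.
- have := transport _ _ (fun c => (c 0 (o6 3))%:C%C) (str_omega3 hstr) (fun _ _ => erefl) (inord a) (inord b).
  rewrite !fctE /form_mul ?fctE !wedge11 !pr2_0 !pr2_1 /fbar ?Eea ?Eeb ?Eta ?Etb ?E3a ?E3b ?E6a ?E6b
    ?x0a ?x0b ?x1a ?x1b ?x2a ?x2b ?x3a ?x3b ?al_at.
  by rewrite /wd => <-.
- have := transport _ _ (fun c => (c 0 (o6 4) +i* c 0 (o6 5))%C) (str_theta hstr) thetaE (inord a) (inord b).
  rewrite !fctE /form_mul ?fctE !wedge11 !pr2_0 !pr2_1 /fbar ?Eea ?Eeb ?Eta ?Etb ?E3a ?E3b ?E6a ?E6b
    ?x0a ?x0b ?x1a ?x1b ?x2a ?x2b ?x3a ?x3b ?al_at.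
  by rewrite /wd => <-.
- have := transport _ _ (fun c => (c 0 (o6 6))%:C%C) (str_omega6 hstr) (fun _ _ => erefl) (inord a) (inord b).
  rewrite !fctE /form_mul ?fctE !wedge11 !pr2_0 !pr2_1 /fbar ?Eea ?Eeb ?Eta ?Etb ?E3a ?E3b ?E6a ?E6b
    ?x0a ?x0b ?x1a ?x1b ?x2a ?x2b ?x3a ?x3b ?al_at.
  by rewrite /wd => <-.
Qed.

End GaugeStructure.

(** * Consequences of the Jacobi identity *)

Section JacobiConsequences.
Context {R : realType} {M : fspace R}.
Hypothesis hM : manifold 6 M.
Variables (V : set M) (s : 'I_6 -> M -> tvec M).
Hypothesis oV : fopen V.
Hypothesis ss : forall i, smooth_field V (s i).
Hypothesis fs : forall x, V x -> is_frame x (s^~ x).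
Variables (T : M -> @torsion R) (u : M -> R).
Let a x := re4 (T x).
Let b x := im4 (T x).
Let c x := rer (T x).
Let d x := imr (T x).
Local Notation e k := (s (inord k)).
Let u1 x := e 0 x u.
Let u2 x := e 1 x u.
Hypothesis table : forall x (j k l : 'I_6), V x -> (j < k)%N ->
  structure_fun s j k l x = (half_table (T x) (u1 x) (u2 x) j k)`_l.
Hypothesis smooth_T : forall x, V x ->
  [/\ smoothat x a, smoothat x b, smoothat x c & smoothat x d].
Hypothesis smooth_u : forall x, V x -> smoothat x u.
Hypothesis inv_T : forall x (k : 'I_6), V x -> (1 < k)%N ->
  [/\ s k x a = 0, s k x b = 0, s k x c = 0 & s k x d = 0].
Hypothesis inv_u : forall x (k : 'I_6), V x -> (1 < k)%N -> s k x u = 0.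

Let ts x i : V x -> tangent x (s i x). Proof. by move=> /fs[]. Qed.

Definition full_table t (v1 v2 : R) j k l :=
  if (j < k)%N then (half_table t v1 v2 j k)`_l else - (half_table t v1 v2 k j)`_l.

Lemma full_tableE x j k l : V x -> (j < 6)%N -> (k < 6)%N -> (l < 6)%N ->
  structure_fun s (inord j) (inord k) (inord l) x = full_table (T x) (u1 x) (u2 x) j k l.
Proof.
move=> Vx j6 k6 l6; rewrite /full_table; case: (ltngtP j k) => [jk|kj|->].
- by rewrite table // !inordK.
- by rewrite (structure_skew hM oV ss fs) // table // !inordK.
have := structure_skew hM oV ss fs (inord k) (inord k) (inord l) Vx.
rewrite (_ : half_table _ _ _ k k = [::]) ?nth_nil; last by case: (k) => [|[|[|[|[|?]]]]].
by lra.
Qed.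

Let sum6 (F : 'I_6 -> R) : \sum_l F l = F (inord 0) + F (inord 1) + F (inord 2) + F (inord 3) + F (inord 4) + F (inord 5).
Proof.
rewrite !big_ord_recl big_ord0 addr0 !addrA; congr (F _ + F _ + F _ + F _ + F _ + F _);
  by apply: val_inj; rewrite /= inordK.
Qed.

Let half_jacobi t v1 v2 i j k m : R :=
  let B := full_table t v1 v2 in
  B j k 0%N * B i 0%N m + B j k 1%N * B i 1%N m + B j k 2%N * B i 2%N m
  + B j k 3%N * B i 3%N m + B j k 4%N * B i 4%N m + B j k 5%N * B i 5%N m.

Lemma table_jacobi x i j k m : V x -> (i < 6)%N -> (j < 6)%N -> (k < 6)%N -> (m < 6)%N ->
    e i x (fun y => full_table (T y) (u1 y) (u2 y) j k m)
  + e j x (fun y => full_table (T y) (u1 y) (u2 y) k i m)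
  + e k x (fun y => full_table (T y) (u1 y) (u2 y) i j m)
  + half_jacobi (T x) (u1 x) (u2 x) i j k m + half_jacobi (T x) (u1 x) (u2 x) j k i m
  + half_jacobi (T x) (u1 x) (u2 x) k i j m = 0.
Proof.
move=> Vx i6 j6 k6 m6.
have D a' j' k' : (j' < 6)%N -> (k' < 6)%N -> e a' x (structure_fun s (inord j') (inord k') (inord m)) =
    e a' x (fun y => full_table (T y) (u1 y) (u2 y) j' k' m).
  move=> j6' k6'; apply: (tangent_germ (ts _ Vx)); apply: nearby_mono (oV Vx) => y Vy /=.
  exact: full_tableE.
have := jacobi hM oV ss fs (inord i) (inord j) (inord k) (inord m) Vx.
rewrite !D // !sum6 !full_tableE //= => E; rewrite -[RHS]E /half_jacobi; ring.
Qed.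

(* For k > 1, the bracket of s_k with s_0 or s_1 has no horizontal component. *)
Let inv_du x (k : 'I_6) : V x -> (1 < k)%N -> s k x u1 = 0 /\ s k x u2 = 0.
Proof.
move=> Vx k1; have H j : (j < 2)%N -> s k x (fun y => e j y u) = 0.
  move=> j2; have := structureE hM oV ss fs k (inord j) Vx (smooth_u Vx).
  have -> : e j x (fun y => s k y u) = 0.
    rewrite -(tan_cst 0 (ts (inord j) Vx)); apply: (tangent_germ (ts _ Vx)).
    by apply: nearby_mono (oV Vx) => y Vy /=; apply: inv_u.
  rewrite subr0 => ->; rewrite big1 // => l _.
  have [l1|l1] := leqP l 1; last by rewrite inv_u ?mulr0.
  rewrite -[k]inord_val -[l]inord_val full_tableE ?ltn_ord //; last exact: ltn_trans j2 _.
  have -> : full_table (T x) (u1 x) (u2 x) k j l = 0; last by rewrite mul0r.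
  rewrite /full_table ltnNge (ltnW (leq_trans j2 k1)) /=.
  move: j2 l1 k1 (ltn_ord k); case: (val l) => [|[|]] //; case: j => [|[|]] //;
    case: (val k) => [|[|[|[|[|[|]]]]]] //= *; rewrite oppr0 //.
by split; apply: H.
Qed.

Lemma tan_affine x v (f1 f2 f3 F : M -> R) (k0 k1 k2 k3 : R) : tangent x v ->
  smoothat x f1 -> smoothat x f2 -> smoothat x f3 ->
  nearby x [set y | F y = k0 + k1 * f1 y + k2 * f2 y + k3 * f3 y] ->
  v F = k1 * v f1 + k2 * v f2 + k3 * v f3.
Proof.
move=> tv s1 s2 s3 E; rewrite (tangent_germ tv E).
have sk k f : smoothat x f -> smoothat x (fun y => k * f y).
  by move=> sf; apply: smoothatM => //; apply: smoothat_cst.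
have sc := smoothat_cst x k0.
rewrite !(tangentD tv) ?(tan_cst k0 tv) ?(tangentZ _ tv) ?add0r //; repeat first [exact: sk|apply: smoothatD => //].
Qed.



(** The components of the Jacobi identity without derivatives express the torsion
    by p_4 and r alone: p_2 = 0, p_1 = - 4 i p_4 and p_3 = 4 p_4. *)
Lemma torsion_reduced x : V x ->
  T x = Torsion (4 * b x) (- 4 * a x) 0 0 (4 * a x) (4 * b x) (a x) (b x) (c x) (d x).
Proof.
move=> Vx; have tx k := ts k Vx.
have [sa sb sc sd] := smooth_T Vx.
have e1x k : (1 < k < 6)%N -> [/\ e k x a = 0, e k x b = 0, e k x c = 0 & e k x d = 0].
  by move=> /andP[k1 k6]; apply: inv_T => //; rewrite inordK.
have e1u k : (1 < k < 6)%N -> e k x u1 = 0 /\ e k x u2 = 0.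
  by move=> /andP[k1 k6]; apply: inv_du => //; rewrite inordK.
have [_ du2_2] := e1u 2%N isT; have [a2 b2 c2 d2] := e1x 2%N isT.
have smu2 : smoothat x u2 by apply: (smooth_field_at oV (ss _) Vx (smooth_u Vx)).
have jac i j k m i6 j6 k6 m6 := @table_jacobi x i j k m Vx i6 j6 k6 m6.
have D0 k (F : M -> R) r0 : (forall y, F y = r0) -> e k x F = 0.
  by move=> E; rewrite (_ : F = fun=> r0) ?(tan_cst _ (tx _)) //; apply/funext.
(* A1, A2 concern p_2; A3, A4 concern p_1; A5, A6 concern p_3. *)
have A1 := jac 0%N 1%N 3%N 2%N isT isT isT isT.
have A2 := jac 0%N 1%N 4%N 2%N isT isT isT isT.
have A3 := jac 0%N 3%N 2%N 4%N isT isT isT isT.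
have A4 := jac 0%N 4%N 2%N 4%N isT isT isT isT.
have A5 := jac 0%N 3%N 4%N 2%N isT isT isT isT.
have A6 := jac 1%N 3%N 4%N 2%N isT isT isT isT.
have E3 : e 2 x (fun y => full_table (T y) (u1 y) (u2 y) 0 3 4) = 0.
  rewrite (@tan_affine x _ b c u2 _ 0 (-1) 1 1) //; first by rewrite b2 c2 du2_2; ring.
  by apply: nearbyT => y; rewrite /full_table /= /b /c; ring.
have E4 : e 2 x (fun y => full_table (T y) (u1 y) (u2 y) 0 4 4) = 0.
  rewrite (@tan_affine x _ a d u2 _ 0 (-1) 1 0) //; first by rewrite a2 d2; ring.
  by apply: nearbyT => y; rewrite /full_table /= /a /d; ring.
have const k j' k' m' r0 : (forall t v1 v2, full_table t v1 v2 j' k' m' = r0) ->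
    e k x (fun y => full_table (T y) (u1 y) (u2 y) j' k' m') = 0.
  by move=> E; apply: (D0 _ _ r0) => y.
rewrite (const 0%N _ _ _ 0) ?(const 1%N _ _ _ 0) ?(const 3%N _ _ _ 5) // in A1;
  try by move=> *; rewrite /full_table /= ?oppr0.
rewrite (const 0%N _ _ _ 0) ?(const 1%N _ _ _ 0) ?(const 4%N _ _ _ 5) // in A2;
  try by move=> *; rewrite /full_table /= ?oppr0.
rewrite E3 (const 0%N _ _ _ 0) ?(const 3%N _ _ _ 0) // in A3;
  try by move=> *; rewrite /full_table /= ?oppr0.
rewrite E4 (const 0%N _ _ _ 0) ?(const 4%N _ _ _ 0) // in A4;
  try by move=> *; rewrite /full_table /= ?oppr0.
rewrite (const 0%N _ _ _ 3) ?(const 3%N _ _ _ 0) ?(const 4%N _ _ _ 0) // in A5;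
  try by move=> *; rewrite /full_table /= ?oppr0.
rewrite (const 1%N _ _ _ 3) ?(const 3%N _ _ _ 0) ?(const 4%N _ _ _ 0) // in A6;
  try by move=> *; rewrite /full_table /= ?oppr0.
clear - A1 A2 A3 A4 A5 A6; move: A1 A2 A3 A4 A5 A6.
rewrite /half_jacobi /full_table /a /b /c /d.
move: (u1 x) (u2 x); case: (T x) => a1 b1 a2 b2 a3 b3 a4 b4 c0 d0 v1 v2 /= A1 A2 A3 A4 A5 A6.
have b20 : b2 = 0 by lra.
have a20 : a2 = 0 by lra.
by congr Torsion; lra.
Qed.

(** The remaining components of the Jacobi identity. With p_4 = a + i b and
    r = c + i d, these are the eta-components of d p_4 and d r, and the equation
    for the curvature of the surface. *)
Lemma torsion_derivatives x : V x ->
  [/\ e 0 x a + e 1 x b = a x * u1 x + b x * u2 x - 12 * (a x ^+ 2 + b x ^+ 2) - 3,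
      e 0 x b - e 1 x a = b x * u1 x - a x * u2 x,
      e 0 x c + e 1 x d = 20 * (a x * b x) - 2 * (a x * c x + b x * d x) + 3 * (c x * u1 x + d x * u2 x),
      e 0 x d - e 1 x c = - 10 * (a x ^+ 2 - b x ^+ 2) - 2 * (a x * d x - b x * c x) + 3 * (d x * u1 x - c x * u2 x) &
      e 0 x u1 + e 1 x u2 - u1 x ^+ 2 - u2 x ^+ 2 = 2 * (6 + c x ^+ 2 + d x ^+ 2 - a x ^+ 2 - b x ^+ 2)].
Proof.
move=> Vx; have tx k := ts k Vx.
have [sa sb sc sd] := smooth_T Vx.
have smu1 : smoothat x u1 by apply: (smooth_field_at oV (ss _) Vx (smooth_u Vx)).
have smu2 : smoothat x u2 by apply: (smooth_field_at oV (ss _) Vx (smooth_u Vx)).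
have jac i j k m i6 j6 k6 m6 := @table_jacobi x i j k m Vx i6 j6 k6 m6.
pose t1 (v1 v2 v3 v4 : R) := @Torsion R (4 * v2) (- 4 * v1) 0 0 (4 * v1) (4 * v2) v1 v2 v3 v4.
have affine k j' k' m' f1 f2 f3 k0 k1 k2 k3 : smoothat x f1 -> smoothat x f2 -> smoothat x f3 ->
    (forall y, full_table (t1 (a y) (b y) (c y) (d y)) (u1 y) (u2 y) j' k' m' = k0 + k1 * f1 y + k2 * f2 y + k3 * f3 y) ->
    e k x (fun y => full_table (T y) (u1 y) (u2 y) j' k' m') = k1 * e k x f1 + k2 * e k x f2 + k3 * e k x f3.
  move=> s1 s2 s3 E; rewrite (@tan_affine x _ f1 f2 f3 _ k0 k1 k2 k3) //.
  by apply: nearby_mono (oV Vx) => y Vy /=; rewrite (torsion_reduced Vy) -E.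
(* A1 to A4 concern p_4, A5 to A8 concern r and the curvature. *)
have A1 := jac 0%N 3%N 5%N 2%N isT isT isT isT.
rewrite (affine 0%N _ _ _ a b c 0 8 0 0) ?(affine 3%N _ _ _ a b c 0 0 0 0) ?(affine 5%N _ _ _ a b c 0 0 0 0) // in A1;
  try by move=> y; rewrite /full_table /=; ring.
have A2 := jac 0%N 4%N 5%N 2%N isT isT isT isT.
rewrite (affine 0%N _ _ _ a b c 0 0 8 0) ?(affine 4%N _ _ _ a b c 0 0 0 0) ?(affine 5%N _ _ _ a b c 0 0 0 0) // in A2;
  try by move=> y; rewrite /full_table /=; ring.
have A3 := jac 1%N 3%N 5%N 2%N isT isT isT isT.
rewrite (affine 1%N _ _ _ a b c 0 8 0 0) ?(affine 3%N _ _ _ a b c 0 0 0 0) ?(affine 5%N _ _ _ a b c 0 0 0 0) // in A3;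
  try by move=> y; rewrite /full_table /=; ring.
have A4 := jac 1%N 4%N 5%N 2%N isT isT isT isT.
rewrite (affine 1%N _ _ _ a b c 0 0 8 0) ?(affine 4%N _ _ _ a b c 0 0 0 0) ?(affine 5%N _ _ _ a b c 0 0 0 0) // in A4;
  try by move=> y; rewrite /full_table /=; ring.
have A5 := jac 0%N 1%N 3%N 3%N isT isT isT isT.
rewrite (affine 0%N _ _ _ a b c 0 0 (-1) 1) ?(affine 1%N _ _ _ a d c 0 3 1 0) ?(affine 3%N _ _ _ a b c 0 0 0 0) // in A5;
  try by move=> y; rewrite /full_table /=; ring.
have A6 := jac 0%N 1%N 3%N 4%N isT isT isT isT.
rewrite (affine 0%N _ _ _ a d u1 0 (-1) 1 (-1)) ?(affine 1%N _ _ _ b c u2 0 1 (-1) (-1)) ?(affine 3%N _ _ _ a b c 0 0 0 0) // in A6;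
  try by move=> y; rewrite /full_table /=; ring.
have A7 := jac 0%N 1%N 4%N 3%N isT isT isT isT.
rewrite (affine 0%N _ _ _ a d u1 0 (-1) 1 1) ?(affine 1%N _ _ _ b c u2 0 1 (-1) 1) ?(affine 4%N _ _ _ a b c 0 0 0 0) // in A7;
  try by move=> y; rewrite /full_table /=; ring.
have A8 := jac 0%N 1%N 4%N 4%N isT isT isT isT.
rewrite (affine 0%N _ _ _ b c a 0 (-3) (-1) 0) ?(affine 1%N _ _ _ a d c 0 1 (-1) 0) ?(affine 4%N _ _ _ a b c 0 0 0 0) // in A8;
  try by move=> y; rewrite /full_table /=; ring.
move: A1 A2 A3 A4 A5 A6 A7 A8; rewrite (torsion_reduced Vx).
move: (a x) (b x) (c x) (d x) (u1 x) (u2 x) (e 0 x a) (e 0 x b) (e 0 x c) (e 0 x d) (e 0 x u1) (e 0 x u2)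
  (e 1 x a) (e 1 x b) (e 1 x c) (e 1 x d) (e 1 x u1) (e 1 x u2) (e 3 x a) (e 3 x b) (e 3 x c)
  (e 4 x a) (e 4 x b) (e 4 x c) (e 5 x a) (e 5 x b) (e 5 x c) => ax bx cx dx v1 v2
  a0 b0 c0 d0 u10 u20 a1 b1 c1 d1 u11 u21 a3 b3 c3 a4 b4 c4 a5 b5 c5.
clear; rewrite /half_jacobi /full_table /=.
move=> A1 A2 A3 A4 A5 A6 A7 A8.
by split; lra.
Qed.

End JacobiConsequences.

(** * The Laplacian in a holomorphic coordinate *)

Section ConjugateDifferential.
Context {R : realType} {X : fspace R} (U : set X) (c : 'I_2 -> X -> R).
Hypothesis cU : chart U c.
Variable u : X -> R.
Hypothesis smu : forall y, U y -> smoothat y u.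
Local Notation C := R[i].
Implicit Types (x y : X).

Definition chart_d (i : 'I_2) y : R := coordvec c y i u.
Definition chart_laplacian y : R :=
  coordvec c y ord0 (chart_d ord0) + coordvec c y ord_max (chart_d ord_max).
(** With z = x + i y the Hodge dual of du is u_x dy - u_y dx. *)
Definition conj_d : dform X 1 :=
  form1 (fun y v => (chart_d ord0 y * v (c ord_max) - chart_d ord_max y * v (c ord0))%:C%C).
Definition chart_area : dform X 2 := fun y v =>
  (chart_laplacian y * (v ord0 (c ord0) * v ord_max (c ord_max)
                        - v ord0 (c ord_max) * v ord_max (c ord0)))%:C%C.

Let oU : fopen U. Proof. exact: chart_fopen cU. Qed.
Let smc i y : U y -> smoothat y (c i). Proof. exact: (chart_smoothat cU). Qed.

Lemma chart_d_smooth i y : U y -> smoothat y (chart_d i).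
Proof. by move=> Uy; apply: (smooth_field_at oU (coordvec_field cU i) Uy); apply: smu. Qed.

Lemma chart_d_decomp y (v : tvec X) f : U y -> tangent y v ->
  v f = v (c ord0) * coordvec c y ord0 f + v (c ord_max) * coordvec c y ord_max f.
Proof.
move=> Uy tv; rewrite {1}(coordvec_decomp cU Uy tv) /lincomb big_ord_recl big_ord1 !mxE.
by rewrite (_ : lift ord0 ord0 = ord_max) //; apply: val_inj.
Qed.

Lemma chart_laplacian_smooth y : U y -> smoothat y chart_laplacian.
Proof.
move=> Uy; apply: smoothatD; apply: (smooth_field_at oU (coordvec_field cU _) Uy);
  exact: chart_d_smooth.
Qed.

Lemma csmoothat_real x (f : X -> R) : smoothat x f -> csmoothat x (fun y => (f y)%:C%C).
Proof. by move=> sf; split=> //=; apply: smoothat_cst. Qed.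

Lemma conj_d_form : is_form U conj_d.
Proof.
split.
- move=> x v i a t Ux tv tt; rewrite /conj_d /form1 /subst_at (ord1 i) /=.
  move: (chart_d ord0 x) (chart_d ord_max x) => A B.
  by apply/eqP; rewrite eq_complex /=; apply/andP; split; apply/eqP; ring.
- by move=> x v i j _ _; rewrite (ord1 i) (ord1 j).
- move=> V Z oV VU sZ x Vx; have Ux := VU x Vx; apply: csmoothat_real.
  by apply: smoothatB; apply: smoothatM; try exact: chart_d_smooth;
    apply: (smooth_field_at oV (sZ _) Vx); apply: smc.
Qed.

Lemma chart_area_form : is_form U chart_area.
Proof.
split.
- move=> x v i a t Ux tv tt; rewrite /chart_area /subst_at.
  have i2 : i = ord0 \/ i = ord_max by case: i => [[|[|]] //] ?; [left|right]; apply: val_inj.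
  by case: i2 => ->; rewrite /=; apply/eqP; rewrite eq_complex /=; apply/andP; split; apply/eqP; ring.
- move=> x v i j _ _ ij vij; have E : v ord0 = v ord_max.
    move: ij vij; case: (unliftP ord0 i) => [i'|] ->; case: (unliftP ord0 j) => [j'|] -> //;
      rewrite ?(ord1 i') ?(ord1 j') ?eqxx // (_ : lift ord0 ord0 = ord_max) //; exact: val_inj.
  by rewrite /chart_area E [X in _ - X]mulrC subrr mulr0.
- move=> V Z oV VU sZ x Vx; have Ux := VU x Vx; apply: csmoothat_real.
  apply: smoothatM; first exact: chart_laplacian_smooth.
  by apply: smoothatB; apply: smoothatM; apply: (smooth_field_at oV (sZ _) Vx); apply: smc.
Qed.

(** This is d(p0 dy - p1 dx) = (d p0/dx + d p1/dy) dx /\ dy. The terms in which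
    the components of the two fields are differentiated cancel against the bracket. *)
Lemma d_flux (p0 p1 : X -> R) : (forall y, U y -> smoothat y p0) -> (forall y, U y -> smoothat y p1) ->
  is_d U (form1 (fun y v => (p0 y * v (c ord_max) - p1 y * v (c ord0))%:C%C))
    (fun y v => ((coordvec c y ord0 p0 + coordvec c y ord_max p1) *
       (v ord0 (c ord0) * v ord_max (c ord_max) - v ord0 (c ord_max) * v ord_max (c ord0)))%:C%C).
Proof.
move=> sp0 sp1 V Z oV VU sZ x Vx; rewrite koszul1; have Ux := VU x Vx.
have [t0 _] := sZ ord0 x Vx; have [t1 _] := sZ ord_max x Vx.
have der v W : tangent x v -> smooth_field V W ->
    cder v (fun y => (p0 y * W y (c ord_max) - p1 y * W y (c ord0))%:C%C) =
     (p0 x * v (fun y => W y (c ord_max)) + W x (c ord_max) * v p0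
      - (p1 x * v (fun y => W y (c ord0)) + W x (c ord0) * v p1))%:C%C.
  move=> tv sW; have sx0 := sp0 x Ux; have sx1 := sp1 x Ux.
  have sWc i : smoothat x (fun y => W y (c i)) by apply: (smooth_field_at oV sW Vx); apply: smc.
  rewrite /cder /= (tan_cst 0 tv) (tangentB tv); [|exact: smoothatM|exact: smoothatM].
  by rewrite !(tangentM tv).
rewrite /form1 !der // !bracketE; try exact: smc.
have := (chart_d_decomp p0 Ux t0, chart_d_decomp p1 Ux t0, chart_d_decomp p0 Ux t1, chart_d_decomp p1 Ux t1).
move: (coordvec c x ord0 p0) (coordvec c x ord0 p1) (coordvec c x ord_max p0)
  (coordvec c x ord_max p1) (p0 x) (p1 x).
move: (Z ord0 x p0) (Z ord0 x p1) (Z ord_max x p0) (Z ord_max x p1).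
move: (Z ord0 x (fun y => Z ord_max y (c ord0))) (Z ord0 x (fun y => Z ord_max y (c ord_max)))
  (Z ord_max x (fun y => Z ord0 y (c ord0))) (Z ord_max x (fun y => Z ord0 y (c ord_max)))
  (Z ord0 x (c ord0)) (Z ord0 x (c ord_max)) (Z ord_max x (c ord0)) (Z ord_max x (c ord_max)).
clear=> z1 z2 z3 z4 z5 z6 z7 z8 a1 a2 a3 a4 b1 b2 b3 b4 b5 b6 [[[-> ->] ->] ->].
by apply/eqP; rewrite eq_complex /=; apply/andP; split; apply/eqP; ring.
Qed.

Lemma d_conj_d : is_d U conj_d chart_area.
Proof. by apply: d_flux => y; apply: chart_d_smooth. Qed.

End ConjugateDifferential.

(** * The equations on the orbit surface *)

Section OrbitSurfaceEquations.
Context {R : realType} {M : fspace R} {Om : dform M 2} {Up : dform M 3}.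
Context {n : nat} {G : groupType} {CG : set (G -> R)} {act : G -> M -> M}.
Hypothesis hM : manifold 6 M.
Hypothesis hsym : symmetric_SU3 n CG act Om Up.
Local Notation C := R[i].
Local Notation ii := (0 +i* 1)%C.
Local Notation S := (adapted CG act Om Up).
Local Notation P := (P_bundle CG act Om Up).
Local Notation Sg := (orbit_space act).
Local Notation q := (orbit_proj act).
Variables (alpha xi0 xi1 xi2 xi3 : dform P 1).
Hypothesis real_alpha : real_form alpha.
Hypothesis hstr : structure_equations alpha xi0 xi1 xi2 xi3.
Variables (p1 p2 p3 p4 q1 q2 r : P -> C) (h1 h2 h3 h4 : P -> R).
Hypothesis htor : torsion_equations xi0 xi1 xi2 xi3 p1 p2 p3 p4 q1 q2 r h1 h2 h3 h4.
Hypothesis htypeI : typeI q1 q2 h1 h2 h3 h4.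
Variables (V : set M) (s : 'I_6 -> M -> tvec M).
Hypothesis sV : adapted_field (CG := CG) (act := act) (Om := Om) (Up := Up) V s.
Variables (z f g : Sg -> C) (u : Sg -> R).
Hypothesis smz : forall x, V x -> csmoothat (q x) z.
Hypothesis smf : forall x, V x -> csmoothat (q x) f.
Hypothesis smg : forall x, V x -> csmoothat (q x) g.
Hypothesis smu : forall x, V x -> smoothat (q x) u.
Local Notation E x := (expR (u (q x))).
Hypothesis dz : forall x v, V x -> tangent x v ->
  cder v (z \o q) = (E x)%:C%C * eta_of (s^~ x) v.
Hypothesis p4r : forall x (p0 : P), V x -> fbase p0 = x -> fframe p0 = s^~ x ->
  (p4 p0)^* = f (q x) * (E x)%:C%C /\ (r p0)^* = g (q x) * ((E x)%:C%C) ^+ 3.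

Let oV : fopen V. Proof. by case: sV. Qed.
Let ss i : smooth_field V (s i). Proof. by case: sV. Qed.
Let Ss x : V x -> S x (s^~ x). Proof. by case: sV => _ _; apply. Qed.
Let fs x : V x -> is_frame x (s^~ x). Proof. by move=> /Ss[/SU3_is_frame]. Qed.
Let ts x i : V x -> tangent x (s i x). Proof. by move=> /fs[]. Qed.

Local Notation e k := (s (inord k)).

Lemma orbit_invariant x (k : 'I_6) (h : Sg -> R) : V x -> (1 < k)%N -> smoothat (q x) h ->
  s k x (h \o q) = 0.
Proof.
move=> Vx k1 smh; rewrite -(pushE _ smh) (push_orbit_tangent hsym) //.
exact: (orbit_vector sV Vx k1).
Qed.

Let f1 (y : Sg) : R := complex.Re (f y).
Let f2 (y : Sg) : R := complex.Im (f y).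
Let g1 (y : Sg) : R := complex.Re (g y).
Let g2 (y : Sg) : R := complex.Im (g y).

Let pull x (h : Sg -> R) : smoothat (q x) h -> smoothat x (h \o q).
Proof. by move=> smh; apply: smooth_map_atE smh; apply: q_smooth. Qed.

(** Substituting p_4 = conj(f) e^u and r = conj(g) e^{3u} makes the derivatives of
    u disappear from the equations of p_4 and r. *)
Lemma horizontal_equations x : V x ->
  [/\ E x * (e 0 x (f1 \o q) - e 1 x (f2 \o q)) = - 12 * E x ^+ 2 * (f1 (q x) ^+ 2 + f2 (q x) ^+ 2) - 3,
      e 0 x (f2 \o q) + e 1 x (f1 \o q) = 0,
      E x * (e 0 x (g1 \o q) - e 1 x (g2 \o q)) = - 20 * (f1 (q x) * f2 (q x))
         - 2 * E x ^+ 2 * (f1 (q x) * g1 (q x) + f2 (q x) * g2 (q x)),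
      E x * (e 0 x (g2 \o q) + e 1 x (g1 \o q)) = 10 * (f1 (q x) ^+ 2 - f2 (q x) ^+ 2)
         + 2 * E x ^+ 2 * (f2 (q x) * g1 (q x) - f1 (q x) * g2 (q x)) &
      e 0 x (fun y => e 0 y (u \o q)) + e 1 x (fun y => e 1 y (u \o q))
        - e 0 x (u \o q) ^+ 2 - e 1 x (u \o q) ^+ 2
      = 2 * (6 + E x ^+ 6 * (g1 (q x) ^+ 2 + g2 (q x) ^+ 2) - E x ^+ 2 * (f1 (q x) ^+ 2 + f2 (q x) ^+ 2))].
Proof.
move=> Vx; have [pd [bpd fpd]] := frame_point_ex (Ss Vx).
pose sec x' : P := mkframe pd x' (s^~ x').
have secE y : V y -> fbase (sec y) = y /\ fframe (sec y) = s^~ y.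
  by move=> Vy; rewrite /sec fbase_mkframe ?fframe_mkframe //; apply: Ss.
pose T y := torsion_at p1 p2 p3 p4 r (sec y).
have TE y : V y -> [/\ re4 (T y) = f1 (q y) * E y, im4 (T y) = - f2 (q y) * E y,
    rer (T y) = g1 (q y) * E y ^+ 3 & imr (T y) = - g2 (q y) * E y ^+ 3].
  move=> Vy; have [by0 fy0] := secE y Vy; have [H4 Hr] := p4r Vy by0 fy0.
  rewrite /T /torsion_at /= -[p4 _]conjCK -[r _]conjCK H4 Hr /f1 /f2 /g1 /g2.
  by case: (f (q y)) (g (q y)) => [a b] [a' b']; rewrite -rmorphXn /=; split; ring.
have su y : V y -> smoothat y (u \o q) by move=> /smu /pull.
have sE y : V y -> smoothat y (fun x => E x) by move=> /su /smoothat_expR.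
have sfg y : V y -> [/\ smoothat y (f1 \o q), smoothat y (f2 \o q), smoothat y (g1 \o q) & smoothat y (g2 \o q)].
  by move=> Vy; have [? ?] := smf Vy; have [? ?] := smg Vy; split; apply: pull.
have inv_u y (k : 'I_6) : V y -> (1 < k)%N -> s k y (u \o q) = 0.
  by move=> Vy k1; apply: orbit_invariant => //; apply: smu.
have sE3 y : V y -> smoothat y (fun x => E x ^+ 3).
  move=> Vy; have := smoothatM (sE y Vy) (smoothatM (sE y Vy) (sE y Vy)).
  by apply: smoothat_eq; apply: nearbyT => x' /=; rewrite !exprS expr0 mulr1.
have smT y : V y -> [/\ smoothat y (fun x => f1 (q x) * E x), smoothat y (fun x => - f2 (q x) * E x),
    smoothat y (fun x => g1 (q x) * E x ^+ 3) & smoothat y (fun x => - g2 (q x) * E x ^+ 3)].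
  by move=> Vy; have [? ? ? ?] := sfg y Vy; split; apply: smoothatM;
    [| |apply: smoothatN| |  | |apply: smoothatN|]; (try by []); [exact: sE|exact: sE|exact: sE3|exact: sE3].
have nT y : V y -> [/\ nearby y [set x | re4 (T x) = f1 (q x) * E x],
   nearby y [set x | im4 (T x) = - f2 (q x) * E x], nearby y [set x | rer (T x) = g1 (q x) * E x ^+ 3] &
   nearby y [set x | imr (T x) = - g2 (q x) * E x ^+ 3]].
  by move=> Vy; split; apply: nearby_mono (oV Vy) => x' /TE[].
have dE y v : V y -> tangent y v -> v (fun x => E x) = E y * v (u \o q).
  by move=> Vy tv; apply: (tan_expR tv); apply: su.
have dE3 y v : V y -> tangent y v -> v (fun x => E x ^+ 3) = 3 * E y ^+ 3 * v (u \o q).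
  move=> Vy tv; have s1 := sE y Vy; have s2 := smoothatM s1 s1.
  rewrite (_ : (fun x => E x ^+ 3) = fun x => E x * (E x * E x)); last first.
    by apply/funext => x'; rewrite !exprS expr0 mulr1.
  by rewrite (tangentM tv s1 s2) (tangentM tv s1 s1) (dE y v Vy tv); ring.
have dT y v : V y -> tangent y v ->
    [/\ v (fun x => re4 (T x)) = E y * (v (f1 \o q) + f1 (q y) * v (u \o q)),
        v (fun x => im4 (T x)) = - E y * (v (f2 \o q) + f2 (q y) * v (u \o q)),
        v (fun x => rer (T x)) = E y ^+ 3 * (v (g1 \o q) + 3 * g1 (q y) * v (u \o q)) &
        v (fun x => imr (T x)) = - E y ^+ 3 * (v (g2 \o q) + 3 * g2 (q y) * v (u \o q))].
  move=> Vy tv; have [n1 n2 n3 n4] := nT y Vy; have [sf1 sf2 sg1 sg2] := sfg y Vy.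
  rewrite (tangent_germ tv n1) (tangent_germ tv n2) (tangent_germ tv n3) (tangent_germ tv n4).
  rewrite (tangentM tv sf1 (sE y Vy)) (tangentM tv (smoothatN sf2) (sE y Vy)).
  rewrite (tangentM tv sg1 (sE3 y Vy)) (tangentM tv (smoothatN sg2) (sE3 y Vy)).
  rewrite (tangentN tv sf2) (tangentN tv sg2) (dE y v Vy tv) (dE3 y v Vy tv) /=.
  by split; ring.
have inv_T y (k : 'I_6) : V y -> (1 < k)%N -> [/\ s k y (fun x => re4 (T x)) = 0, s k y (fun x => im4 (T x)) = 0,
     s k y (fun x => rer (T x)) = 0 & s k y (fun x => imr (T x)) = 0].
  move=> Vy k1; have [-> -> -> ->] := dT y (s k y) Vy (ts k Vy); have [? ?] := smf Vy; have [? ?] := smg Vy.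
  by rewrite !(orbit_invariant Vy k1) //; [split; ring|exact: smu].
have table y (j k l : 'I_6) : V y -> (j < k)%N -> structure_fun s j k l y =
    (half_table (T y) (e 0 y (u \o q)) (e 1 y (u \o q)) j k)`_l.
  move=> Vy jk; have [by0 fy0] := secE y Vy.
  apply: (frame_brackets hM real_alpha hstr htor htypeI sV (Z := z \o q)) => //.
  by move=> x' Vx'; have [sr si] := smz Vx'; split; [apply: (pull sr)|apply: (pull si)].
have smT' y : V y -> [/\ smoothat y (fun x => re4 (T x)), smoothat y (fun x => im4 (T x)),
    smoothat y (fun x => rer (T x)) & smoothat y (fun x => imr (T x))].
  move=> Vy; have [t1 t2 t3 t4] := smT y Vy.
  by split; [apply: smoothat_eq t1|apply: smoothat_eq t2|apply: smoothat_eq t3|apply: smoothat_eq t4];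
    apply: nearby_mono (oV Vy) => x' /TE[].
have [H1 H2 H3 H4 H5] := torsion_derivatives hM oV ss fs table smT' su inv_T inv_u Vx.
have [D0a D0b D0c D0d] := dT x (e 0 x) Vx (ts _ Vx); have [D1a D1b D1c D1d] := dT x (e 1 x) Vx (ts _ Vx).
have [Ta Tb Tc Td] := TE x Vx; have E0 : E x != 0 by rewrite gt_eqF ?expR_gt0.
move: H1 H2 H3 H4 H5; rewrite D0a D0b D0c D0d D1a D1b D1c D1d Ta Tb Tc Td.
move: (E x) E0 (e 0 x (f1 \o q)) (e 0 x (f2 \o q)) (e 0 x (g1 \o q)) (e 0 x (g2 \o q))
  (e 1 x (f1 \o q)) (e 1 x (f2 \o q)) (e 1 x (g1 \o q)) (e 1 x (g2 \o q))
  (e 0 x (fun y => e 0 y (u \o q))) (e 1 x (fun y => e 1 y (u \o q))) (e 0 x (u \o q)) (e 1 x (u \o q))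
  (f1 (q x)) (f2 (q x)) (g1 (q x)) (g2 (q x)).
clear D0a D0b D0c D0d D1a D1b D1c D1d Ta Tb Tc Td => Ex E0 a1 a2 a3 a4 b1 b2 b3 b4 u00 u11 u0 u1 F1 F2 G1 G2 H1 H2 H3 H4 H5.
have E2 : Ex ^+ 2 != 0 by rewrite expf_neq0.
split; [lra|apply: (mulfI E0); lra|apply: (mulfI E2); lra|apply: (mulfI E2); lra|].
by rewrite H5; ring.
Qed.

End OrbitSurfaceEquations.

Section SurfaceChart.
Context {R : realType} {M : fspace R} {G : groupType} {act : G -> M -> M}.
Local Notation C := R[i].
Local Notation ii := (0 +i* 1)%C.
Local Notation Sg := (orbit_space act).
Variables (U : set Sg) (z : Sg -> C).
Hypothesis zc : chart U (zchart z).
Implicit Types (y : Sg).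
Local Notation dx y := (coordvec (zchart z) y ord0).
Local Notation dy y := (coordvec (zchart z) y ord_max).

(** With a = (dh/dx - i dh/dy) / 2 and b = (dh/dx + i dh/dy) / 2 one has
    dh = a dz + b dzbar. *)
Lemma dzbar_chart (h : Sg -> C) y b : U y -> cder (dx y) h + ii * cder (dy y) h = 2 * b ->
  is_dzbar z h y b.
Proof.
move=> Uy Hb; exists (cder (dx y) h - b) => v tv.
have D f := chart_d_decomp zc f Uy tv.
rewrite [LHS](_ : _ = (v (zchart z ord0))%:C%C * cder (dx y) h + (v (zchart z ord_max))%:C%C * cder (dy y) h).
  have -> : cder v z = (v (zchart z ord0) +i* v (zchart z ord_max))%C by [].
  move: Hb; move: (v _) (v _) => a c; move: (cder (dx y) h) (cder (dy y) h) => [X1 X2] [Y1 Y2] Hb.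
  have B1 := congr1 (@complex.Re R) Hb; have B2 := congr1 (@complex.Im R) Hb.
  move: B1 B2; clear Hb; case: b => b1 b2 /= B1 B2.
  have -> : Y1 = 2 * b2 - X2 by lra.
  have -> : Y2 = X1 - 2 * b1 by lra.
  by apply/eqP; rewrite eq_complex /=; apply/andP; split; apply/eqP; ring.
rewrite /cder (D (fun y => complex.Re (h y))) (D (fun y => complex.Im (h y))).
move: (v _) (v _) (dx y (fun y => complex.Re (h y))) (dx y (fun y => complex.Im (h y)))
  (dy y (fun y => complex.Re (h y))) (dy y (fun y => complex.Im (h y))) => *.
by apply/eqP; rewrite eq_complex /=; apply/andP; split; apply/eqP; ring.
Qed.

Context {Om : dform M 2} {Up : dform M 3} {CG : set (G -> R)}.
Variables (V : set M) (s : 'I_6 -> M -> tvec M) (u : Sg -> R).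
Hypothesis sV : adapted_field (CG := CG) (act := act) (Om := Om) (Up := Up) V s.
Hypothesis VU : forall x, V x -> U (orbit_proj act x).
Hypothesis smu : forall y, U y -> smoothat y u.
Local Notation q := (orbit_proj act).
Local Notation E x := (expR (u (q x))).
Local Notation e k := (s (inord k)).
Hypothesis dz : forall x v, V x -> tangent x v ->
  cder v (z \o q) = (E x)%:C%C * eta_of (s^~ x) v.

Let oV : fopen V. Proof. by case: sV. Qed.
Let ss i : smooth_field V (s i). Proof. by case: sV. Qed.
Let ts x i : V x -> tangent x (s i x). Proof. by case: sV => _ _ Ss /Ss[/SU3_is_frame[]]. Qed.

(** Since dz = e^u eta, and eta takes the values 1 and i on these two vectors. *)
Lemma horizontal_push x : V x ->
  push q x (e 0 x) = (fun h => E x * dx (q x) h) /\ push q x (e 1 x) = (fun h => E x * dy (q x) h).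
Proof.
move=> Vx; have Uy := VU Vx.
have coord k i : push q x (e k x) (zchart z i) =
    if i == ord0 then E x * unit_at 0 (inord k : 'I_6) else E x * unit_at 1 (inord k : 'I_6).
  rewrite pushE; last exact: (chart_smoothat zc).
  have := dz Vx (ts (inord k) Vx); rewrite (eta_of_frame sV) // /zchart /cder => H.
  by case: ifP => _; [have := congr1 (@complex.Re R) H|have := congr1 (@complex.Im R) H];
    rewrite /= => H1; apply: etrans H1 _; ring.
have tq k : tangent (q x) (push q x (e k x)) by apply: push_tangent; [exact: q_smooth|exact: ts].
split; apply/funext => h; rewrite (chart_d_decomp zc h Uy (tq _)) !coord /= /unit_at !inordK //=.
  by rewrite mulr1 mulr0 mul0r addr0.
by rewrite mulr1 mulr0 mul0r add0r.
Qed.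

Lemma horizontal_d x (h : Sg -> R) : V x -> smoothat (q x) h ->
  e 0 x (h \o q) = E x * dx (q x) h /\ e 1 x (h \o q) = E x * dy (q x) h.
Proof.
move=> Vx smh; have [H0 H1] := horizontal_push Vx.
by split; [have := congr1 (fun v : tvec Sg => v h) H0|have := congr1 (fun v : tvec Sg => v h) H1];
  rewrite pushE.
Qed.

(** On the right e^{2u} times the flat Laplacian, the Laplacian of the metric
    e^{-2u} |dz|^2 up to sign. *)
Lemma horizontal_laplacian x : V x ->
  e 0 x (fun y : M => e 0 y (u \o q)) + e 1 x (fun y : M => e 1 y (u \o q))
    - e 0 x (u \o q) ^+ 2 - e 1 x (u \o q) ^+ 2 = E x ^+ 2 * chart_laplacian (zchart z) u (q x).
Proof.
move=> Vx; have Uy := VU Vx.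
have su (y : M) : V y -> smoothat y (u \o q).
  by move=> Vy; apply: smooth_map_atE (smu (VU Vy)); apply: q_smooth.
have second k i : (forall y : M, V y -> e k y (u \o q) = E y * chart_d (zchart z) u i (q y)) ->
    e k x (chart_d (zchart z) u i \o q) = E x * coordvec (zchart z) (q x) i (chart_d (zchart z) u i) ->
    e k x (fun y : M => e k y (u \o q)) = E x ^+ 2 * coordvec (zchart z) (q x) i (chart_d (zchart z) u i)
       + e k x (u \o q) ^+ 2.
  move=> D1 D2.
  have sd : smoothat (q x) (chart_d (zchart z) u i) by apply: (chart_d_smooth zc smu).
  have sd' : smoothat x (chart_d (zchart z) u i \o q) by apply: smooth_map_atE sd; apply: q_smooth.
  have n0 : nearby x [set y : M | e k y (u \o q) = E y * (chart_d (zchart z) u i \o q) y].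
    by apply: nearby_mono (oV Vx) => y Vy /=; rewrite D1.
  rewrite (tangent_germ (ts _ Vx) n0) (tangentM (ts _ Vx) (smoothat_expR (su x Vx)) sd') D2.
  rewrite (tan_expR (ts _ Vx) (su x Vx)) (D1 x Vx) /=.
  move: (coordvec _ _ _ _) (chart_d _ _ _ _) => A B; ring.
have sd i : smoothat (q x) (chart_d (zchart z) u i) by apply: (chart_d_smooth zc smu).
have h1 (y : M) (Vy : V y) := horizontal_d Vy (smu (VU Vy)).
rewrite (second 0%N ord0) ?(second 1%N ord_max); first last.
- by case: (horizontal_d Vx (sd ord0)).
- by move=> y /h1[H _]; exact: H.
- by case: (horizontal_d Vx (sd ord_max)).
- by move=> y /h1[_ H]; exact: H.
rewrite /chart_laplacian; move: (coordvec _ _ _ _) (coordvec _ _ _ _) (e 0 x _) (e 1 x _) => A B a b; ring.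
Qed.

End SurfaceChart.

(** * The differential system *)

Section FinalAlgebra.
Context {R : realType}.
Local Notation C := R[i].

Lemma norm_sq (w : C) : `|w| ^+ 2 = (complex.Re w ^+ 2 + complex.Im w ^+ 2)%:C%C.
Proof. by rewrite normCK; case: w => a b; apply/eqP; rewrite eq_complex /=; apply/andP; split; apply/eqP; ring. Qed.

Lemma expR_inv2 (t : R) : expR (- 2 * t) * expR t ^+ 2 = 1.
Proof.
rewrite expr2 -!expRD (_ : _ + _ = 0) ?expR0 //; ring.
Qed.

Lemma double_rhs (N K : R) :
  2 * (- 6 * N%:C%C - 3 / 2 * K%:C%C) = (- 12 * N - 3 * K)%:C%C :> C.
Proof.
have -> : 3 / 2 = (3 / 2)%:C%C :> C by rewrite rmorphM fmorphV !rmorph_nat.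
by apply/eqP; rewrite eq_complex /=; apply/andP; split; apply/eqP; field.
Qed.

End FinalAlgebra.


Lemma orbit_proj_surj (R : realType) (G : Type) (M : fspace R) (act : G -> M -> M)
  (y : orbit_space act) : exists x, y = orbit_proj act x.
Proof. by case: y => O [x Ox]; exists x; subst O. Qed.

Theorem proposition1p3 (R : realType)
  (* the nearly-Kähler 6-manifold and its symmetry group *)
  (M : fspace R) (Om : dform M 2) (Up : dform M 3)
  (n : nat) (G : groupType) (CG : set (G -> R)) (act : G -> M -> M)
  (hM : manifold 6 M) (hSU3 : SU3_structure Om Up) (hNK : nearly_Kahler Om Up)
  (hsym : symmetric_SU3 n CG act Om Up)
  (* the forms alpha, xi_j on P *)
  (alpha xi0 xi1 xi2 xi3 : dform (P_bundle CG act Om Up) 1)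
  (halpha : is_form setT alpha) (hxi0 : is_form setT xi0)
  (hxi1 : is_form setT xi1) (hxi2 : is_form setT xi2) (hxi3 : is_form setT xi3)
  (real_alpha : real_form alpha) (real_xi0 : real_form xi0)
  (hstr : structure_equations alpha xi0 xi1 xi2 xi3)
  (* the torsion functions on P *)
  (p1 p2 p3 p4 q1 q2 r : P_bundle CG act Om Up -> R[i])
  (h1 h2 h3 h4 : P_bundle CG act Om Up -> R)
  (smooth_p : [/\ smooth_invariant act p1, smooth_invariant act p2,
     smooth_invariant act p3 & smooth_invariant act p4])
  (smooth_qr : [/\ smooth_invariant act q1, smooth_invariant act q2 &
     smooth_invariant act r])
  (smooth_h : [/\ smooth_invariant act (rfun h1), smooth_invariant act (rfun h2),
     smooth_invariant act (rfun h3) & smooth_invariant act (rfun h4)])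
  (htor : torsion_equations xi0 xi1 xi2 xi3 p1 p2 p3 p4 q1 q2 r h1 h2 h3 h4)
  (htypeI : typeI q1 q2 h1 h2 h3 h4)
  (* the metric of Sigma = M/G, and p4, r as functions on F *)
  (gS : forall y : orbit_space act,
     tvec (orbit_space act) -> tvec (orbit_space act) -> R)
  (hgS : is_orbit_metric (adapted CG act Om Up) gS)
  (p4F rF : F_bundle gS -> R[i])
  (hp4F : forall (p : P_bundle CG act Om Up) (p' : F_bundle gS),
     natural_map p p' -> p4F p' = p4 p)
  (hrF : forall (p : P_bundle CG act Om Up) (p' : F_bundle gS),
     natural_map p p' -> rF p' = r p)
  (* an oriented coordinate domain, and the functions f, g, u on it *)
  (U : set (orbit_space act)) (Fp : set (F_bundle gS))
  (hU : fopen U) (hFp : SO2_subbundle U Fp)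
  (z : orbit_space act -> R[i]) (hz : holomorphic_coordinate U Fp z)
  (f g : orbit_space act -> R[i]) (u : orbit_space act -> R)
  (smooth_f : forall y, U y -> csmoothat y f)
  (smooth_g : forall y, U y -> csmoothat y g)
  (smooth_u : forall y, U y -> smoothat y u)
  (hf : forall (p : F_bundle gS) w, Fp p -> tangent p w ->
     (p4F p)^* * etaF p w = f (fbase p) * pull_d z p w)
  (hg : forall (p : F_bundle gS) w1 w2 w3, Fp p ->
     tangent p w1 -> tangent p w2 -> tangent p w3 ->
     (rF p)^* * (etaF p w1 * etaF p w2 * etaF p w3) =
     g (fbase p) * (pull_d z p w1 * pull_d z p w2 * pull_d z p w3))
  (hu : forall (p : F_bundle gS) w1 w2, Fp p -> tangent p w1 -> tangent p w2 ->
     expR (2 * u (fbase p)) * complex.Re (etaF p w1 * (etaF p w2)^*) =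
     complex.Re (pull_d z p w1 * (pull_d z p w2)^*)) :
  (forall y, U y ->
     is_dzbar z f y
       (- 6 * `|f y| ^+ 2 - 3 / 2 * (expR (- 2 * u y))%:C%C) /\
     is_dzbar z g y
       (5 * (0 +i* 1)%C * f y ^+ 2 * (expR (- 2 * u y))%:C%C - (f y)^* * g y)) /\
  is_laplacian U Fp u (fun y =>
    - 2 * (6 + complex.Re (`|g y| ^+ 2) * expR (6 * u y)
             - complex.Re (`|f y| ^+ 2) * expR (2 * u y))).
Proof.
have zc : chart U (zchart z) by apply: zchartP hz.
have sz y : U y -> csmoothat y z by apply: z_smooth hz _.
pose D (i : 'I_2) (h : orbit_space act -> R) y := coordvec (zchart z) y i h.
pose f1 y := complex.Re (f y); pose f2 y := complex.Im (f y).
pose g1 y := complex.Re (g y); pose g2 y := complex.Im (g y).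
have surface_eqs y : U y -> let K := expR (- 2 * u y) in
  [/\ D ord0 f1 y - D ord_max f2 y = - 12 * (f1 y ^+ 2 + f2 y ^+ 2) - 3 * K
      /\ D ord0 f2 y + D ord_max f1 y = 0,
      D ord0 g1 y - D ord_max g2 y = - 20 * (f1 y * f2 y) * K - 2 * (f1 y * g1 y + f2 y * g2 y)
      /\ D ord0 g2 y + D ord_max g1 y = 10 * (f1 y ^+ 2 - f2 y ^+ 2) * K + 2 * (f2 y * g1 y - f1 y * g2 y),
      expR (u y) ^+ 2 * chart_laplacian (zchart z) u y = 2 * (6 + expR (u y) ^+ 6 * (g1 y ^+ 2 + g2 y ^+ 2)
          - expR (u y) ^+ 2 * (f1 y ^+ 2 + f2 y ^+ 2)) &
      forall p, Fp p -> fbase p = y -> exists al be : R, [/\ al ^+ 2 + be ^+ 2 = 1,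
        fframe p ord0 = (fun h => expR (u y) * (al * D ord0 h y + be * D ord_max h y)) &
        fframe p ord_max = (fun h => expR (u y) * (- be * D ord0 h y + al * D ord_max h y))]].
  have [x ->] := orbit_proj_surj y => Uy.
  have [V [s [sV Vx VU G0]]] := gauge hM hSU3 hsym hgS hp4F hrF hU hFp hz smooth_u hf hg hu Uy.
  have dz x' v : V x' -> tangent x' v ->
      cder v (z \o orbit_proj act) = (expR (u (orbit_proj act x')))%:C%C * eta_of (s^~ x') v.
    by move=> /G0[H _ _]; apply: H.
  have p4r x' (p0 : P_bundle CG act Om Up) : V x' -> fbase p0 = x' -> fframe p0 = s^~ x' ->
    (p4 p0)^* = f (orbit_proj act x') * (expR (u (orbit_proj act x')))%:C%C /\
    (r p0)^* = g (orbit_proj act x') * ((expR (u (orbit_proj act x')))%:C%C) ^+ 3.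
    by move=> /G0[_ H _]; apply: H.
  have [sf1 sf2] := smooth_f _ Uy; have [sg1 sg2] := smooth_g _ Uy.
  have hd h sh := horizontal_d zc sV VU dz Vx (h := h) sh.
  have [df10 df11] := hd _ sf1; have [df20 df21] := hd _ sf2.
  have [dg10 dg11] := hd _ sg1; have [dg20 dg21] := hd _ sg2.
  have [H1 H2 H3 H4 H5] := horizontal_equations hM hsym real_alpha hstr htor htypeI sV
    (fun x Vx => sz _ (VU x Vx)) (fun x Vx => smooth_f _ (VU x Vx)) (fun x Vx => smooth_g _ (VU x Vx))
    (fun x Vx => smooth_u _ (VU x Vx)) dz p4r Vx.
  rewrite (horizontal_laplacian zc sV VU smooth_u dz Vx) in H5.
  rewrite df10 df21 in H1; rewrite df20 df11 in H2; rewrite dg10 dg21 in H3; rewrite dg20 dg11 in H4.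
  move=> K; have KE : K * expR (u (orbit_proj act x)) ^+ 2 = 1 by apply: expR_inv2.
  have E0 : expR (u (orbit_proj act x)) != 0 by rewrite gt_eqF ?expR_gt0.
  (* The frame of p is a rotation of the image of the normalized frame. *)
  have frames p : Fp p -> fbase p = orbit_proj act x -> exists al be : R, [/\ al ^+ 2 + be ^+ 2 = 1,
        fframe p ord0 = (fun h => expR (u (orbit_proj act x)) * (al * D ord0 h (orbit_proj act x) + be * D ord_max h (orbit_proj act x))) &
        fframe p ord_max = (fun h => expR (u (orbit_proj act x)) * (- be * D ord0 h (orbit_proj act x) + al * D ord_max h (orbit_proj act x)))].
    have [_ ss Ss] := sV; have [_ _ FpN] := G0 x Vx.
    have [pN [bN fN]] := frame_point_ex (image_orthonormal hgS hz sV VU Vx).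
    move=> Fpp bp; have Fpn := FpN pN bN fN.
    have [al [be [ab pE]]] := iffLR (SO2_torsor hFp Fpn (etrans bp (esym bN))) Fpp.
    have [N0 N1] := horizontal_push zc sV VU dz Vx.
    have W0 : fframe pN ord0 = push (orbit_proj act) x (s (inord 0) x).
      by rewrite fN /image_frame; congr (push _ _ (s _ _)); apply: val_inj; rewrite /= inordK.
    have W1 : fframe pN ord_max = push (orbit_proj act) x (s (inord 1) x).
      by rewrite fN /image_frame; congr (push _ _ (s _ _)); apply: val_inj; rewrite /= inordK.
    exists al, be; split=> //; rewrite pE /= W0 W1 N0 N1; apply/funext => h; rewrite /D;
      move: (coordvec _ _ _ _) (coordvec _ _ _ _) => A B; ring.
  split; [| |exact: H5|exact: frames].
    move: H1 H2 E0 KE; rewrite /D /f1 /f2; move: (coordvec _ _ _ _) (coordvec _ _ _ _) (coordvec _ _ _ _) (coordvec _ _ _ _).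
    move: (expR (u _)) K (complex.Re (f _)) (complex.Im (f _)).
    clear; move=> X K F1 F2 A1 A2 A3 A4 H1 H2 E0 KE; have E2 : X ^+ 2 != 0 by rewrite expf_neq0.
    split; [apply: (mulfI E2)|apply: (mulfI E0)]; lra.
  move: H3 H4 E0 KE; rewrite /D /f1 /f2 /g1 /g2; move: (coordvec _ _ _ _) (coordvec _ _ _ _) (coordvec _ _ _ _) (coordvec _ _ _ _).
  move: (expR (u _)) K (complex.Re (f _)) (complex.Im (f _)) (complex.Re (g _)) (complex.Im (g _)).
  clear; move=> X K F1 F2 G1 G2 A1 A2 A3 A4 H1 H2 E0 KE; have E2 : X ^+ 2 != 0 by rewrite expf_neq0.
  have K1 : K * X ^+ 2 * (F1 * F2) = F1 * F2 by rewrite KE mul1r.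
  have K2 : K * X ^+ 2 * (F1 ^+ 2 - F2 ^+ 2) = F1 ^+ 2 - F2 ^+ 2 by rewrite KE mul1r.
  by split; apply: (mulfI E2); lra.
split.
  move=> y Uy; have [[F1 F2] [G1 G2] _ _] := surface_eqs y Uy.
  split; apply: (dzbar_chart zc Uy); rewrite /cder.
    rewrite norm_sq double_rhs; clear G1 G2; move: F1 F2; rewrite /D /f1 /f2.
    move: (coordvec _ _ _ _) (coordvec _ _ _ _) (coordvec _ _ _ _) (coordvec _ _ _ _) => A1 A2 A3 A4 <- H.
    by apply/eqP; rewrite eq_complex /=; apply/andP; split; apply/eqP; [ring|move: H; lra].
  clear F1 F2; move: G1 G2; rewrite /D /f1 /f2 /g1 /g2.
  move: (coordvec _ _ _ _) (coordvec _ _ _ _) (coordvec _ _ _ _) (coordvec _ _ _ _) (f y) (g y) (expR _).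
  clear; move=> A1 A2 A3 A4 [a1 a2] [b1 b2] K /= G1 G2.
  by apply/eqP; rewrite eq_complex /=; apply/andP; split; apply/eqP; lra.
have Re_norm w : complex.Re (`|w| ^+ 2 : R[i]) = complex.Re w ^+ 2 + complex.Im w ^+ 2 by rewrite norm_sq.
exists (conj_d (zchart z) u), (chart_area (zchart z) u); split.
- exact: (conj_d_form zc smooth_u).
- exact: (chart_area_form zc smooth_u).
- move=> p Fpp; have Uy := SO2_over hFp Fpp; have [_ _ _ /(_ p Fpp erefl)] := surface_eqs _ Uy.
  move=> [al [be [_ E0 E1]]]; rewrite /conj_d /du /form1 E0 E1 /D !(coordvec_coord zc) //= /chart_d.
  rewrite !mulr0 !mulr1 ?addr0 ?add0r.
  move: (coordvec _ _ _ _) (coordvec _ _ _ _) (expR _) => A B K.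
  by split; rewrite -?rmorphN /=; congr (_%:C%C); ring.
- exact: (d_conj_d zc smooth_u).
- move=> p Fpp; have Uy := SO2_over hFp Fpp; have [_ _ L /(_ p Fpp erefl)] := surface_eqs _ Uy.
  cbv beta; rewrite !Re_norm !expRM_natl => -[al [be [ab E0 E1]]]; rewrite /chart_area E0 E1 /D !(coordvec_coord zc) //=.
  rewrite !mulr0 !mulr1 ?addr0 ?add0r; congr (_%:C%C).
  move: L ab; rewrite /f1 /f2 /g1 /g2; move: (chart_laplacian _ _ _) (expR _) (complex.Re (f _)) (complex.Im (f _)) (complex.Re (g _)) (complex.Im (g _)).
  clear; move=> L X F1 F2 G1 G2 H ab.
  transitivity (X ^+ 2 * L * (al ^+ 2 + be ^+ 2)); first by ring.
  by rewrite H ab; ring.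
Qed.
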